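(* There is an algorithm that, given an undirected graph $G$ with $n$ vertices, determines whether $G$ is a partial cube and, if it is, constructs a valid partial cube labeling of $G$, in time $O(n^2)$.
   Context: All graphs are finite, simple and undirected; $d(u,v)$ denotes the number of edges on a shortest path between $u$ and $v$. A graph $G$ is a partial cube if its vertices can be labeled by bitvectors (all of the same length) so that for every two vertices $u,v$, $d(u,v)$ equals the Hamming distance between the labels of $u$ and $v$; such a labeling is a (valid) partial cube labeling. Model of computation: a RAM in which machine words hold integers of at least $\log n$ bits, and addition, bitwise Boolean operations, comparisons and table lookups on $\log n$-bit integers take constant time. *)

(* Defs.v *)
From mathcomp Require Import all_boot.

Set Implicit Arguments.
Unset Strict Implicit.
Unset Printing Implicit Defensive.

Definition bigO (f g : nat -> nat) : Prop :=
  exists c n0 : nat, forall n : nat, n0 <= n -> f n <= c * g n.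

Definition is_path (V : finType) (e : rel V) (u v : V) (p : seq V) : Prop :=
  [/\ path e u p, last u p = v & uniq (u :: p)].

(* [u :: p] has [size p] edges.  For [u], [v] in different components no [d]
   satisfies the relation, i.e. the distance is infinite. *)
Definition is_dist (V : finType) (e : rel V) (u v : V) (d : nat) : Prop :=
  (exists2 p, is_path e u v p & size p = d) /\
  (forall p, is_path e u v p -> d <= size p).

Definition hamming (k : nat) (a b : k.-tuple bool) : nat :=
  #|[set i : 'I_k | tnth a i != tnth b i]|.

Definition partial_cube_labeling (V : finType) (e : rel V)
    (k : nat) (lab : V -> k.-tuple bool) : Prop :=
  forall u v : V, is_dist e u v (hamming (lab u) (lab v)).

Definition partial_cube (V : finType) (e : rel V) : Prop :=
  exists (k : nat) (lab : V -> k.-tuple bool), partial_cube_labeling e lab.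

(* A RAM with [w]-bit words, represented as the natural numbers below [2 ^ w].
   It has registers and tables, all of whose cells hold one word.  Registers,
   tables and jump targets are named by constants of the program text, so a
   program uses only finitely many registers and tables.  A cell of a table is
   addressed by two words: with words of only [log n] bits, one-word addresses
   would reach fewer cells than it takes to store a graph on [n] vertices, or
   a labeling of it. *)
Inductive instr : Type :=
| Const (x k : nat)       (* R[x] := k mod 2^w *)
| Add (x y z : nat)       (* R[x] := (R[y] + R[z]) mod 2^w *)
| And (x y z : nat)
| Or (x y z : nat)
| Xor (x y z : nat)
| Not (x y : nat)
| Lookup (x t y z : nat)  (* R[x] := T_t[R[y], R[z]] *)
| Store (t y z x : nat)   (* T_t[R[y], R[z]] := R[x] *)
| JumpLt (y z l : nat)    (* if R[y] < R[z] then goto l *)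
| JumpEq (y z l : nat)    (* if R[y] = R[z] then goto l *)
| Halt (b : bool).        (* stop with answer b *)

Definition program := seq instr.

Record config : Type := Config {
  pc : nat;
  reg : nat -> nat;
  tab : nat -> nat -> nat -> nat
}.

Definition set_reg (c : config) (x v : nat) : config :=
  Config (pc c).+1 (fun x' => if x' == x then v else reg c x') (tab c).

Definition set_tab (c : config) (t i j v : nat) : config :=
  Config (pc c).+1 (reg c)
    (fun t' i' j' =>
       if [&& t' == t, i' == i & j' == j] then v else tab c t' i' j').

Definition jump_if (c : config) (b : bool) (l : nat) : config :=
  Config (if b then l else (pc c).+1) (reg c) (tab c).

(* Both a [Halt] instruction and a program counter outside the program leave
   the configuration unchanged; only the former counts as halting, see
   [answer]. *)
Definition step (w : nat) (P : program) (c : config) : config :=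
  let R := reg c in
  match onth P (pc c) with
  | Some (Const x k) => set_reg c x (k %% 2 ^ w)
  | Some (Add x y z) => set_reg c x ((R y + R z) %% 2 ^ w)
  | Some (And x y z) => set_reg c x (Nat.land (R y) (R z))
  | Some (Or x y z) => set_reg c x (Nat.lor (R y) (R z))
  | Some (Xor x y z) => set_reg c x (Nat.lxor (R y) (R z))
  | Some (Not x y) => set_reg c x ((2 ^ w).-1 - R y)
  | Some (Lookup x t y z) => set_reg c x (tab c t (R y) (R z))
  | Some (Store t y z x) => set_tab c t (R y) (R z) (R x)
  | Some (JumpLt y z l) => jump_if c (R y < R z) l
  | Some (JumpEq y z l) => jump_if c (R y == R z) l
  | Some (Halt _) | None => c
  end.

Definition run (w : nat) (P : program) (t : nat) (c : config) : config :=
  iter t (step w P) c.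

Definition answer (P : program) (c : config) : option bool :=
  if onth P (pc c) is Some (Halt b) then Some b else None.

(* Register 0 holds [n], table 0 holds the adjacency matrix (as 0/1 words), and
   every other register and cell holds 0. *)
Definition input (n : nat) (e : rel 'I_n) : config :=
  Config 0
    (fun x => if x == 0 then n else 0)
    (fun t i j =>
       match insub i, insub j with
       | Some u, Some v => (t == 0) && e u v : nat
       | _, _ => 0
       end).

(* Register 0 holds the common length [k] of the labels, and entry [(u, i)] of
   table 1 holds bit [i] of the label of vertex [u]. *)
Definition outputs (n k : nat) (c : config) (lab : 'I_n -> k.-tuple bool) :
    Prop :=
  reg c 0 = k /\
  forall (u : 'I_n) (i : 'I_k), tab c 1 u i = tnth (lab u) i :> nat.

(* Main.v *)
(* A graph is contracted in stages.  Every stage picks a vertex [r] of maximum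
   degree [D]; the [D] edges at [r] lie in different classes of edges that flip
   the same bit.  Relative to [r], the label of a vertex with two neighbours
   closer to [r] is the union of the labels of these two, and a vertex with only
   one such neighbour inherits the bits of the [D] classes from it; hence these
   bits are found in time O(n D) after a breadth-first search.  Then the [D]
   classes are contracted and parallel edges are merged.  Since [D] is the
   maximum degree and the number of classes is less than [n], all stages take
   time O(n^2) together, where merging vertices is paid for by the decrease of
   the number of vertices.  If the input is a partial cube, this yields a valid
   labeling.

   It remains to check an arbitrary labeling in time O(n^2).  Along a spanning
   tree the matrix of Hamming distances is updated by +1 or -1 per entry.  All
   edges must have Hamming distance 1, and all [u <> v] must have a neighbour of
   [u] that is closer to [v].  The number of these neighbours, for all [u], also
   changes by at most 1 when [v] moves along a tree edge that flips bit [c], and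
   changes exactly when [u] has an edge that flips [c].  The bit flipped by an
   edge is the exclusive or of two hash values of its ends.  No bit-parallelism
   is needed. *)

Require Import Defs.
From Stdlib Require Import PeanoNat.
From HB Require Import structures.
From mathcomp Require Import all_boot zify.

Set Implicit Arguments.
Unset Strict Implicit.
Unset Printing Implicit Defensive.

(** * Structured programs and their compilation *)

(** Correctness of the labeller is shown for partial cubes only; for other graphs nothing is known
    about its table, so the checker even tests that the entries are bits. What must hold for every
    input is the running time and [k <= n]. Both come from the register [rrem], which holds [n - k]:
    a stage whose [D] exceeds it is skipped, so the [D] of the executed stages sum to at most [n].
    On a partial cube no stage is skipped, because fewer than [n] coordinates are nonconstant. On a
    partial cube, a labeling [l] that the program cannot see is fixed. The list [F] of coordinates
    contracted so far then describes the contracted graph: its distance [dq F] is the Hamming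
    distance outside [F]. The columns written by the program agree with those of [l] up to
    complement. The edges to contract are recognised in constant time: the number of new bits set at
    the two ends differs exactly for them. Programs use counted loops only, running to [n], [D] or
    [k], with guarded bodies in place of early exits; so most costs are products of loop bounds that
    the syntax shows. *)

Record state := State { R : nat -> nat; T : nat -> nat -> nat -> nat }.

Definition setr s x v :=
  State (fun x' => if x' == x then v else R s x') (T s).

Definition sett s t i j v :=
  State (R s)
    (fun t' i' j' => if [&& t' == t, i' == i & j' == j] then v else T s t' i' j').

Inductive cmd : Type :=
| Skip
| Op (i : instr)
| Seq (c d : cmd)
| If (lt : bool) (y z : nat) (c d : cmd)
| For (x y : nat) (c : cmd).

(* Register [1] holds the constant 1 by which the loops are incremented. *)
Notation rone := 1 (only parsing).

Section Semantics.

Variable w : nat.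

Definition exec_op (i : instr) (s : state) : state :=
  match i with
  | Const x k => setr s x (k %% 2 ^ w)
  | Add x y z => setr s x ((R s y + R s z) %% 2 ^ w)
  | And x y z => setr s x (Nat.land (R s y) (R s z))
  | Xor x y z => setr s x (Nat.lxor (R s y) (R s z))
  | Not x y => setr s x ((2 ^ w).-1 - R s y)
  | Lookup x t y z => setr s x (T s t (R s y) (R s z))
  | Store t y z x => sett s t (R s y) (R s z) (R s x)
  | _ => s
  end.

Definition test (lt : bool) (y z : nat) (s : state) :=
  if lt then R s y < R s z else R s y == R s z.

(** The variable is overwritten with [i.+1] after each round, not incremented. Since [wf] forbids
    the body to write it, this agrees with the increment in the compiled code. *)
Definition loop (f : state -> state) x m s :=
  iteri m (fun i s' => setr (f s') x i.+1) (setr s x 0).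

Fixpoint exec (c : cmd) (s : state) : state :=
  match c with
  | Skip => s
  | Op i => exec_op i s
  | Seq c d => exec d (exec c s)
  | If lt y z c d => if test lt y z s then exec c s else exec d s
  | For x y c => loop (exec c) x (R s y) s
  end.

(** The constants count the compiled control flow. A conditional takes a test and at most one
    further jump. A loop takes its initialisation, the last failing test and the jump out; each
    round takes a test, an increment and a jump back. *)
Fixpoint cost (c : cmd) (s : state) : nat :=
  match c with
  | Skip => 0
  | Op i => 1
  | Seq c d => cost c s + cost d (exec c s)
  | If lt y z c d => 2 + (if test lt y z s then cost c s else cost d s)
  | For x y c => 3 + \sum_(i < R s y) (3 + cost c (loop (exec c) x i s))
  end.

Lemma loopS f x m s : loop f x m.+1 s = setr (f (loop f x m s)) x m.+1.
Proof. by []. Qed.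

Definition wr_op (i : instr) : seq nat :=
  match i with
  | Const x _ | Add x _ _ | And x _ _ | Xor x _ _ | Not x _
  | Lookup x _ _ _ => [:: x]
  | _ => [::]
  end.

Fixpoint wr (c : cmd) : seq nat :=
  match c with
  | Skip => [::]
  | Op i => wr_op i
  | Seq c d | If _ _ _ c d => wr c ++ wr d
  | For x y c => x :: wr c
  end.

Fixpoint wt (c : cmd) : seq nat :=
  match c with
  | Op (Store t _ _ _) => [:: t]
  | Seq c d | If _ _ _ c d => wt c ++ wt d
  | For x y c => wt c
  | _ => [::]
  end.

Definition basic (i : instr) : bool :=
  match i with
  | Const _ _ | Add _ _ _ | And _ _ _ | Xor _ _ _ | Not _ _
  | Lookup _ _ _ _ | Store _ _ _ _ => true
  | _ => false
  end.

Fixpoint wf (c : cmd) : bool :=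
  match c with
  | Skip => true
  | Op i => basic i
  | Seq c d | If _ _ _ c d => wf c && wf d
  | For x y c => [&& wf c, y \notin x :: wr c, x \notin wr c & rone \notin x :: wr c]
  end.

Lemma exec_wr c s z : z \notin wr c -> R (exec c s) z = R s z.
Proof.
elim: c s => //= [i|c IHc d IHd|lt y z' c IHc d IHd|x y c IHc] s.
- by case: i => //= [x k|x y z'|x y z'|x y z'|x y|x t y z']; rewrite inE => /negbTE ->.
- by rewrite mem_cat negb_or => /andP[hc hd]; rewrite IHd // IHc.
- by rewrite mem_cat negb_or => /andP[hc hd]; case: ifP; rewrite ?IHd ?IHc.
rewrite inE negb_or => /andP[/negbTE zx hz].
elim: (R s y) => [|m IH]; first by rewrite /loop /= zx.
by rewrite loopS /= zx IHc.
Qed.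

Lemma exec_wt c s t : t \notin wt c -> T (exec c s) t = T s t.
Proof.
elim: c s => //= [i|c IHc d IHd|lt y z' c IHc d IHd|x y c IHc] s.
- by case: i => //= t' y z x; rewrite inE => /negbTE ->.
- by rewrite mem_cat negb_or => /andP[hc hd]; rewrite IHd // IHc.
- by rewrite mem_cat negb_or => /andP[hc hd]; case: ifP; rewrite ?IHd ?IHc.
by move=> hz; elim: (R s y) => [|m IH] //; rewrite loopS /= IHc.
Qed.

Definition frame (c : cmd) (s s' : state) : Prop :=
  (forall z, z \notin wr c -> R s' z = R s z) /\
  (forall t, t \notin wt c -> T s' t = T s t).

Lemma exec_frame c s : frame c s (exec c s).
Proof. by split=> z; [apply: exec_wr | apply: exec_wt]. Qed.

Lemma loop_frame x y c s m : frame (For x y c) s (loop (exec c) x m s).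
Proof.
split=> [z|t] /= hz.
- rewrite inE negb_or in hz; case/andP: hz => /negbTE zx hz.
  by elim: m => [|m IH]; rewrite ?loopS /= zx ?exec_wr.
- by elim: m => [|m IH] //; rewrite loopS /= exec_wt.
Qed.

Lemma loop_var x c s m : R (loop (exec c) x m s) x = m.
Proof. by case: m => [|m] /=; rewrite eqxx. Qed.

Lemma for_rule (I : nat -> state -> Prop) x y c s :
  I 0 (setr s x 0) ->
  (forall i s', i < R s y -> R s' x = i -> frame (For x y c) s s' -> I i s' ->
     I i.+1 (setr (exec c s') x i.+1)) ->
  I (R s y) (exec (For x y c) s).
Proof.
move=> I0 IS /=.
suff: forall m, m <= R s y -> I m (loop (exec c) x m s) by apply.
elim=> [|m IH] // hm; rewrite loopS; apply: IS => //.
- exact: loop_var.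
- exact: loop_frame.
- exact/IH/ltnW.
Qed.

(** Amortised cost: [F] is a potential, and [P] bounds the cost of one round plus the change of [F].
    The sum telescopes. *)
Lemma for_cost (P : nat) (F : state -> nat) (I : nat -> state -> Prop) x y c s :
  I 0 (setr s x 0) -> F (setr s x 0) = F s ->
  (forall i s', i < R s y -> R s' x = i -> frame (For x y c) s s' -> I i s' ->
     I i.+1 (setr (exec c s') x i.+1) /\
     cost c s' + F (setr (exec c s') x i.+1) <= P + F s') ->
  cost (For x y c) s + F (exec (For x y c) s) <= 3 + R s y * (3 + P) + F s.
Proof.
move=> I0 F0 IS.
have -> : cost (For x y c) s =
  3 + \sum_(i < R s y) (3 + cost c (loop (exec c) x i s)) by [].
rewrite [exec (For x y c) s]/(loop (exec c) x (R s y) s).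
suff H: forall m, m <= R s y -> I m (loop (exec c) x m s) /\
   \sum_(i < m) (3 + cost c (loop (exec c) x i s)) + F (loop (exec c) x m s)
   <= m * (3 + P) + F s.
  by have [_ h] := H _ (leqnn _); rewrite -!addnA leq_add2l.
elim=> [|m IH] hm; first by rewrite big_ord0 /= -F0.
have [Im Fm] := IH (ltnW hm).
have [a b] := IS m (loop (exec c) x m s) hm (loop_var _ _ _ _) (loop_frame _ _ _ _ _) Im.
rewrite big_ord_recr loopS mulSn; split=> //.
move: Fm b => /=; set S := \sum_(i < m) _; lia.
Qed.

(** Adding the two branches of a conditional, instead of taking their maximum, makes the bound a
    polynomial in the values of [env] with nonnegative coefficients; [cost_bound_le] relies on
    this. *)
Fixpoint cost_bound (env : nat -> nat) (c : cmd) : nat :=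
  match c with
  | Skip => 0
  | Op i => 1
  | Seq c d => cost_bound env c + cost_bound env d
  | If lt y z c d => 2 + (cost_bound env c + cost_bound env d)
  | For x y c => 3 + env y * (3 + cost_bound env c)
  end.

Fixpoint bounds (c : cmd) : seq nat :=
  match c with
  | Seq c d | If _ _ _ c d => bounds c ++ bounds d
  | For x y c => y :: bounds c
  | _ => [::]
  end.

(** A register that bounds a loop is written nowhere in [c], so its value on entry is the one met by
    every nested loop. *)
Lemma cost_le env c s :
  {in bounds c, forall y, y \notin wr c /\ R s y <= env y} ->
  cost c s <= cost_bound env c.
Proof.
elim: c s => //= [c IHc d IHd|lt y z c IHc d IHd|x y c IHc] s H.
- apply: leq_add; [apply: IHc => y hy | apply: IHd => y hy].
    have [|] := H y; first by rewrite mem_cat hy.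
    by rewrite mem_cat negb_or => /andP[].
  have [|] := H y; first by rewrite mem_cat hy orbT.
  by rewrite mem_cat negb_or => /andP[h1 h2]; rewrite exec_wr.
- rewrite !addSn !add0n !ltnS; case: ifP => _.
    apply: leq_trans (leq_addr _ _); apply: IHc => u hu.
    have [|] := H u; first by rewrite mem_cat hu.
    by rewrite mem_cat negb_or => /andP[].
  apply: leq_trans (leq_addl _ _); apply: IHd => u hu.
  have [|] := H u; first by rewrite mem_cat hu orbT.
  by rewrite mem_cat negb_or => /andP[].
rewrite leq_add2l.
apply: (@leq_trans (\sum_(i < R s y) (3 + cost_bound env c))).
  apply: leq_sum => i _; rewrite leq_add2l; apply: IHc => u hu.
  have [|] := H u; first by rewrite inE hu orbT.
  move=> hx; have := hx; rewrite inE negb_or => /andP[_ h2]; split=> //.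
  by have [-> //] := loop_frame x y c s i.
rewrite sum_nat_const card_ord leq_mul2r; apply/orP; right.
by have [|] := H y; first by rewrite inE eqxx.
Qed.

(** The code is position dependent because jump targets are absolute; [off] is the address of the
    first instruction. In a conditional the second branch comes first, and the test jumps over it.
    [JumpEq 0 0] is the unconditional jump. *)
Fixpoint compile (c : cmd) (off : nat) : seq instr :=
  match c with
  | Skip => [::]
  | Op i => [:: i]
  | Seq c d => let p := compile c off in p ++ compile d (off + size p)
  | If lt y z c d =>
      let q := compile d off.+1 in
      let l := off + (size q).+2 in
      let p := compile c l in
      (if lt then JumpLt y z l else JumpEq y z l)
        :: q ++ JumpEq 0 0 (l + size p) :: p
  | For x y c =>
      let p := compile c (off + 3) in
      [:: Const x 0; JumpLt x y (off + 3); JumpEq 0 0 (off + size p + 5)]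
        ++ p ++ [:: Add x x rone; JumpEq 0 0 off.+1]
  end.

(** * Correctness of the compiled code *)

Definition in_range s :=
  (forall x, R s x < 2 ^ w) /\ (forall t i j, T s t i j < 2 ^ w).

(** The binary logarithm of an exclusive or is at most the larger of the two logarithms, and a
    positive number is below [2 ^ w] iff its logarithm is below [w]. Zero is split off because the
    logarithm says nothing there. *)
Lemma lxor_lt a b : a < 2 ^ w -> b < 2 ^ w -> Nat.lxor a b < 2 ^ w.
Proof.
have expE m : Nat.pow 2 m = 2 ^ m.
  by elim: m => //= m ->; rewrite expnS; lia.
move=> ha hb; have e0 : 0 < 2 ^ w by rewrite expn_gt0.
case: (posnP (Nat.lxor a b)) => [-> //|p0].
apply/ltP; rewrite -expE; apply/Nat.log2_lt_pow2; first exact/ltP.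
apply: Nat.le_lt_trans (Nat.log2_lxor a b) _.
have lg c : c < 2 ^ w -> 0 < w -> Nat.lt (Nat.log2 c) w.
  case: c => [|c] hc w0; first exact/ltP.
  by apply/Nat.log2_lt_pow2; [apply/ltP | rewrite expE; apply/ltP].
case: (posnP w) => [w0|w0].
  by move: p0; rewrite w0 expn0 in ha hb *; case: a b ha hb => [|?] [|?].
by apply: Nat.max_lub_lt; apply: lg.
Qed.

Lemma land_lt a b : a < 2 ^ w -> Nat.land a b < 2 ^ w.
Proof. by apply: leq_ltn_trans; have := Nat.land_le_l a b; lia. Qed.

Lemma exec_in_range c s : in_range s -> in_range (exec c s).
Proof.
have e0 : 0 < 2 ^ w by rewrite expn_gt0.
have setP s' x v : in_range s' -> v < 2 ^ w -> in_range (setr s' x v).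
  by move=> [h1 h2] hv; split=> // z /=; case: ifP.
elim: c s => //= [i|c IHc d IHd|lt y z c IHc d IHd|x y c IHc] s hs.
- case: i => //=; try (by move=> *; apply: setP => //; rewrite ltn_mod).
  + by move=> x y z; apply: setP => //; apply: land_lt; case: hs.
  + by move=> x y z; apply: setP => //; apply: lxor_lt; case: hs.
  + by move=> x y; apply: setP => //; lia.
  + by move=> x t y z; apply: setP => //; case: hs.
  + by move=> t y z x; case: hs => h1 h2; split=> //= *; case: ifP.
- exact/IHd/IHc.
- by case: ifP; auto.
have : R s y < 2 ^ w by case: hs.
elim: (R s y) => [|m IH] hm; first exact: setP.
by rewrite loopS; apply: setP => //; apply/IHc/IH/ltnW.
Qed.

Definition cfg pc s := Config pc (R s) (T s).

Lemma runD P a b c : run w P (a + b) c = run w P b (run w P a c).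
Proof. by rewrite /run addnC iterD. Qed.

(** The number of steps is only bounded, since [cost] charges both branches of a conditional for the
    jump that only one of them performs. *)
Definition reaches P c k c' := exists2 t, t <= k & run w P t c = c'.

Lemma reaches0 P c k : reaches P c k c.
Proof. by exists 0. Qed.

Lemma reaches_trans P a b c k l :
  reaches P a k b -> reaches P b l c -> reaches P a (k + l) c.
Proof. by case=> t ht <- [u hu <-]; exists (t + u); rewrite ?runD ?leq_add. Qed.

Lemma reaches1 P c k c' : 0 < k -> step w P c = c' -> reaches P c k c'.
Proof. by move=> hk <-; exists 1. Qed.

Lemma reachesW P a b k l : k <= l -> reaches P a k b -> reaches P a l b.
Proof. by move=> hkl [t ht E]; exists t => //; apply: leq_trans hkl. Qed.

Definition code_at (P : program) off p := forall i, i < size p -> onth P (off + i) = onth p i.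

Lemma code_at_cat P off p q :
  code_at P off (p ++ q) <-> code_at P off p /\ code_at P (off + size p) q.
Proof.
split=> [H|[H1 H2] i]; first split=> i hi.
- by rewrite H ?size_cat ?(leq_trans hi) ?leq_addr // onth_cat hi.
- by rewrite -addnA H ?size_cat ?ltn_add2l // onth_cat ltnNge leq_addr /= addKn.
rewrite size_cat onth_cat; case: (ltnP i (size p)) => h1 h2; first exact: H1.
by rewrite -H2 ?ltn_subLR // -addnA subnKC.
Qed.

Lemma code_at_cons P off i p :
  code_at P off (i :: p) <-> onth P off = Some i /\ code_at P off.+1 p.
Proof.
rewrite -cat1s code_at_cat /= addn1.
suff -> : code_at P off [:: i] <-> onth P off = Some i by [].
split=> [/(_ 0 isT)|H [|j] //]; rewrite addn0 //.
Qed.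

Lemma compile_correct P c off s :
  wf c -> rone \notin wr c -> code_at P off (compile c off) ->
  in_range s -> R s rone = 1 ->
  reaches P (cfg off s) (cost c s) (cfg (off + size (compile c off)) (exec c s)).
Proof.
elim: c off s => [|i|c IHc d IHd|lt y z c IHc d IHd|x y c IHc] off s.
- by move=> *; rewrite addn0; apply: reaches0.
- move=> /= hb _ /code_at_cons[hP _] _ _; apply: reaches1 => //.
  by rewrite /step hP addn1; case: i hb {hP}.
- move=> /= /andP[wc wd]; rewrite mem_cat negb_or => /andP[nc nd].
  move=> /code_at_cat[hc hd] hs h1; rewrite size_cat addnA.
  apply: reaches_trans; first exact: IHc.
  by apply: IHd => //; [exact: exec_in_range | rewrite exec_wr].
- move=> /= /andP[wc wd]; rewrite mem_cat negb_or => /andP[nc nd].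
  set q := compile d _; set l := off + _; set p := compile c l.
  case/code_at_cons=> h0 /code_at_cat[hq] /code_at_cons[hj hp] hs h1.
  rewrite /= size_cat /=.
  have El : l = (off.+1 + size q).+1 by rewrite /l; lia.
  have E : off + (size q + (size p).+1).+1 = l + size p by lia.
  rewrite E -add1n -addnA.
  apply: (@reaches_trans _ _ (cfg (if test lt y z s then l else off.+1) s)).
    by apply: reaches1 => //; rewrite /step h0 /test; case: (lt) => /=; case: ifP.
  case: ifP => _.
    apply: (@reachesW _ _ _ (cost c s)); first by lia.
    by apply: IHc; rewrite // -/p El.
  rewrite addnC; apply: reaches_trans; first exact: IHd.
  by apply: reaches1 => //; rewrite /step hj /jump_if /= eqxx.
move=> /= /and4P[wc yn xn on] nn; set p := compile c _.
case/code_at_cons=> h0 /code_at_cons[h1] /code_at_cons[h2] /code_at_cat[hp].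
case/code_at_cons=> h3 /code_at_cons[h4 _] hs h1s.
have ys : R s y < 2 ^ w by case: hs.
(* After [m] rounds the control is at the loop test. The increment never wraps around, because
   [m <= R s y < 2 ^ w]. *)
have L m : m <= R s y -> [/\ in_range (loop (exec c) x m s),
   R (loop (exec c) x m s) rone = 1, R (loop (exec c) x m s) y = R s y,
   R (loop (exec c) x m s) x = m & reaches P (cfg off s)
     (1 + \sum_(i < m) (3 + cost c (loop (exec c) x i s)))
     (cfg off.+1 (loop (exec c) x m s))].
  elim: m => [|m IH] hm; split.
  - case: hs => g1 g2; split=> //= z; case: ifP => // _; exact: leq_ltn_trans (leq0n _) ys.
  - by have [-> //] := loop_frame x y c s 0.
  - by have [-> //] := loop_frame x y c s 0.
  - exact: loop_var.
  - by rewrite big_ord0; apply: reaches1 => //; rewrite /step h0 mod0n.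
  - have [+ _ _ _ _] := IH (ltnW hm); move/(@exec_in_range c) => [g1 g2].
    rewrite loopS; split=> //= z; case: ifP => // _; exact: leq_ltn_trans hm ys.
  - by have [-> //] := loop_frame x y c s m.+1.
  - by have [-> //] := loop_frame x y c s m.+1.
  - exact: loop_var.
  have [i1 i2 i3 i4 i5] := IH (ltnW hm).
  rewrite big_ord_recr addnA; apply: reaches_trans i5 _ => /=.
  set s' := loop _ _ _ _ in i1 i2 i3 i4 *.
  rewrite -[3 + _]/(1 + (2 + cost c s')); apply: (@reaches_trans _ _ (cfg (off + 3) s')).
    by apply: reaches1 => //; rewrite /step h1 /jump_if /= i4 i3 hm.
  rewrite [2 + _]addnC; apply: reaches_trans.
    apply: IHc => //.
      by move: on; rewrite inE negb_or => /andP[].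
    by rewrite -/p [off + 3]addn3.
  rewrite -/p; have -> : off + 3 + size p = off.+3 + size p by lia.
  rewrite -[2]/(1 + 1).
  apply: (@reaches_trans _ _ (cfg (off.+3 + size p).+1 (loop (exec c) x m.+1 s))).
    apply: reaches1 => //; rewrite /step h3 loopS -/s'.
    rewrite /set_reg /cfg /= !exec_wr ?i4 ?i2 ?addn1 ?modn_small //;
      last by move: on; rewrite inE negb_or => /andP[].
    exact: leq_ltn_trans hm ys.
  by apply: reaches1 => //; rewrite /step h4 /jump_if /= eqxx.
have [i1 i2 i3 i4 i5] := L _ (leqnn _).
rewrite -[3 + _]/(2 + (1 + _)) addnC; apply: reaches_trans i5 _.
set s' := loop _ _ _ _ in i1 i2 i3 i4 *; rewrite /= !size_cat /=.
rewrite -[2]/(1 + 1); apply: (@reaches_trans _ _ (cfg off.+2 s')).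
  by apply: reaches1 => //; rewrite /step h1 /jump_if /= i4 i3 ltnn.
apply: reaches1 => //; rewrite /step h2 /jump_if /= eqxx /cfg; congr Config; lia.
Qed.

End Semantics.

(** * The program *)

Declare Scope cmd_scope.
Delimit Scope cmd_scope with cmd.
Bind Scope cmd_scope with cmd.
Notation "c ;; d" := (Seq c d) (at level 60, right associativity) : cmd_scope.
Open Scope cmd_scope.

Notation lk x t y z := (Op (Lookup x t y z)).
Notation sto t y z x := (Op (Store t y z x)).
Notation mov x y := (Op (And x y y)).
Notation add x y z := (Op (Add x y z)).
Notation inc x := (Op (Add x x rone)).
Notation when lt y z c := (If lt y z c Skip).
Notation ifnot lt y z c := (If lt y z Skip c).
Notation LT := true (only parsing).
Notation EQ := false (only parsing).

Notation rn := 0 (only parsing).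
Notation rzero := 2 (only parsing).
Notation rmone := 3 (only parsing).
Notation rk := 4 (only parsing).
Notation rrem := 5 (only parsing).
Notation rD := 6 (only parsing).
Notation rr := 7 (only parsing).
Notation rst := 8 (only parsing).
Notation rst1 := 9 (only parsing).
Notation ru := 10 (only parsing).
Notation rv := 11 (only parsing).
Notation rj := 12 (only parsing).
Notation rg := 13 (only parsing).
Notation ra := 14 (only parsing).
Notation rb := 15 (only parsing).
Notation rh := 16 (only parsing).
Notation rtail := 17 (only parsing).
Notation rdu := 18 (only parsing).
Notation rdv := 19 (only parsing).
Notation rp1 := 20 (only parsing).
Notation rp2 := 21 (only parsing).
Notation rc := 22 (only parsing).
Notation rx := 23 (only parsing).
Notation ry := 24 (only parsing).
Notation rs := 25 (only parsing).
Notation rok := 26 (only parsing).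
Notation ri := 27 (only parsing).

(* One-dimensional arrays are kept in column 0 of a table. *)
Notation tA := 0 (only parsing).
Notation tL := 1 (only parsing).
Notation tadj := 2 (only parsing).
Notation tdeg := 3 (only parsing).
Notation tnew := 4 (only parsing).
Notation tnewdeg := 5 (only parsing).
Notation trep := 6 (only parsing).
Notation tstamp := 7 (only parsing).
Notation tdist := 8 (only parsing).
Notation tqueue := 9 (only parsing).
Notation tsz := 10 (only parsing).
Notation tH := 11 (only parsing).
Notation tseen := 12 (only parsing).
Notation torder := 13 (only parsing).
Notation tpar := 14 (only parsing).
Notation tX := 15 (only parsing).
Notation tinc := 16 (only parsing).
Notation tC := 17 (only parsing).

(** The word of all ones is -1 modulo [2 ^ w], so adding [rmone] decrements. [rrem] counts the label
    columns that are still free. *)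
Definition init_const := Op (Not rmone rzero) ;; mov rrem rn.

Definition init_row :=
  For rv rn
    (lk ra tA ru rv ;;
     when EQ ra rone
       (lk rg tnewdeg ru rzero ;; sto tnew ru rg rv ;;
        inc rg ;; sto tnewdeg ru rzero rg)).

Definition init_lists := For ru rn (sto trep ru rzero ru ;; init_row).

Definition max_degree :=
  mov rD rzero ;; mov rr rzero ;;
  For rv rn (lk rg tnewdeg rv rzero ;; when LT rD rg (mov rD rg ;; mov rr rv)).

(** Here and below, a scan of an adjacency list runs to the maximum degree [D] and tests the index
    against the degree [rg]. A scan of all lists then costs a constant times [n * D]. *)
Definition copy_row :=
  For rj rD (when LT rj rg (lk ra tnew rv rj ;; sto tadj rv rj ra)).

Definition copy_lists :=
  For rv rn
    (lk rg tnewdeg rv rzero ;; sto tdeg rv rzero rg ;; copy_row ;;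
     sto tnewdeg rv rzero rzero ;; sto tdist rv rzero rzero).

(** Seeds the new columns: column [k + j] is set at the [j]-th neighbour of [r]. The seed survives
    until [fill_row] reads it for that vertex. *)
Definition star :=
  For rj rD (lk rv tadj rr rj ;; add rc rk rj ;; sto tL rv rc rone).

(** [tdist] holds the distance plus one, so that 0 means undiscovered. *)
Definition bfs_scan :=
  For rj rD
    (when LT rj rg
       (lk rv tadj ru rj ;; lk rdv tdist rv rzero ;;
        when EQ rdv rzero
          (sto tdist rv rzero rdu ;; sto tqueue rtail rzero rv ;; inc rtail))).

(** A while loop over the queue becomes [n] guarded rounds; this is enough because no vertex enters
    the queue twice. *)
Definition bfs_loop :=
  For rh rn
    (when LT rh rtail
       (lk ru tqueue rh rzero ;; lk rg tdeg ru rzero ;;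
        lk rdu tdist ru rzero ;; inc rdu ;; bfs_scan)).

Definition bfs :=
  sto tqueue rzero rzero rr ;; sto tdist rr rzero rone ;; mov rtail rone ;;
  bfs_loop.

(** Since [rp1] and [rp2] start as [u], they end as the last two neighbours of [u] closer to [r],
    with [u] itself in place of a missing one. *)
Definition downs :=
  For rj rD
    (when LT rj rg
       (lk rv tadj ru rj ;; lk rdv tdist rv rzero ;;
        when LT rdv rdu (mov rp2 rp1 ;; mov rp1 rv))).

(** One rule serves all cases: if [u] has just one closer neighbour, then [rp2] is [u] and
    contributes the seed of [star]. The number of bits set is kept for [unite]. *)
Definition fill_row :=
  For rs rD
    (add rc rk rs ;; lk ra tL rp1 rc ;; lk rb tL rp2 rc ;;
     when EQ rb rone (mov ra rone) ;; sto tL ru rc ra ;; add rx rx ra).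

Definition rows :=
  For rh rn
    (when LT rh rtail
       (lk ru tqueue rh rzero ;; lk rg tdeg ru rzero ;;
        lk rdu tdist ru rzero ;; mov rp1 ru ;; mov rp2 ru ;; downs ;;
        mov rx rzero ;; fill_row ;; sto tsz ru rzero rx)).

Definition spread_row :=
  For rs rD (add rc rk rs ;; lk rb tL ra rc ;; sto tL rv rc rb).

Definition spread := For rv rn (lk ra trep rv rzero ;; spread_row).

Definition relabel :=
  For ry rn (lk rc trep ry rzero ;; when EQ rc rp1 (sto trep ry rzero rp2)).

(** Different values of [tsz] at the ends reveal an edge of one of the [D] classes. The test
    [rv < rn] lets the cost bound hold whatever the lists contain: only then is it clear that a
    relabelling lowers the number of representatives. *)
Definition unite_edge :=
  lk rv tadj ru rj ;; lk rb tsz rv rzero ;;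
  ifnot EQ ra rb
    (when LT rv rn
       (lk rp1 trep ru rzero ;; lk rp2 trep rv rzero ;;
        ifnot EQ rp1 rp2 relabel)).

Definition unite_row := For rj rD (when LT rj rg unite_edge).

Definition unite :=
  For ru rn (lk rg tdeg ru rzero ;; lk ra tsz ru rzero ;; unite_row).

(** [tstamp a b] is the number of the last stage that recorded [b] as a neighbour of [a]. Stamps
    merge parallel edges without clearing a table of size [n ^ 2] in every stage. *)
Definition rebuild_row :=
  For rj rD
    (when LT rj rg
       (lk rv tadj ru rj ;; lk rb trep rv rzero ;;
        ifnot EQ ra rb
          (lk rc tstamp ra rb ;;
           ifnot EQ rc rst1
             (sto tstamp ra rb rst1 ;; lk rx tnewdeg ra rzero ;;
              sto tnew ra rx rb ;; inc rx ;; sto tnewdeg ra rzero rx)))).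

Definition rebuild :=
  For ru rn (lk rg tdeg ru rzero ;; lk ra trep ru rzero ;; rebuild_row).

Definition finish := For rs rD (inc rk ;; add rrem rrem rmone).

Definition contract :=
  copy_lists ;; star ;; bfs ;; rows ;; spread ;; unite ;; rebuild ;; finish.

(** The test of [rrem] against [D] is what bounds the label length and the total time on graphs that
    are not partial cubes. Stages are numbered from 1 for the stamps, as the tables start with 0. *)
Definition stage :=
  add rst1 rst rone ;; max_degree ;;
  when LT rzero rD (ifnot LT rrem rD contract).

Definition stages := For rst rn stage.

Definition reject := mov rok rzero.

Definition root_row :=
  For ri rk
    (lk ra tL ru ri ;; lk rb tL rzero ri ;; when LT rone ra reject ;;
     ifnot EQ ra rb (inc rx)).

Definition root_dist :=
  For ru rn (mov rx rzero ;; root_row ;; sto tH rzero ru rx).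

Definition tree_row :=
  For ru rn
    (lk ra tA rv ru ;;
     when EQ ra rone
       (lk rb tseen ru rzero ;;
        when EQ rb rzero
          (sto tseen ru rzero rone ;; sto torder rtail rzero ru ;;
           inc rtail ;; sto tpar ru rzero rv))).

Definition tree_loop :=
  For rh rn (when LT rh rtail (lk rv torder rh rzero ;; tree_row)).

Definition tree :=
  sto tseen rzero rzero rone ;; mov rtail rone ;; tree_loop ;;
  ifnot EQ rtail rn reject.

(** [rc] keeps the last column where [u] and [v] differ; if there is just one, this is the flipped
    one. *)
Definition flipped :=
  For ri rk
    (lk ra tL ru ri ;; lk rb tL rv ri ;;
     ifnot EQ ra rb (inc rx ;; mov rc ri)).

Definition shift_row :=
  For ry rn
    (lk ra tL ry rc ;; lk rb tH rv ry ;;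
     If EQ ra rp1 (inc rb) (add rb rb rmone) ;; sto tH ru ry rb).

Definition hamming_rows :=
  For rh rn
    (lk ru torder rh rzero ;;
     ifnot EQ ru rzero
       (lk rv tpar ru rzero ;; mov rx rzero ;; mov rc rzero ;; flipped ;;
        ifnot EQ rx rone reject ;;
        lk ra tX rv rzero ;; Op (Xor ra ra rc) ;; sto tX ru rzero ra ;;
        lk rp1 tL rv rc ;; shift_row)).

(** [tinc u c] records that some edge at [u] flips [c]; [rx] counts the neighbours of [u] closer to
    vertex 0, the row from which [counts] starts. *)
Definition edge_row :=
  For rv rn
    (lk rb tH ru rv ;; when EQ rb rzero (ifnot EQ ru rv reject) ;;
     lk ra tA ru rv ;;
     when EQ ra rone
       (ifnot EQ rb rone reject ;;
        lk rp1 tX ru rzero ;; lk rp2 tX rv rzero ;; Op (Xor rc rp1 rp2) ;;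
        sto tinc ru rc rone ;;
        lk rp1 tH rzero ru ;; lk rp2 tH rzero rv ;; when LT rp2 rp1 (inc rx))).

Definition edges := For ru rn (mov rx rzero ;; edge_row ;; sto tC rzero ru rx).

Definition count_row :=
  For ru rn
    (lk rx tC rp1 ru ;; lk ra tinc ru rc ;;
     when EQ ra rone
       (lk ra tH rv ru ;; lk rb tH rp1 ru ;;
        If LT rb ra (inc rx) (add rx rx rmone)) ;;
     sto tC rv ru rx).

Definition counts :=
  For rh rn
    (lk rv torder rh rzero ;;
     ifnot EQ rv rzero
       (lk rp1 tpar rv rzero ;; lk ra tX rv rzero ;; lk rb tX rp1 rzero ;;
        Op (Xor rc ra rb) ;; count_row)).

Definition verdict_row :=
  For ru rn (lk ra tC rv ru ;; when EQ ra rzero (ifnot EQ ru rv reject)).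

Definition verdict := For rv rn verdict_row.

Definition checker :=
  mov rok rone ;; root_dist ;; tree ;; hamming_rows ;; edges ;; counts ;;
  verdict.

Definition labeller := init_const ;; init_lists ;; stages.

Definition main := labeller ;; checker ;; mov rn rk.

Lemma main_wf : wf main.
Proof. by []. Qed.

Arguments exec : simpl never.
Arguments cost : simpl never.

Section Exec.
Variable w : nat.
Implicit Type s : state.

Lemma exec_seq c d s : exec w (c ;; d) s = exec w d (exec w c s).
Proof. by []. Qed.

Lemma exec_if lt y z c d s :
  exec w (If lt y z c d) s =
  if test lt y z s then exec w c s else exec w d s.
Proof. by []. Qed.

Lemma exec_mov x y s : exec w (mov x y) s = setr s x (R s y).
Proof. by rewrite /exec /exec_op Nat.land_diag. Qed.

Lemma exec_lk x t y z s :
  exec w (lk x t y z) s = setr s x (T s t (R s y) (R s z)).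
Proof. by []. Qed.

Lemma exec_sto t y z x s :
  exec w (sto t y z x) s = sett s t (R s y) (R s z) (R s x).
Proof. by []. Qed.

Lemma exec_add x y z s :
  exec w (add x y z) s = setr s x ((R s y + R s z) %% 2 ^ w).
Proof. by []. Qed.

Lemma exec_xor x y z s :
  exec w (Op (Xor x y z)) s = setr s x (Nat.lxor (R s y) (R s z)).
Proof. by []. Qed.

Lemma exec_skip s : exec w Skip s = s.
Proof. by []. Qed.

Definition execE :=
  (exec_seq, exec_if, exec_mov, exec_lk, exec_sto, exec_add, exec_xor,
   exec_skip).

End Exec.

(** * Hamming distances along an edge *)

Lemma lxorA : associative Nat.lxor.
Proof. by move=> a b c; rewrite Nat.lxor_assoc. Qed.

(** Exclusive or becomes an operation for iterated operators, so that the hashes of two vertices can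
    be combined column by column. *)
HB.instance Definition _ :=
  Monoid.isComLaw.Build nat 0 Nat.lxor lxorA Nat.lxor_comm Nat.lxor_0_l.

Section Words.

Variable k : nat.
Implicit Types f g h : nat -> nat.

(** Rows are functions to [nat] because the table is not known to contain bits; that is a separate
    hypothesis wherever it matters. *)
Definition hd f g := \sum_(i < k) (f i != g i).

Definition flips c f g := c < k /\ forall i, i < k -> (f i != g i) = (i == c).

Lemma hdC f g : hd f g = hd g f.
Proof. by apply: eq_bigr => i _; rewrite eq_sym. Qed.

Lemma hd_le f g : hd f g <= k.
Proof.
rewrite -[X in _ <= X]card_ord -sum1_card.
by apply: leq_sum => i _; case: (_ != _).
Qed.

Lemma hd_eq0 f g : hd f g = 0 -> forall i, i < k -> f i = g i.
Proof.
move/eqP; rewrite sum_nat_eq0 => /forallP h i hi.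
by have /= := h (Ordinal hi); case: (f i =P g i).
Qed.

Lemma hd_eq1 f g : hd f g = 1 <-> exists c, flips c f g.
Proof.
split=> [H|[c [hc E]]]; last first.
  rewrite /hd (bigD1 (Ordinal hc)) //= E // eqxx big1 // => i /eqP ne.
  by rewrite E //; case: eqP => // e; case: ne; apply: val_inj.
have [i Hi] : exists i : 'I_k, f i != g i.
  apply/existsP; apply: contraTT isT => /existsPn h.
  by move: H; rewrite /hd big1 // => i _; have /negbNE/eqP-> := h i; rewrite eqxx.
exists i; split=> // j hj; case: (j =P i) => [->|ji]; first by rewrite Hi.
apply/negbTE/negP => ne; move: H; rewrite /hd (bigD1 i) //= Hi (bigD1 (Ordinal hj)) /=.
  by rewrite ne.
by apply/eqP => e; apply: ji; rewrite -e.
Qed.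

Lemma flipsC c f g : flips c f g -> flips c g f.
Proof. by case=> hc E; split=> // i hi; rewrite eq_sym E. Qed.

(** At [c], the rows [f] and [g] hold the two different bits, so [h] agrees there with exactly one
    of them; all other columns contribute equally. *)
Lemma hd_flips c f g h :
  (forall i, i < k -> f i <= 1) -> (forall i, i < k -> g i <= 1) ->
  (forall i, i < k -> h i <= 1) -> flips c f g ->
  if h c == g c then hd f h = (hd g h).+1 else hd g h = (hd f h).+1.
Proof.
move=> bf bg bh [hc E].
have D f' : hd f' h = (f' c != h c) + \sum_(i < k | i != Ordinal hc) (f' i != h i).
  by rewrite /hd (bigD1 (Ordinal hc)).
rewrite !D.
have -> : \sum_(i < k | i != Ordinal hc) (f i != h i) =
          \sum_(i < k | i != Ordinal hc) (g i != h i).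
  apply: eq_bigr => i ne; have := E i (ltn_ord i).
  have -> : (i == c :> nat) = false by apply: contraNF ne => /eqP e; apply/eqP/val_inj.
  by move=> /negbT; rewrite negbK => /eqP ->.
have := E c hc; rewrite eqxx; have := (bf c hc, bg c hc, bh c hc) => -[[]].
by case: (f c) (g c) (h c) => [|[|?]] [|[|?]] [|[|?]].
Qed.

(** The exclusive or of the columns at which [f] differs from [f0]. For the ends of an edge all
    columns but the flipped one cancel. Column 0 contributes nothing, which is harmless: the value
    is read only as the flipped column of a pair that differs in exactly one. *)
Definition hash f0 f := \big[Nat.lxor/0]_(i < k) (if f i != f0 i then i : nat else 0).

Lemma hash_flips c f0 f g :
  (forall i, i < k -> f i <= 1) -> (forall i, i < k -> g i <= 1) ->
  (forall i, i < k -> f0 i <= 1) -> flips c f g ->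
  Nat.lxor (hash f0 f) (hash f0 g) = c.
Proof.
move=> bf bg b0 [hc E]; rewrite /hash -big_split /= (bigD1 (Ordinal hc)) //=.
rewrite big1 => [|i ne]; last first.
  have := E i (ltn_ord i).
  have -> : (i == c :> nat) = false by apply: contraNF ne => /eqP e; apply/eqP/val_inj.
  by move=> /negbT; rewrite negbK => /eqP ->; rewrite Nat.lxor_nilpotent.
rewrite Nat.lxor_0_r.
have := E c hc; rewrite eqxx; have := (bf c hc, bg c hc, b0 c hc) => -[[]].
case: (f c) (g c) (f0 c) => [|[|?]] [|[|?]] [|[|?]] //= _ _ _ _;
  by rewrite ?Nat.lxor_0_r ?Nat.lxor_0_l.
Qed.

Lemma hash_step c f0 f g :
  (forall i, i < k -> f i <= 1) -> (forall i, i < k -> g i <= 1) ->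
  (forall i, i < k -> f0 i <= 1) -> flips c f g ->
  hash f0 f = Nat.lxor (hash f0 g) c.
Proof.
move=> bf bg b0 fl; rewrite -(hash_flips bf bg b0 fl).
by rewrite [X in Nat.lxor _ X]Nat.lxor_comm lxorA Nat.lxor_nilpotent Nat.lxor_0_l.
Qed.

Lemma hash0 f0 : hash f0 f0 = 0.
Proof. by rewrite /hash big1 // => i _; rewrite eqxx. Qed.

End Words.

(** * How the number of neighbours of [u] closer to [v] varies with [v] *)

Section Count.

Variables (k n : nat) (A : nat -> nat -> bool) (L : nat -> nat -> nat).
Notation H u v := (hd k (L u) (L v)).
Notation X := (fun u => hash k (L 0) (L u)).
Hypothesis n_gt0 : 0 < n.
Hypothesis bits : forall u i, u < n -> i < k -> L u i <= 1.
Hypothesis Hinj : forall u v, u < n -> v < n -> H u v = 0 -> u = v.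
Hypothesis HA : forall u v, u < n -> v < n -> A u v -> H u v = 1.

Definition closer v u := \sum_(x < n) (A u x && (H x v < H u v)).

Lemma closer_le v u : closer v u <= n.
Proof.
rewrite -[X in _ <= X]card_ord -sum1_card.
by apply: leq_sum => i _; case: (_ && _).
Qed.

(** Whether an edge at [u] leads closer to [v] depends on [v] only through the bit that the edge
    flips. *)
Lemma closer_flip c u v x : u < n -> v < n -> x < n ->
  flips k c (L u) (L x) -> (H x v < H u v) = (L u c != L v c).
Proof.
move=> hu hv hx fl; have hc := fl.1.
have := hd_flips (fun i => @bits x i hx) (fun i => @bits u i hu)
  (fun i => @bits v i hv) (flipsC fl).
by rewrite [in _ != _]eq_sym; case: ifP => _ ->; lia.
Qed.

(** Passing from [p] to [v] changes bit [c] only, so it affects only an edge at [u] that flips [c].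
    This edge leads closer to whichever of [p] and [v] differs from [u] at [c], which is the one
    farther from [u]. *)
Lemma closer_step p v c u : p < n -> v < n -> u < n ->
  flips k c (L v) (L p) ->
  ((exists x, [/\ x < n, A u x & Nat.lxor (X u) (X x) = c]) ->
    if H p u < H v u then closer v u = (closer p u).+1
    else closer p u = (closer v u).+1) /\
  (~ (exists x, [/\ x < n, A u x & Nat.lxor (X u) (X x) = c]) ->
    closer v u = closer p u).
Proof.
move=> hp hv hu fl; have hc := fl.1.
have cls x : x < n -> A u x -> flips k (Nat.lxor (X u) (X x)) (L u) (L x).
  move=> hx ax; have /hd_eq1[d fd] := HA hu hx ax.
  by rewrite (hash_flips (fun i => @bits u i hu) (fun i => @bits x i hx)
    (fun i => @bits 0 i n_gt0) fd).
have ne x : x < n -> A u x -> Nat.lxor (X u) (X x) <> c ->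
    (H x v < H u v) = (H x p < H u p).
  move=> hx ax nc; have fx := cls x hx ax.
  rewrite (closer_flip hu hv hx fx) (closer_flip hu hp hx fx); congr (_ != _).
  by have := fl.2 _ fx.1; rewrite (introF eqP nc) => /negbT; rewrite negbK => /eqP.
split=> [[x [hx ax ex]]|no]; last first.
  apply: eq_bigr => x _; case ax: (A u x) => //=.
  by rewrite (ne x (ltn_ord x) ax) // => e; apply: no; exists x.
have fx : flips k c (L u) (L x) by rewrite -ex; apply: cls.
have D p' : closer p' u = (H x p' < H u p') +
    \sum_(i < n | i != Ordinal hx) (A u i && (H i p' < H u p')).
  by rewrite /closer (bigD1 (Ordinal hx)) //= ax.
rewrite !D.
(* No other edge at [u] flips [c]: its end would have the same label as [x], contrary to [Hinj]. *)
have -> : \sum_(i < n | i != Ordinal hx) (A u i && (H i v < H u v)) =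
          \sum_(i < n | i != Ordinal hx) (A u i && (H i p < H u p)).
  apply: eq_bigr => y ny; case ay: (A u y) => //=.
  rewrite (ne y (ltn_ord y) ay) // => e.
  case/negP: ny; apply/eqP/val_inj => /=; apply: Hinj => //.
  have fy : flips k c (L u) (L y) by rewrite -e; apply: cls.
  rewrite /hd big1 // => i _.
  have := (fx.2 i (ltn_ord i), fy.2 i (ltn_ord i)).
  have := (@bits u i hu (ltn_ord i), @bits x i hx (ltn_ord i),
    @bits y i (ltn_ord y) (ltn_ord i)).
  case: (i == c :> nat);
    by case: (L u i) (L x i) (L y i) => [|[|?]] [|[|?]] [|[|?]] [[]] //= ? ? ? [].
rewrite (closer_flip hu hv hx fx) (closer_flip hu hp hx fx).
have := hd_flips (fun i => @bits v i hv) (fun i => @bits p i hp)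
  (fun i => @bits u i hu) fl.
have := fl.2 c hc; rewrite eqxx.
have := (@bits u c hu hc, @bits v c hv hc, @bits p c hp hc).
case: (L u c) (L v c) (L p c) => [|[|?]] [|[|?]] [|[|?]] [[]] //= ? ? ? _ ->;
  by rewrite ?ltnSn ?ltnNge ?leqnSn ?ltnS ?leqnn.
Qed.

End Count.

(** * The checker *)

Lemma forallS i (P : nat -> Prop) :
  (forall j, j < i.+1 -> P j) <-> (forall j, j < i -> P j) /\ P i.
Proof.
split=> [H|[H1 H2] j]; first by split=> [j hj|]; apply: H => //; apply: ltnW.
by rewrite ltnS leq_eqVlt => /predU1P[-> //|]; apply: H1.
Qed.

Lemma uniq_size_le n (q : seq nat) : uniq q -> all (fun v => v < n) q -> size q <= n.
Proof.
move=> uq /allP hq; rewrite -[n](size_iota 0); apply: uniq_leq_size => // v /hq.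
by rewrite mem_iota.
Qed.

Lemma uniq_size_lt n (q : seq nat) i :
  uniq q -> all (fun v => v < n) q -> i < n -> i \notin q -> size q < n.
Proof.
move=> uq hq hi ni; have := @uniq_size_le n (i :: q).
by rewrite /= ni hi; apply.
Qed.

Lemma uniq_size_mem n (q : seq nat) i :
  uniq q -> all (fun v => v < n) q -> size q = n -> i < n -> i \in q.
Proof.
move=> uq hq sq hi; apply: contraT => ni.
by have := uniq_size_lt uq hq hi ni; rewrite sq ltnn.
Qed.

Lemma incE n w a : n < 2 ^ w -> a < n -> (a + 1) %% 2 ^ w = a.+1.
Proof. by move=> hn h; rewrite modn_small; lia. Qed.

Lemma decE n w a : n < 2 ^ w -> 0 < a <= n -> (a + (2 ^ w).-1) %% 2 ^ w = a.-1.
Proof.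
move=> hn h; have -> : a + (2 ^ w).-1 = a.-1 + 2 ^ w by lia.
by rewrite modnDr modn_small; lia.
Qed.

Section Base.
Variables n w : nat.
Hypotheses (n_gt0 : 0 < n) (n_lt : n < 2 ^ w).
Implicit Types s : state.

Definition base s :=
  [/\ R s rn = n, R s rone = 1, R s rzero = 0 & R s rmone = (2 ^ w).-1].

Lemma base_frame c s s' :
  frame c s s' -> all (fun z => z \notin wr c) [:: rn; rone; rzero; rmone] ->
  base s -> base s'.
Proof.
move=> [F _] /= /and5P[h0 h1 h2 h3 _] [b0 b1 b2 b3].
by split; rewrite F.
Qed.

Lemma base_exec c s :
  all (fun z => z \notin wr c) [:: rn; rone; rzero; rmone] ->
  base s -> base (exec w c s).
Proof. exact: base_frame (exec_frame w c s). Qed.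

Lemma for_base m (I : nat -> state -> Prop) x y c s :
  base s -> R s y = m ->
  all (fun z => z \notin wr (For x y c)) [:: rn; rone; rzero; rmone] ->
  I 0 (setr s x 0) ->
  (forall i s', i < m -> R s' x = i -> frame (For x y c) s s' -> base s' ->
     I i s' -> I i.+1 (setr (exec w c s') x i.+1)) ->
  I m (exec w (For x y c) s).
Proof.
move=> bs <- hw I0 IS; apply: for_rule => // i s' hi e F; apply: IS => //.
exact: base_frame F hw bs.
Qed.

(* Once [rok] differs from 1, it never becomes 1 again, so that a failed test
   need not stop the program. *)
Fixpoint only_rejects (c : cmd) : bool :=
  match c with
  | Op (And x y z) => (x == rok) ==> (y == rzero)
  | Op i => rok \notin wr (Op i)
  | Seq c d | If _ _ _ c d => only_rejects c && only_rejects d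
  | For x y c => (x != rok) && only_rejects c
  | _ => true
  end.

Lemma rejected c s :
  only_rejects c -> rzero \notin wr c ->
  R s rzero = 0 -> R s rok <> 1 -> R (exec w c s) rok <> 1.
Proof.
elim: c s => //= [i|c IHc d IHd|lt y z c IHc d IHd|x y c IHc] s.
- case: i => //= [x a|x y z|x y z|x y z|x y|x t y z]; rewrite ?inE /exec /=;
    rewrite 1?[x == _]eq_sym; try (by case: (26 =P x)).
  by case: (26 =P x) => //= <- /eqP -> _ ->.
- move=> /andP[h1 h2]; rewrite mem_cat negb_or => /andP[z1 z2] s0 h.
  by rewrite execE; apply: IHd => //; [rewrite exec_wr|apply: IHc].
- move=> /andP[h1 h2]; rewrite mem_cat negb_or => /andP[z1 z2] s0 h.
  by rewrite execE; case: ifP; auto.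
move=> /andP[/negbTE nx hc] nz s0 h.
have: R (exec w (For x y c) s) rzero = 0 /\ R (exec w (For x y c) s) rok <> 1.
  apply: (@for_rule w (fun _ s' => R s' rzero = 0 /\ R s' rok <> 1)) => [|i s' _ _ _ [e1 e2]].
    by rewrite /= [26 == x]eq_sym nx; move: nz; rewrite inE negb_or => /andP[/negbTE-> _].
  rewrite /= [26 == x]eq_sym nx; move: nz; rewrite inE negb_or => /andP[/negbTE-> nz].
  by rewrite exec_wr //; split=> //; apply: IHc.
by case.
Qed.

Section Checker.

Variables (k : nat) (A : nat -> nat -> bool) (L : nat -> nat -> nat).
Hypothesis k_le : k <= n.
Notation H u v := (hd k (L u) (L v)).
Notation X := (fun u => hash k (L 0) (L u)).

Definition chk s :=
  [/\ base s, R s rk = k, T s tL = L &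
      forall u v, u < n -> v < n -> T s tA u v = A u v].

Lemma chk_frame c s s' : frame c s s' ->
  all (fun z => z \notin wr c) [:: rn; rone; rzero; rmone; rk] ->
  all (fun z => z \notin wt c) [:: tA; tL] -> chk s -> chk s'.
Proof.
move=> F hr ht [bs hk hL hA].
split; first 1 last.
- by case: F => -> //; case/and5P: hr => _ _ _ _ /andP[].
- by case: F => _ ->; case/and3P: ht.
- by case: F => _ ->; case/and3P: ht.
by apply: base_frame F _ bs; case/and5P: hr => /= -> -> -> ->.
Qed.

Lemma chk_exec c s :
  all (fun z => z \notin wr c) [:: rn; rone; rzero; rmone; rk] ->
  all (fun z => z \notin wt c) [:: tA; tL] -> chk s -> chk (exec w c s).
Proof. exact: chk_frame (exec_frame w c s). Qed.

Lemma root_row_spec s :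
  chk s -> R s rx = 0 ->
  let s' := exec w root_row s in
  R s' rx = H (R s ru) 0 /\
  (R s' rok = 1 <-> R s rok = 1 /\ forall i, i < k -> L (R s ru) i <= 1).
Proof.
move=> [bs hk hL hA] hx /=; set u := R s ru.
apply: (@for_base k (fun i s1 => R s1 rx = hd i (L u) (L 0) /\
    (R s1 rok = 1 <-> R s rok = 1 /\ forall j, j < i -> L u j <= 1))) => //.
  by rewrite /hd big_ord0 /=; split=> //; split=> [h|[]].
move=> i s1 hi ei F1 [b0 b1 b2 b3] [E1 E2].
have [FR FT] := F1; have Eu := FR ru isT; have ET := FT tL isT.
rewrite forallS !execE /test /= b1 b2 ei Eu ET hL -/u.
rewrite /hd big_ord_recr -/(hd _ _ _) /= ltnNge.
have hi1 : hd i (L u) (L 0) < n by apply: leq_ltn_trans (hd_le _ _ _) _; lia.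
case: (_ <= 1) => /=; rewrite ?b1 ?b2 ?Eu; case: eqP => /= _;
  rewrite E1 ?E2 ?addn0 ?b1 ?(incE n_lt) ?addn1 //; by split=> //; intuition.
Qed.

Lemma root_dist_spec s :
  chk s ->
  let s' := exec w root_dist s in
  (forall u, u < n -> T s' tH 0 u = H u 0) /\
  (R s' rok = 1 <->
   R s rok = 1 /\ forall u, u < n -> forall i, i < k -> L u i <= 1).
Proof.
move=> cs /=; have [bs _ _ _] := cs; have [h0 _ _ _] := bs.
apply: (@for_base n (fun m s1 => (forall u, u < m -> T s1 tH 0 u = H u 0) /\
  (R s1 rok = 1 <->
   R s rok = 1 /\ forall u, u < m -> forall i, i < k -> L u i <= 1))) => //=.
  by split=> //; split=> [h|[]].
move=> m s1 hm em F1 [b0 b1 b2 b3] [E1 E2]; rewrite !execE.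
set s2 := setr _ rx _.
have cs2 : chk s2 by case: (chk_frame F1 isT isT cs).
have [G1 G2] := root_row_spec cs2 b2.
have [FR FT] := exec_frame w root_row s2.
have em2 : R (exec w root_row s2) ru = m by rewrite FR.
have ez : R (exec w root_row s2) rzero = 0 by rewrite FR.
have eu : R s2 ru = m by [].
move: (exec w root_row s2) G1 G2 FR FT em2 ez => s3 G1 G2 FR FT em2 ez.
rewrite /= ez em2 G1 eu G2 eu (forallS m (fun u => forall i, i < k -> L u i <= 1)).
rewrite [R s2 rok]/= E2; split; last by tauto.
move=> u; rewrite eqxx ltnS leq_eqVlt => /predU1P[->|hu]; first by rewrite eqxx.
by rewrite ltn_eqF //= (FT tH isT) /= E1.
Qed.

(** [q] is the order of discovery. Parents stand earlier in [q], so rows can be computed along [q],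
    each from the finished row of the parent. *)
Definition queued (q : seq nat) s :=
  [/\ R s rtail = size q, uniq q, all (fun v => v < n) q,
      0 < size q /\ nth 0 q 0 = 0 &
      [/\ forall h, h < size q -> T s torder h 0 = nth 0 q h,
          forall u, u < n -> T s tseen u 0 = (u \in q) &
          forall h, 0 < h < size q ->
            exists j, [/\ j < h, T s tpar (nth 0 q h) 0 = nth 0 q j &
                          A (nth 0 q j) (nth 0 q h)]]].

Lemma tree_row_spec s q h :
  chk s -> queued q s -> h < size q -> R s rv = nth 0 q h ->
  exists q', let s' := exec w tree_row s in
    [/\ queued q' s', prefix q q' &
        forall u, u < n -> A (nth 0 q h) u -> u \in q'].
Proof.
move=> cs Q hh ev; have [bs _ _ hA] := cs; have [h0 _ _ _] := bs.
set v := nth 0 q h in ev *.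
have hv : v < n by case: Q => _ _ /allP Q _ _; apply: Q; rewrite mem_nth.
suff: exists q', [/\ queued q' (exec w tree_row s), prefix q q' &
        forall u, u < n -> A v u -> u \in q'] by [].
apply: (@for_base n (fun m s1 => exists q', [/\ queued q' s1, prefix q q' &
        forall u, u < m -> A v u -> u \in q'])) => //.
  by exists q; rewrite prefix_refl.
move=> m s1 hm em F1 [b0 b1 b2 b3] [q1 [Q1 P1 C1]].
have [FR FT] := F1.
have [e1 e2 e3 [e4 e4'] [e5 e6 e7]] := Q1.
have e6m := e6 m hm.
rewrite !execE /test /= (FR rv isT) em ev (FT tA isT) hA //.
case a : (A v m) => /=; rewrite b1 /=; last first.
  exists q1; split=> // u; rewrite ltnS leq_eqVlt => /predU1P[->|]; last exact: C1.
  by rewrite a.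
rewrite b2 e6m.
case mq : (m \in q1) => /=.
  exists q1; split=> // u; rewrite ltnS leq_eqVlt => /predU1P[->|]; last exact: C1.
  by rewrite mq.
exists (rcons q1 m); split; last 2 first.
- exact: prefix_trans P1 (prefix_rcons _ _).
- move=> u; rewrite ltnS mem_rcons inE leq_eqVlt => /predU1P[->|hu au]; first by rewrite eqxx.
  by rewrite C1 ?orbT.
have sq : size q1 < n by apply: (@uniq_size_lt n q1 m) => //; rewrite mq.
rewrite /queued /= e1 size_rcons (incE n_lt) //.
split=> //.
- by rewrite rcons_uniq mq.
- by rewrite all_rcons hm.
- by rewrite nth_rcons e4.
split=> [j|u hu|j /andP[j0]].
- rewrite ltnS leq_eqVlt nth_rcons => /predU1P[->|hj]; first by rewrite ltnn !eqxx.
  by rewrite hj ltn_eqF //= e5.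
- by rewrite andbT mem_rcons inE e6 //; case: (u =P m) => //= ->.
rewrite ltnS leq_eqVlt => /predU1P[->|hj].
  have [p1 hp1] : exists j, j < size q1 /\ nth 0 q1 j = v.
    case/prefixP: P1 => q2 ->; exists h; rewrite size_cat nth_cat hh.
    by split=> //; apply: leq_trans hh (leq_addr _ _).
  exists p1; case: hp1 => hp1 e.
  by rewrite !nth_rcons ltnn eqxx hp1 e !eqxx.
have [p [hp ep ap]] := e7 j (introT andP (conj j0 hj)).
exists p; rewrite !nth_rcons hj (ltn_trans hp hj).
have -> : (nth 0 q1 j == m) = false.
  by apply/negbTE/eqP => e; rewrite -e mem_nth in mq.
by [].
Qed.

(** The order [q] has no repetitions, hence at most [n] entries, and [n] rounds process all of them.
    This is why the reached set is closed under adjacency. *)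
Lemma tree_spec s :
  chk s -> T s torder 0 0 = 0 -> (forall u, T s tseen u 0 = 0) ->
  exists q : seq nat, let s' := exec w tree s in
    [/\ queued q s', forall u v, u \in q -> v < n -> A u v -> v \in q &
        (R s' rok = 1 <-> R s rok = 1 /\ size q = n)].
Proof.
move=> cs o0 sn0; have [[b0 b1 b2 b3] _ _ hA] := cs; rewrite /tree !execE.
set s1 := setr _ rtail _.
have cs1 : chk s1 by case: cs.
have [q [Q C]] : exists q : seq nat, queued q (exec w tree_loop s1) /\
    forall j, j < n -> j < size q -> forall u, u < n -> A (nth 0 q j) u -> u \in q.
  apply: (@for_base n (fun m s2 => exists q : seq nat, queued q s2 /\ forall j, j < m ->
      j < size q -> forall u, u < n -> A (nth 0 q j) u -> u \in q)) => //.
    exists [:: 0]; rewrite /queued /= b1 b2 n_gt0; split=> //; split=> //; split=> //.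
    - by case.
    - by move=> u hu; rewrite inE andbT sn0; case: eqP.
    - by case.
  move=> m s2 hm em F [c0 c1 c2 c3] [q [Q C]].
  have cs2 := chk_frame F isT isT cs1.
  have [e1 e2 e3 e4 [e5 e6 e7]] := Q.
  rewrite !execE /test /= em e1 c2; case: ltnP => hq; last first.
    exists q; split=> // j; rewrite ltnS leq_eqVlt => /predU1P[->|]; last exact: C.
    by rewrite ltnNge hq.
  set s3 := setr s2 rv _.
  have [|||| q' [Q' P' C']] := @tree_row_spec s3 q m => //.
    by rewrite /= e5.
  exists q'; split=> //.
  case/prefixP: P' Q' C' => q2 -> Q' C' j hj _ u hu.
  rewrite nth_cat; case: ltnP => hjq.
    move: hj; rewrite ltnS leq_eqVlt => /predU1P[->|hj]; first exact: C'.
    by move=> /(C _ hj hjq _ hu); rewrite mem_cat => ->.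
  by have := leq_ltn_trans hjq hj; rewrite ltnS leqNgt hq.
have F := exec_frame w tree_loop s1.
have [[d0 d1 d2 d3] _ _ _] := chk_frame F isT isT cs1.
have eok : R (exec w tree_loop s1) rok = R s rok by rewrite F.1.
move: (exec w tree_loop s1) Q F d0 d2 eok => s4 Q F d0 d2 eok.
exists q; have [e1 e2 e3 e4 e5] := Q; split.
- by case: ifP.
- move=> u v hu hv; rewrite -(nth_index 0 hu); apply: C => //; last by rewrite index_mem.
  by apply: leq_trans (uniq_size_le e2 e3); rewrite index_mem.
rewrite /test /= e1 d0; case: eqP => h /=; rewrite ?eok ?d2; by intuition.
Qed.

Lemma flipped_spec s : chk s -> R s rx = 0 ->
  let s' := exec w flipped s in
  R s' rx = H (R s ru) (R s rv) /\
  (R s' rx = 1 -> flips k (R s' rc) (L (R s ru)) (L (R s rv))).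
Proof.
move=> [bs hk hL hA] hx /=; set u := R s ru; set v := R s rv.
apply: (@for_base k (fun i s1 => R s1 rx = hd i (L u) (L v) /\
    (R s1 rx = 1 -> flips i (R s1 rc) (L u) (L v)))) => //.
  by rewrite /hd big_ord0 /= hx.
move=> i s1 hi ei F1 [b0 b1 b2 b3] [E1 E2].
have [FR FT] := F1.
rewrite !execE /test /= ei (FR ru isT) (FR rv isT) (FT tL isT) hL -/u -/v.
rewrite /hd big_ord_recr -/(hd _ _ _) /=.
have hi1 : hd i (L u) (L v) < n by apply: leq_ltn_trans (hd_le _ _ _) _; lia.
case: eqP => /= e; rewrite ?b1 E1 ?addn0 ?(incE n_lt) ?addn1 //; split=> //.
  move=> e1; have [hc E] := E2 (etrans E1 e1); split; first exact: ltnW.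
  move=> j; rewrite ltnS leq_eqVlt => /predU1P[->|]; last exact: E.
  by rewrite e eqxx gtn_eqF.
case=> h0; split=> // j; rewrite ltnS leq_eqVlt => /predU1P[->|hj].
  by rewrite eqxx; apply/eqP.
by rewrite (hd_eq0 h0) // eqxx ltn_eqF.
Qed.

Lemma shift_row_spec s : chk s -> R s ru <> R s rv ->
  let s' := exec w shift_row s in
  (forall y, y < n -> T s' tH (R s ru) y =
    (T s tH (R s rv) y + (if L y (R s rc) == R s rp1 then 1 else (2 ^ w).-1)) %% 2 ^ w) /\
  (forall a b, a <> R s ru -> T s' tH a b = T s tH a b).
Proof.
move=> [bs hk hL hA] /=; set u := R s ru; set v := R s rv; move=> uv.
have [h0 _ _ _] := bs.
apply: (@for_base n (fun i s1 => (forall y, y < i -> T s1 tH u y =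
    (T s tH v y + (if L y (R s rc) == R s rp1 then 1 else (2 ^ w).-1)) %% 2 ^ w) /\
  (forall a b, a <> u -> T s1 tH a b = T s tH a b))) => //.
move=> i s1 hi ei F1 [b0 b1 b2 b3] [E1 E2].
have [FR FT] := F1.
rewrite !execE /test /= ei (FR rv isT) (FR rc isT) (FR rp1 isT) (FT tL isT) hL -/v.
rewrite E2; last by apply/nesym.
case: (L i (R s rc) =P R s rp1) => e /=; rewrite ?b1 ?b3 ?(FR ru isT) ?ei -/u;
  (split=> [y|a b au]; last by rewrite (introF eqP au) /= E2);
  rewrite eqxx ltnS leq_eqVlt => /predU1P[->|hy];
  try (by rewrite (ltn_eqF hy) /= E1); rewrite eqxx /=.
  by rewrite e eqxx.
by rewrite (introF eqP e).
Qed.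

(** The update by +1 or -1 is valid only along edges of Hamming distance 1, which the same pass
    tests. Hence the rows are claimed to be correct only if nothing was rejected. *)
Lemma hamming_rows_spec s q :
  chk s -> queued q s -> size q = n -> R s rok = 1 ->
  (forall u i, u < n -> i < k -> L u i <= 1) ->
  (forall u, u < n -> T s tH 0 u = H u 0) -> T s tX 0 0 = 0 ->
  let s' := exec w hamming_rows s in
  (R s' rok = 1 <-> forall j, 0 < j < n ->
     H (nth 0 q j) (T s tpar (nth 0 q j) 0) = 1) /\
  (R s' rok = 1 -> forall u, u < n ->
     (forall v, v < n -> T s' tH u v = H u v) /\ T s' tX u 0 = X u).
Proof.
move=> cs Q sq ok bits hH hX /=.
have [_ uq /allP aq [q0 e0] [ho hs hp]] := Q; have [bs _ _ _] := cs.
have [hn _ _ _] := bs.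
pose good s1 u := (forall v, v < n -> T s1 tH u v = H u v) /\ T s1 tX u 0 = X u.
pose par j := H (nth 0 q j) (T s tpar (nth 0 q j) 0) = 1.
have nz j : j < n -> (nth 0 q j == 0) = (j == 0).
  by move=> hj; rewrite -{2}e0 nth_uniq // ?sq.
suff [E1 E2]: let s' := exec w hamming_rows s in
  (R s' rok = 1 <-> forall j, j < n -> 0 < j -> par j) /\
  (R s' rok = 1 -> good s' 0 /\ forall j, j < n -> good s' (nth 0 q j)).
  split.
    rewrite E1; split=> E j; first by case/andP=> j0 jn; apply: E.
    by move=> jn j0; apply: E; rewrite j0.
  move=> /E2[_ G] u hu; have uin := uniq_size_mem uq (introT allP aq) sq hu.
  by rewrite -(nth_index 0 uin); apply: G; rewrite -sq index_mem.
apply: (@for_base n (fun m s1 =>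
  (R s1 rok = 1 <-> forall j, j < m -> 0 < j -> par j) /\
  (R s1 rok = 1 -> good s1 0 /\ forall j, j < m -> good s1 (nth 0 q j)))) => //=.
  split; first by rewrite ok.
  by split=> //; split=> [v hv|] /=; rewrite ?hH ?hX ?hash0 // hdC.
move=> m s1 hm em F [b0 b1 b2 b3] [E1 E2].
have cs1 := chk_frame F isT isT cs.
have [FR FT] := F.
rewrite !execE /test /= em b2 (FT torder isT) ho ?sq // nz //.
case: (posnP m) => [m0|m0] /=.
  rewrite m0 in E1 E2 *; split=> [|/E2[G0 Gm]].
    by rewrite E1; split=> _ [].
  split=> // -[|//] _; by rewrite e0.
set u := nth 0 q m.
rewrite (FT tpar isT).
have [p [hpm ep ap]] := hp m (introT andP (conj m0 (etrans (congr1 _ sq) hm))).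
rewrite -/u in ep ap; rewrite ep; set v := nth 0 q p in ep ap *.
have hpn : p < n := ltn_trans hpm hm.
have hu : u < n by apply: aq; rewrite mem_nth ?sq.
have hv : v < n by apply: aq; rewrite mem_nth ?sq.
have uv : u <> v.
  by move/eqP; rewrite nth_uniq ?sq // => /eqP e; rewrite e ltnn in hpm.
set s2 := setr (setr _ _ _) rc 0.
have cs2 : chk s2 by case: cs1.
have [G1 G2] := flipped_spec cs2 erefl.
have F3 := exec_frame w flipped s2.
have cs3 := chk_frame F3 isT isT cs2.
have eu : R (exec w flipped s2) ru = u by rewrite F3.1.
have ev : R (exec w flipped s2) rv = v by rewrite F3.1.
have eok : R (exec w flipped s2) rok = R s1 rok by rewrite F3.1.
have eX : T (exec w flipped s2) tX = T s1 tX by rewrite F3.2.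
have eH : T (exec w flipped s2) tH = T s1 tH by rewrite F3.2.
have eL : T (exec w flipped s2) tL = L by case: cs3.
move: (exec w flipped s2) G1 G2 cs3 eu ev eok eX eH eL {F3} => s3 G1 G2 cs3 eu ev eok eX eH eL.
have [[d0 d1 d2 d3] _ _ _] := cs3.
change (R s2 ru) with u in G1, G2; change (R s2 rv) with v in G1, G2.
rewrite d1 /=.
(* The two outcomes of the test differ in [rok] only, so both are followed at once. *)
set s4 := (if _ then _ else _).
have T4 : T s4 = T s3 by rewrite /s4; case: ifP.
have R4 z : z != rok -> R s4 z = R s3 z by rewrite /s4; case: ifP => //= _ /negbTE ->.
have ok4 : R s4 rok = 1 <-> R s1 rok = 1 /\ H u v = 1.
  by rewrite /s4 G1; case: eqP => h /=; rewrite ?eok ?d2; intuition.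
have cs4 : chk s4 by case: cs3 => -[*]; split; rewrite ?T4 ?R4 //; split; rewrite R4.
set s5 := setr _ rp1 _.
have cs5 : chk s5 by case: cs4.
have u5 : R s5 ru = u by rewrite /= R4.
have v5 : R s5 rv = v by rewrite /= R4.
have uv5 : R s5 ru <> R s5 rv by rewrite u5 v5.
have [G3 G4] := shift_row_spec cs5 uv5.
have F6 := exec_frame w shift_row s5.
have ok6 : R (exec w shift_row s5) rok = R s4 rok by rewrite F6.1.
have X6 : T (exec w shift_row s5) tX = T s5 tX by rewrite F6.2.
rewrite u5 v5 in G3 G4.
move: (exec w shift_row s5) G3 G4 ok6 X6 {F6} => s6 G3 G4 ok6 X6.
rewrite ok6 (forallS m (fun j => 0 < j -> par j)).
have -> : (0 < m -> par m) <-> H u v = 1.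
  by rewrite /par -/u ep; split=> [->|].
split; first by rewrite ok4 E1.
rewrite ok4 => -[ok1 huv]; have [g0 gj] := E2 ok1.
have fl := G2 (etrans G1 huv).
have [gv gXv] := gj p hpm; rewrite -/v in gv gXv.
have c5 : R s5 rc = R s3 rc by rewrite /= R4.
have p5 : R s5 rp1 = L v (R s3 rc) by rewrite /= !R4 // T4 eL ev.
have H5 a b : T s5 tH a b = T s1 tH a b by rewrite /= T4 eH.
have X5 a : T s5 tX a 0 = if a == u then Nat.lxor (X v) (R s3 rc) else T s1 tX a 0.
  by rewrite /= !R4 // d2 T4 eX eu ev gXv andbT.
have old a : a <> u -> good s1 a -> good s6 a.
  move=> au [ga gXa]; split=> [b hb|]; first by rewrite /= G4 // H5 ga.
  by rewrite /= X6 X5 gXa; case: eqP.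
have u0 : 0 <> u by move=> e; have := nz m hm; rewrite -/u -e eqxx (gtn_eqF m0).
split; first exact: old.
move=> j; rewrite ltnS leq_eqVlt => /predU1P[->|hj]; last first.
  apply: old (gj j hj) => /eqP; rewrite nth_uniq ?sq ?(ltn_trans hj) // => /eqP e.
  by rewrite e ltnn in hj.
rewrite -/u; split=> [y hy|] /=; last first.
  rewrite X6 X5 eqxx; symmetry.
  by apply: hash_step => // i hi; apply: bits.
rewrite G3 // H5 gv // c5 p5.
have := hd_flips (fun i => @bits u i hu) (fun i => @bits v i hv) (fun i => @bits y i hy) fl.
have := hd_le k (L u) (L y); have := hd_le k (L v) (L y).
case: ifP => _ l1 l2 e; first by rewrite (incE n_lt) ?e //; lia.
by rewrite (decE n_lt) e //; lia.
Qed.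

Lemma edge_row_spec s : chk s -> R s rx = 0 -> R s ru < n ->
  (forall u, u < n -> (forall v, v < n -> T s tH u v = H u v) /\ T s tX u 0 = X u) ->
  (forall c, T s tinc (R s ru) c = 0) ->
  let s' := exec w edge_row s in let u := R s ru in
  [/\ (R s' rok = 1 <-> R s rok = 1 /\ forall v, v < n ->
         (H u v = 0 -> u = v) /\ (A u v -> H u v = 1)),
      R s' rx = closer k n A L 0 u,
      forall c, T s' tinc u c = 1 <->
        exists x, [/\ x < n, A u x & Nat.lxor (X u) (X x) = c] &
      forall a c, a <> u -> T s' tinc a c = T s tinc a c].
Proof.
move=> cs hx hu G hinc /=; set u := R s ru in hu hinc *.
have [bs hk hL hA] := cs; have [h0 _ _ _] := bs.
pose cl m := \sum_(x < m) (A u x && (H x 0 < H u 0)).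
have cl_le m : cl m <= m.
  rewrite -[X in _ <= X]card_ord -sum1_card.
  by apply: leq_sum => i _; case: (_ && _).
apply: (@for_base n (fun m s1 =>
  [/\ (R s1 rok = 1 <-> R s rok = 1 /\ forall v, v < m ->
         (H u v = 0 -> u = v) /\ (A u v -> H u v = 1)),
      R s1 rx = cl m,
      forall c, T s1 tinc u c = 1 <->
        exists x, [/\ x < m, A u x & Nat.lxor (X u) (X x) = c] &
      forall a c, a <> u -> T s1 tinc a c = T s tinc a c])) => //.
  rewrite /cl big_ord0 /=; split=> //; first by split=> [|[]].
  by move=> c; rewrite hinc; split=> [|[x []]].
move=> m s1 hm em F [b0 b1 b2 b3] [E1 E2 E3 E4].
have [FR FT] := F.
have E1' : (R s rok = 1 /\ forall v, v < m.+1 -> (H u v = 0 -> u = v) /\ (A u v -> H u v = 1))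
    <-> R s1 rok = 1 /\ ((H u m = 0 -> u = m) /\ (A u m -> H u m = 1)).
  by rewrite (forallS m (fun v => (H u v = 0 -> u = v) /\ (A u v -> H u v = 1))) E1; tauto.
rewrite /cl big_ord_recr -/(cl m) /=.
have Eu := FR ru isT; rewrite -/u in Eu.
have [Gu GXu] := G u hu; have [Gm GXm] := G m hm; have [G0 _] := G 0 n_gt0.
have c1 : cl m < n by apply: leq_ltn_trans (cl_le m) hm.
rewrite exec_seq exec_lk /= Eu em (FT tH isT) Gu // exec_seq.
set d := when EQ rb rzero _; set s2 := setr s1 rb _.
have ok3 : R (exec w d s2) rok = 1 <-> R s1 rok = 1 /\ (H u m = 0 -> u = m).
  rewrite /d !execE /test /= Eu em b2.
  by case: (H u m =P 0) => h; [case: (u =P m) => e|] => /=; intuition.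
have [FR3 FT3] := exec_frame w d s2.
have u3 : R (exec w d s2) ru = u by rewrite FR3.
have v3 : R (exec w d s2) rv = m by rewrite FR3.
have one3 : R (exec w d s2) rone = 1 by rewrite FR3.
have zero3 : R (exec w d s2) rzero = 0 by rewrite FR3.
have x3 : R (exec w d s2) rx = cl m by rewrite FR3.
have rb3 : R (exec w d s2) rb = H u m by rewrite FR3.
have T3 : T (exec w d s2) = T s1 by rewrite /d !execE; do 2?case: ifP.
move: (exec w d s2) ok3 u3 v3 one3 zero3 x3 rb3 T3 {FR3 FT3} =>
  s3 ok3 u3 v3 one3 zero3 x3 rb3 T3 {d s2}.
rewrite exec_seq exec_lk exec_if /test /= u3 v3 one3 T3 (FT tA isT) hA //.
case Aum : (A u m) => /=; last first.
  rewrite ?exec_skip /= T3 x3 addn0; split=> //.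
  - by rewrite E1' ok3 Aum; intuition.
  - by move=> c; rewrite E3; split=> -[x [hx' ax ex]]; exists x; split=> //;
      [exact: ltnW | move: hx'; rewrite ltnS leq_eqVlt => /predU1P[e|//]; rewrite e Aum in ax].
rewrite exec_seq; set d := ifnot EQ rb rone _; set s4 := setr s3 ra _.
have ok5 : R (exec w d s4) rok = 1 <->
    (R s1 rok = 1 /\ (H u m = 0 -> u = m)) /\ H u m = 1.
  rewrite /d !execE /test /= rb3 one3 zero3.
  by case: (H u m =P 1) => h /=; rewrite ?ok3; intuition.
have [FR5 FT5] := exec_frame w d s4.
have u5 : R (exec w d s4) ru = u by rewrite FR5.
have v5 : R (exec w d s4) rv = m by rewrite FR5.
have one5 : R (exec w d s4) rone = 1 by rewrite FR5.
have zero5 : R (exec w d s4) rzero = 0 by rewrite FR5.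
have x5 : R (exec w d s4) rx = cl m by rewrite FR5.
have T5 : T (exec w d s4) = T s1 by rewrite -T3 /d !execE; case: ifP.
move: (exec w d s4) ok5 u5 v5 one5 zero5 x5 T5 {FR5 FT5} =>
  s5 ok5 u5 v5 one5 zero5 x5 T5 {d s4}.
have tinc5 c : (if c == Nat.lxor (X u) (X m) then 1 else T s1 tinc u c) = 1 <->
        exists x, [/\ x < m.+1, A u x & Nat.lxor (X u) (X x) = c].
  case: eqP => [->|ne]; first by split=> // _; exists m.
  rewrite /= E3; split=> -[x [hx' ax ex]]; exists x; split=> //; first exact: ltnW.
  by move: hx'; rewrite ltnS leq_eqVlt => /predU1P[e|//]; rewrite e in ex; case: ne.
rewrite !execE /test /= u5 v5 one5 zero5 x5 T5 (FT tX isT) GXu GXm (FT tH isT) !G0 //.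
rewrite ![H 0 _]hdC; case: ifP => lt /=; rewrite ?(incE n_lt) ?addn0 ?addn1 // ?x5;
  split=> //; rewrite ?T5 //; try by rewrite E1' ok5; intuition.
- by move=> c; rewrite eqxx; apply: tinc5.
- by move=> a c au; rewrite (introF eqP au) E4.
- by move=> c; rewrite eqxx; apply: tinc5.
- by move=> a c au; rewrite (introF eqP au) E4.
Qed.

Lemma edges_spec s : chk s ->
  (forall u, u < n -> (forall v, v < n -> T s tH u v = H u v) /\ T s tX u 0 = X u) ->
  (forall u c, T s tinc u c = 0) ->
  let s' := exec w edges s in
  [/\ (R s' rok = 1 <-> R s rok = 1 /\ forall u, u < n -> forall v, v < n ->
         (H u v = 0 -> u = v) /\ (A u v -> H u v = 1)),
      forall u, u < n -> T s' tC 0 u = closer k n A L 0 u &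
      forall u, u < n -> forall c, T s' tinc u c = 1 <->
        exists x, [/\ x < n, A u x & Nat.lxor (X u) (X x) = c]].
Proof.
move=> cs G hinc /=; have [bs hk hL hA] := cs; have [h0 _ _ _] := bs.
pose P u v := (H u v = 0 -> u = v) /\ (A u v -> H u v = 1).
pose inv m s1 :=
  [/\ (R s1 rok = 1 <-> R s rok = 1 /\ forall u, u < m -> forall v, v < n -> P u v),
      forall u, u < m -> T s1 tC 0 u = closer k n A L 0 u,
      forall u, u < m -> forall c, T s1 tinc u c = 1 <->
        exists x, [/\ x < n, A u x & Nat.lxor (X u) (X x) = c] &
      forall u c, m <= u -> T s1 tinc u c = 0].
suff [] : inv n (exec w edges s) by [].
apply: (@for_base n inv) => //; first by split=> //=; split=> [|[]].
move=> m s1 hm em F bs1 [E1 E2 E3 E4].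
have cs1 := chk_frame F isT isT cs.
have [FR FT] := F; have [b0 b1 b2 b3] := bs1.
rewrite exec_seq exec_mov exec_seq; set s2 := setr s1 rx _.
have cs2 : chk s2 by case: cs1.
have m2 : R s2 ru = m by [].
have G2 u : u < n -> (forall v, v < n -> T s2 tH u v = H u v) /\ T s2 tX u 0 = X u.
  by rewrite /= (FT tH isT) (FT tX isT); apply: G.
have i2 c : T s2 tinc (R s2 ru) c = 0 by rewrite m2 E4.
have [K1 K2 K3 K4] := edge_row_spec cs2 b2 (eq_ind_r (fun z => z < n) hm m2) G2 i2.
rewrite m2 in K1 K2 K3 K4.
have [FR3 FT3] := exec_frame w edge_row s2.
have u3 : R (exec w edge_row s2) ru = m by rewrite FR3.
have z3 : R (exec w edge_row s2) rzero = 0 by rewrite FR3.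
have C3 : T (exec w edge_row s2) tC = T s1 tC by rewrite FT3.
move: (exec w edge_row s2) K1 K2 K3 K4 u3 z3 C3 {FR3 FT3} => s3 K1 K2 K3 K4 u3 z3 C3.
rewrite exec_sto /inv /= u3 z3 K2 C3; split.
- by rewrite K1 (forallS m (fun u => forall v, v < n -> P u v)) E1; tauto.
- move=> u; rewrite eqxx ltnS leq_eqVlt => /predU1P[->|hu]; first by rewrite eqxx.
  by rewrite ltn_eqF //= E2.
- move=> u; rewrite ltnS leq_eqVlt => /predU1P[->|hu] c; first exact: K3.
  by rewrite K4 /= ?E3 //; lia.
by move=> u c hu; rewrite K4 /= ?E4 //; lia.
Qed.

Lemma count_row_spec s : chk s -> R s rv <> R s rp1 ->
  let s' := exec w count_row s in let v := R s rv in let p := R s rp1 in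
  (forall u, u < n -> T s' tC v u =
     if T s tinc u (R s rc) == 1 then
       (T s tC p u + (if T s tH p u < T s tH v u then 1 else (2 ^ w).-1)) %% 2 ^ w
     else T s tC p u) /\
  (forall a b, a <> v -> T s' tC a b = T s tC a b).
Proof.
move=> [bs hk hL hA] /=; set v := R s rv; set p := R s rp1; move=> vp.
have [h0 _ _ _] := bs.
apply: (@for_base n (fun m s1 => (forall u, u < m -> T s1 tC v u =
     if T s tinc u (R s rc) == 1 then
       (T s tC p u + (if T s tH p u < T s tH v u then 1 else (2 ^ w).-1)) %% 2 ^ w
     else T s tC p u) /\
  (forall a b, a <> v -> T s1 tC a b = T s tC a b))) => //.
move=> m s1 hm em F [b0 b1 b2 b3] [E1 E2]; have [FR FT] := F.
have Ev := FR rv isT; have Ep := FR rp1 isT; rewrite -/v in Ev; rewrite -/p in Ep.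
rewrite 2!exec_seq !exec_lk /= Ep em E2; last exact/nesym.
rewrite (FR rc isT) (FT tinc isT) ?exec_seq exec_if /test /= b1.
case: (T s tinc m (R s rc) =P 1) => hi; last first.
  rewrite ?execE /= ?Ev ?em; split=> [u|a b av]; last by rewrite (introF eqP av) /= E2.
  rewrite eqxx ltnS leq_eqVlt => /predU1P[->|hu]; first by rewrite eqxx (introF eqP hi).
  by rewrite (ltn_eqF hu) /= E1.
rewrite ?exec_seq ?exec_lk exec_if /test /= ?Ev ?Ep ?em (FT tH isT).
case: ifP => hlt; rewrite ?execE /= ?b1 ?b3 ?Ev ?em;
  (split=> [u|a b av]; last by rewrite (introF eqP av) /= E2);
  rewrite eqxx ltnS leq_eqVlt => /predU1P[->|hu];
  try (by rewrite (ltn_eqF hu) /= E1); by rewrite eqxx hi hlt.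
Qed.

Lemma counts_spec s q :
  chk s -> queued q s -> size q = n ->
  (forall u i, u < n -> i < k -> L u i <= 1) ->
  (forall u v, u < n -> v < n -> H u v = 0 -> u = v) ->
  (forall u v, u < n -> v < n -> A u v -> H u v = 1) ->
  (forall u, u < n -> (forall v, v < n -> T s tH u v = H u v) /\ T s tX u 0 = X u) ->
  (forall u, u < n -> T s tC 0 u = closer k n A L 0 u) ->
  (forall u, u < n -> forall c, T s tinc u c = 1 <->
        exists x, [/\ x < n, A u x & Nat.lxor (X u) (X x) = c]) ->
  forall v u, v < n -> u < n -> T (exec w counts s) tC v u = closer k n A L v u.
Proof.
move=> cs Q sq bits inj eA G C0 hinc.
have [_ uq /allP aq [q0 e0] [ho hs hp]] := Q; have [bs _ _ _] := cs.
have [hn _ _ _] := bs.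
pose good s1 v := forall u, u < n -> T s1 tC v u = closer k n A L v u.
have nz j : j < n -> (nth 0 q j == 0) = (j == 0).
  by move=> hj; rewrite -{2}e0 nth_uniq // ?sq.
suff [_ E]: good (exec w counts s) 0 /\ forall j, j < n -> good (exec w counts s) (nth 0 q j).
  move=> v u hv hu; have vin := uniq_size_mem uq (introT allP aq) sq hv.
  by rewrite -(nth_index 0 vin); apply: E; rewrite // -sq index_mem.
apply: (@for_base n (fun m s1 => good s1 0 /\ forall j, j < m -> good s1 (nth 0 q j))) => //.
move=> m s1 hm em F [b0 b1 b2 b3] [E1 E2].
have cs1 := chk_frame F isT isT cs; have [FR FT] := F.
rewrite exec_seq exec_lk exec_if /test /= em b2 (FT torder isT) ho ?sq // nz //.
case: (posnP m) => [m0|m0] /=.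
  by rewrite ?exec_skip; split=> // -[|j]; rewrite m0 // => _; rewrite e0.
have [p [hpm ep ap]] := hp m (introT andP (conj m0 (etrans (congr1 _ sq) hm))).
set v := nth 0 q m in ep ap *; set pv := nth 0 q p in ep ap.
have hpn : p < n := ltn_trans hpm hm.
have hv : v < n by apply: aq; rewrite mem_nth ?sq.
have hpv : pv < n by apply: aq; rewrite mem_nth ?sq.
have vp : v <> pv.
  by move/eqP; rewrite nth_uniq ?sq // => /eqP e; rewrite e ltnn in hpm.
rewrite 4!exec_seq !exec_lk exec_xor /= b2 (FT tpar isT) ep (FT tX isT).
rewrite (G v hv).2 (G pv hpv).2.
set s2 := setr _ rc _.
have cs2 : chk s2 by case: cs1.
have [|K1 K2] := count_row_spec cs2; first exact: vp.
rewrite [R s2 rv]/= [R s2 rp1]/= [R s2 rc]/= in K1 K2.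
rewrite [T s2]/= (FT tinc isT) (FT tH isT) in K1 K2.
have old a : a <> v -> good s1 a -> good (exec w count_row s2) a.
  by move=> av ga u hu; rewrite K2 // ga.
have v0 : 0 <> v by move=> e; have := nz m hm; rewrite -/v -e eqxx (gtn_eqF m0).
split; first exact: old.
move=> j; rewrite ltnS leq_eqVlt => /predU1P[->|hj]; last first.
  apply: old (E2 j hj) => /eqP; rewrite nth_uniq ?sq ?(ltn_trans hj) // => /eqP e.
  by rewrite e ltnn in hj.
rewrite -/v => u hu /=; rewrite K1 // (E2 p hpm) // (G pv hpv).1 // (G v hv).1 //.
have /hd_eq1[c fl] : H v pv = 1 by rewrite hdC; apply: eA.
have ec : Nat.lxor (X v) (X pv) = c by apply: hash_flips fl => i hi; apply: bits.
rewrite ec; have [S1 S2] := closer_step n_gt0 bits inj eA hpv hv hu fl.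
have := closer_le k n A L v u; have := closer_le k n A L pv u.
case: eqP => [/(hinc u hu)/S1|ni]; last by rewrite S2 // => /(hinc u hu).
rewrite -/pv; case: ifP => _ e l1 l2; first by rewrite (incE n_lt) ?e //; lia.
by rewrite (decE n_lt) e //; lia.
Qed.

Lemma verdict_row_spec s : chk s ->
  let s' := exec w verdict_row s in let v := R s rv in
  R s' rok = 1 <-> R s rok = 1 /\ forall u, u < n -> T s tC v u = 0 -> u = v.
Proof.
move=> cs /=; have [bs hk hL hA] := cs; have [h0 _ _ _] := bs.
apply: (@for_base n (fun m s1 => R s1 rok = 1 <->
  R s rok = 1 /\ forall u, u < m -> T s tC (R s rv) u = 0 -> u = R s rv)) => //.
  by split=> [|[]].
move=> m s1 hm em F [b0 b1 b2 b3] E; have [FR FT] := F.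
rewrite (forallS m (fun u => T s tC (R s rv) u = 0 -> u = R s rv)).
rewrite !execE /test /= em b2 (FR rv isT) (FT tC isT).
by case: eqP => h; [case: eqP => h'|]; rewrite /= ?E; intuition.
Qed.

Lemma verdict_spec s : chk s ->
  let s' := exec w verdict s in
  R s' rok = 1 <-> R s rok = 1 /\
    forall v, v < n -> forall u, u < n -> T s tC v u = 0 -> u = v.
Proof.
move=> cs /=; have [bs hk hL hA] := cs; have [h0 _ _ _] := bs.
apply: (@for_base n (fun m s1 => R s1 rok = 1 <->
  R s rok = 1 /\ forall v, v < m -> forall u, u < n -> T s tC v u = 0 -> u = v)) => //.
  by split=> [|[]].
move=> m s1 hm em F bs1 E; have cs1 := chk_frame F isT isT cs; have [FR FT] := F.
rewrite (forallS m (fun v => forall u, u < n -> T s tC v u = 0 -> u = v)) /=.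
have /= -> := verdict_row_spec cs1; rewrite em (FT tC isT) E; tauto.
Qed.

(** A local form of being isometric: edges of Hamming distance 1 bound the distance from below, and
    closer neighbours yield a walk that attains the bound. *)
Definition valid :=
  [/\ forall u i, u < n -> i < k -> L u i <= 1,
      forall u v, u < n -> v < n -> A u v -> H u v = 1 &
      forall u v, u < n -> v < n -> u <> v ->
        exists x, [/\ x < n, A u x & H x v < H u v]].

Hypothesis A_sym : forall u v, A u v -> A v u.

Lemma checker_spec s : chk s ->
  (forall t i j, tH <= t -> T s t i j = 0) ->
  R (exec w checker s) rok = 1 <-> valid.
Proof.
move=> cs fresh; rewrite /checker exec_seq exec_mov exec_seq.
have [[_ b1 b2 _] _ _ _] := cs.
set s1 := setr s rok _.
have cs1 : chk s1 by case: cs => -[].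
have ok1 : R s1 rok = 1 by [].
have f1 t i j : tH <= t -> T s1 t i j = 0 by apply: fresh.
move: s1 cs1 ok1 f1 => s1 cs1 ok1 f1 {cs fresh b1 b2}.
have [K1 K2] := root_dist_spec cs1.
have cs2 := chk_exec (c := root_dist) isT isT cs1.
have F2 := (exec_frame w root_dist s1).2.
have fr2 t i j : tseen <= t -> T (exec w root_dist s1) t i j = 0.
  move=> ht; rewrite F2 ?f1 //; first exact: ltnW.
  by rewrite /= inE neq_ltn ht orbT.
move: (exec w root_dist s1) K1 K2 cs2 fr2 {F2} => s2 K1 K2 cs2 fr2.
rewrite exec_seq.
have [q [Q Qc Qok]] := tree_spec cs2 (fr2 torder 0 0 isT) (fun u => fr2 tseen u 0 isT).
have cs3 := chk_exec (c := tree) isT isT cs2.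
have F3 := (exec_frame w tree s2).2.
have f3 i j : T (exec w tree s2) tX i j = 0 by rewrite F3 ?fr2.
have i3 i j : T (exec w tree s2) tinc i j = 0 by rewrite F3 ?fr2.
have H3 u : u < n -> T (exec w tree s2) tH 0 u = H u 0 by rewrite F3 //; apply: K1.
move: (exec w tree s2) Q Qok cs3 f3 i3 H3 {F3} => s3 Q Qok cs3 f3 i3 H3.
(* The tree reaches every vertex, by induction on the Hamming distance to 0: a neighbour closer to 0
   is reached, and [q] is closed under adjacency. *)
have conn : valid -> size q = n.
  case=> v1 v2 v3; apply/eqP; rewrite eqn_leq; have [_ uq aq [q0 e0] _] := Q.
  rewrite (uniq_size_le uq aq) -[n in n <= _](size_iota 0).
  apply: uniq_leq_size (iota_uniq _ _) _ => u; rewrite mem_iota /= add0n.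
  have [m] := ubnP (H u 0); elim: m u => // m IH u hm hu.
  case: (u =P 0) => [->|u0]; first by rewrite -e0 mem_nth.
  have [x [hx ax lx]] := v3 u 0 hu n_gt0 u0.
  by apply: Qc (A_sym ax) => //; apply: IH => //; apply: leq_trans lx _.
(* After each phase, a failed test cannot be undone by the later phases, so in this case only the
   necessity of the test is left: [valid] implies it. If the test passed, its outcome is available
   to the next phase. *)
case: (R s3 rok =P 1) => ok3; last first.
  split=> [h|V].
    pose c := hamming_rows ;; edges ;; counts ;; verdict.
    by have [[_ _ z _] _ _ _] := cs3; case: (@rejected c s3 isT isT z ok3 h).
  case: ok3; apply/Qok; split; last exact: conn.
  by apply/K2; split=> // u hu i hi; case: V => V _ _; apply: V.
have [/K2[_ bits'] sq] := Qok.1 ok3.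
have bits u i : u < n -> i < k -> L u i <= 1 by move=> hu; apply: bits'.
rewrite exec_seq.
have [K4 K5] := hamming_rows_spec cs3 Q sq ok3 bits H3 (f3 0 0).
have cs4 := chk_exec (c := hamming_rows) isT isT cs3.
have F4 := exec_frame w hamming_rows s3.
have i4 i j : T (exec w hamming_rows s3) tinc i j = 0 by rewrite F4.2.
have Q4 : queued q (exec w hamming_rows s3).
  case: Q => e1 e2 e3 e4 [e5 e6 e7]; split=> //; first by rewrite F4.1.
  by split; rewrite F4.2.
have edge j : 0 < j < n -> A (nth 0 q j) (T s3 tpar (nth 0 q j) 0).
  rewrite -{1}sq => hj; case: Q => _ _ _ _ [_ _ /(_ j hj)[p [_ -> ap]]].
  exact: A_sym.
have inn j : j < n -> nth 0 q j < n.
  by move=> hj; case: Q => _ _ /allP aq _ _; apply: aq; rewrite mem_nth ?sq.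
have parn j : 0 < j < n -> T s3 tpar (nth 0 q j) 0 < n.
  move=> hj; have := hj; rewrite -{1}sq => hj'.
  case: Q => _ _ _ _ [_ _ /(_ j hj')[p [hp -> _]]]; apply: inn; lia.
move: (exec w hamming_rows s3) K4 K5 cs4 i4 Q4 {F4} => s4 K4 K5 cs4 i4 Q4.
case: (R s4 rok =P 1) => ok4; last first.
  split=> [|V].
    have [[_ _ z _] _ _ _] := cs4 => h.
    by case: (@rejected (edges ;; counts ;; verdict) s4 isT isT z ok4 h).
  case: ok4; apply/K4 => j hj; case: V => _ V _; apply: V (edge j hj).
    by apply: inn; case/andP: hj.
  exact: parn.
have {K5}K5 := K5 ok4.
rewrite exec_seq.
have [K6 K7 K8] := edges_spec cs4 K5 i4.
have cs5 := chk_exec (c := edges) isT isT cs4.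
have F5 := exec_frame w edges s4.
have Q5 : queued q (exec w edges s4).
  case: Q4 => e1 e2 e3 e4 [e5 e6 e7]; split=> //; first by rewrite F5.1.
  by split; rewrite F5.2.
have K5' u : u < n -> (forall v, v < n -> T (exec w edges s4) tH u v = H u v) /\
   T (exec w edges s4) tX u 0 = X u by rewrite !F5.2 //; apply: K5.
move: (exec w edges s4) K6 K7 K8 cs5 Q5 K5' {F5} => s5 K6 K7 K8 cs5 Q5 K5'.
case: (R s5 rok =P 1) => ok5; last first.
  split=> [|[v1 v2 v3]].
    by have [[_ _ z _] _ _ _] := cs5 => h; case: (@rejected (counts ;; verdict) s5 isT isT z ok5 h).
  case: ok5; apply/K6; split=> // u hu v hv; split=> [h0|]; last exact: v2.
  apply/eqP/negPn/negP => /eqP uv; have [x [_ _]] := v3 u v hu hv uv.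
  by rewrite h0.
have [_ K9] := K6.1 ok5.
have inj u v : u < n -> v < n -> H u v = 0 -> u = v by move=> hu hv; apply: (K9 u hu v hv).1.
have eA u v : u < n -> v < n -> A u v -> H u v = 1 by move=> hu hv; apply: (K9 u hu v hv).2.
rewrite exec_seq.
have K10 := counts_spec cs5 Q5 sq bits inj eA K5' K7 K8.
have cs6 := chk_exec (c := counts) isT isT cs5.
have ok6 : R (exec w counts s5) rok = 1 by rewrite (exec_frame w counts s5).1.
have /= -> := verdict_spec cs6.
split=> [[_ K11]|[_ _ v3]].
  split=> // u v hu hv uv.
  have := K10 v u hv hu; case e: (T _ _ _ _) => [|c]; first by case: uv; apply: K11 e.
  move/esym => hc; have [x /andP[ax hx]] : exists x : 'I_n, A u x && (H x v < H u v).
    apply/existsP; apply: contraTT isT => /existsPn h.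
    by move: hc; rewrite /closer big1 // => i _; rewrite (negbTE (h i)).
  by exists x.
split=> // v hv u hu; rewrite K10 // => h0; apply/eqP/negPn/negP => /eqP uv.
have [x [hx ax lx]] := v3 u v hu hv uv.
by move/eqP: h0; rewrite /closer sum_nat_eq0 => /forallP/(_ (Ordinal hx)) /=; rewrite ax lx.
Qed.

End Checker.
End Base.

(** * Contracted partial cubes *)

Section Contraction.

Variables (K n : nat) (l : nat -> 'I_K -> bool) (A : nat -> nat -> bool).
Implicit Types (F : seq 'I_K) (i j c : 'I_K) (u v x y a b p q r : nat).

(** The Hamming distance in the graph that results from contracting the classes in [F]. Two vertices
    are merged iff it is 0. *)
Definition dq F u v := #|[set i | (i \notin F) && (l u i != l v i)]|.

Definition flip F i a b :=
  i \notin F /\ forall j, j \notin F -> (l a j != l b j) = (j == i).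

Lemma dqC F u v : dq F u v = dq F v u.
Proof. by apply: eq_card => i; rewrite !inE eq_sym. Qed.

Lemma dq_eq0 F u v : dq F u v = 0 <-> forall i, i \notin F -> l u i = l v i.
Proof.
split=> [/eqP|H]; last first.
  by apply: eq_card0 => i; rewrite !inE; case Fi: (i \in F) => //=; rewrite H ?Fi ?eqxx.
rewrite cards_eq0 => /eqP/setP H i Fi; apply/eqP/negPn/negP => h.
by have := H i; rewrite !inE Fi h.
Qed.

Lemma dqxx F u : dq F u u = 0.
Proof. exact/dq_eq0. Qed.

Lemma eq_dq F u v x : dq F u v = 0 -> dq F u x = dq F v x.
Proof.
by move/dq_eq0 => E; apply: eq_card => i; rewrite !inE; case Fi: (i \in F) => //=; rewrite E ?Fi.
Qed.

Lemma dq_eq1 F u v : dq F u v = 1 <-> exists i, flip F i u v.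
Proof.
split=> [/eqP/cards1P[i /setP E]|[i [Fi E]]]; last first.
  apply/eqP/cards1P; exists i; apply/setP => j; rewrite !inE.
  case Fj: (j \in F) => /=; last by rewrite E ?Fj.
  by apply/esym/eqP => e; rewrite -e Fj in Fi.
have := E i; rewrite !inE eqxx => /andP[Fi _].
by exists i; split=> // j Fj; have := E j; rewrite !inE Fj.
Qed.

Lemma flipE F i a b j : flip F i a b -> j \notin F -> l b j = l a j (+) (j == i).
Proof. by case=> _ E Fj; rewrite -E //; case: (l a j) (l b j) => [] []. Qed.

Lemma flip_dq F i a b v : flip F i a b ->
  if l a i == l v i then dq F b v = (dq F a v).+1 else dq F a v = (dq F b v).+1.
Proof.
move=> fl; have Fi := fl.1; case: ifP => h.
  rewrite /dq (cardsD1 i) inE Fi (flipE fl Fi) eqxx.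
  have -> : l a i (+) true != l v i by move/eqP: h => ->; case: (l v i).
  rewrite add1n; congr S; apply: eq_card => j; rewrite !inE.
  case: (j =P i) => [->|/eqP ji] /=; first by rewrite h andbF.
  by case Fj: (j \in F) => //=; rewrite (flipE fl) ?Fj // (negbTE ji) addbF.
rewrite /dq (cardsD1 i) inE Fi h.
rewrite add1n; congr S; apply: eq_card => j; rewrite !inE.
case: (j =P i) => [->|/eqP ji] /=.
  by rewrite (flipE fl) ?Fi // eqxx; case: (l a i) (l v i) h => [] [].
by case Fj: (j \in F) => //=; rewrite (flipE fl) ?Fj // (negbTE ji) addbF.
Qed.

Lemma flip_inj F i a b x : flip F i a b -> flip F i a x -> dq F b x = 0.
Proof. by move=> f1 f2; apply/dq_eq0 => j Fj; rewrite (flipE f1) ?(flipE f2). Qed.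

Hypothesis n_gt0 : 0 < n.
Hypothesis edge_dq : forall u v, u < n -> v < n -> A u v -> dq [::] u v = 1.
Hypothesis geodesic : forall u v, u < n -> v < n -> u <> v ->
  exists x, [/\ x < n, A u x & dq [::] x v < dq [::] u v].

(** The flipped coordinate is one where [u] and [v] differ, as otherwise the step would lead away
    from [v]. *)
Lemma geodesic_step u v : u < n -> v < n -> u <> v ->
  exists x i, [/\ x < n, A u x, flip [::] i u x, l u i != l v i &
                  dq [::] x v < dq [::] u v].
Proof.
move=> hu hv uv; have [x [hx ax lx]] := geodesic hu hv uv.
have /dq_eq1[i fl] := edge_dq hu hx ax.
exists x, i; split=> //; have := flip_dq v fl; case: eqP => // _ e.
by move: lx; rewrite e ltnNge leqnSn.
Qed.

Lemma flipW F i a b : i \notin F -> flip [::] i a b -> flip F i a b.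
Proof. by move=> Fi [_ E]; split=> // j _; apply: E. Qed.

Lemma flip_in F i a b : i \in F -> flip [::] i a b -> dq F a b = 0.
Proof.
move=> Fi [_ E]; apply/dq_eq0 => j Fj; have := E j isT.
have -> : (j == i) = false by apply: contraNF Fj => /eqP ->.
by move/negbT; rewrite negbK => /eqP.
Qed.

(* The first edge of a geodesic that the contraction of [F] does not kill. *)
Lemma contracted_edge F u v : u < n -> v < n -> 0 < dq F u v ->
  exists x y i, [/\ x < n /\ y < n, A x y, dq F u x = 0, l u i != l v i &
                    i \notin F /\ flip [::] i x y].
Proof.
move=> + hv; have [m] := ubnP (dq [::] u v); elim: m u => // m IH u hm hu d0.
have uv : u <> v by move=> e; rewrite e dqxx in d0.
have [x [i [hx ax fl ui lx]]] := geodesic_step hu hv uv.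
case Fi: (i \in F); last by exists u, x, i; rewrite dqxx Fi; split.
have ux := flip_in Fi fl.
have [||x' [y [j [hxy axy dx xj [Fj fl']]]]] := IH x _ hx.
- exact: leq_trans lx _.
- by rewrite -(eq_dq _ ux).
exists x', y, j; split=> //; first by rewrite (eq_dq _ ux).
by move/dq_eq0: ux => ->.
Qed.

Section Reps.

Variables (F : seq 'I_K) (rep : nat -> nat).
Hypothesis rep_lt : forall v, v < n -> rep v < n.
Hypothesis rep_dq : forall v, v < n -> dq F v (rep v) = 0.
Hypothesis dq_rep : forall u v, u < n -> v < n -> dq F u v = 0 -> rep u = rep v.

Definition alive a := (a < n) && (rep a == a).

Lemma live_rep v : v < n -> alive (rep v).
Proof.
move=> hv; rewrite /alive rep_lt //=; apply/eqP/esym.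
by apply: dq_rep => //; [apply: rep_lt | apply: rep_dq].
Qed.

Lemma live_inj a b : alive a -> alive b -> dq F a b = 0 -> a = b.
Proof.
move=> /andP[ha /eqP ea] /andP[hb /eqP eb] d.
by rewrite -ea -eb; apply: dq_rep.
Qed.

(** The edge of [contracted_edge] starts at a vertex merged with [a]; replacing its far end by the
    representative does not change any coordinate outside [F]. *)
Lemma live_step a v : alive a -> v < n -> 0 < dq F a v ->
  exists b i, [/\ alive b, flip F i a b & l a i != l v i].
Proof.
move=> la hv d0; have ha : a < n by case/andP: la.
have [x [y [i [[hx hy] axy dx li [Fi fl]]]]] := contracted_edge ha hv d0.
exists (rep y), i; split=> //; first exact: live_rep.
split=> // j Fj.
have /dq_eq0 E1 := dx; have /dq_eq0 E2 := rep_dq hy.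
by rewrite E1 // -E2 //; case: (flipW Fi fl) => _ ->.
Qed.

Lemma down_flip r u p : dq F u p = 1 ->
  dq F r p < dq F r u <-> exists2 i, flip F i u p & l u i != l r i.
Proof.
move=> /dq_eq1[i fl]; have H := flip_dq r fl; rewrite ![dq F _ r]dqC in H.
split=> [h|[j fj uj]].
  by exists i => //; case: eqP H => // _ H; move: h; rewrite H ltnNge leqnSn.
have ij : j = i.
  by have := fl.2 j fj.1; rewrite fj.2 ?fj.1 // eqxx => /esym/eqP.
by move: H; rewrite -ij (negbTE uj) => ->.
Qed.

(** [p] and [q] undo two different coordinates at which [u] differs from [r], because live vertices
    flipping the same one coincide. So every difference between [u] and [r] survives in at least one
    of them, and no new one arises. *)
Lemma two_downs r u p q c : alive p -> alive q -> p <> q ->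
  dq F u p = 1 -> dq F u q = 1 ->
  dq F r p < dq F r u -> dq F r q < dq F r u -> c \notin F ->
  (l u c != l r c) = (l p c != l r c) || (l q c != l r c).
Proof.
move=> lp lq pq up uq /(down_flip _ up)[i fi ui] /(down_flip _ uq)[j fj uj] Fc.
have ij : i != j.
  by apply/eqP => ij; apply: pq; apply: live_inj => //; apply: flip_inj fi _; rewrite ij.
rewrite (flipE fi Fc) (flipE fj Fc); case: (c =P i) => [e|ci].
  by rewrite e ui (negbTE ij) /= addbF ui orbT.
rewrite addbF; case: (c =P j) => [e|cj]; first by rewrite e uj.
by rewrite addbF orbb.
Qed.

(** Here [c] is the class of the edge from [r] to [s]. The step from [u] to its only closer
    neighbour cannot undo [c] unless [u] is [s], so the bit is inherited. *)
Lemma one_down r u p s c : alive u -> alive s -> s < n -> flip F c r s ->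
  dq F u p = 1 -> dq F r p < dq F r u ->
  (forall b, alive b -> dq F u b = 1 -> dq F r b < dq F r u -> b = p) ->
  (l u c != l r c) = (l p c != l r c) || (u == s).
Proof.
move=> lu ls hs fs up /(down_flip _ up)[i fi ui] only; have Fc := fs.1.
case: (u =P s) => [->|us]; first by rewrite orbT (flipE fs Fc) eqxx; case: (l r c).
rewrite orbF; case e: (l u c == l r c) => /=.
  rewrite (flipE fi Fc); case: (c =P i) => [ci|]; last by rewrite addbF e.
  by rewrite -ci e in ui.
(* Walk from [u] towards [s] instead of [r]. As [u] and [s] agree at [c], the step flips some other
   [j], at which [u] differs from [r] too. So it leads closer to [r], hence to [p], and [c] is
   kept. *)
have d0 : 0 < dq F u s by rewrite lt0n; apply/eqP => /(live_inj lu ls).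
have [b [j [lb fj uj]]] := live_step lu hs d0.
have cj : c != j.
  apply/eqP => cj; move: uj e; rewrite -cj (flipE fs Fc) eqxx.
  by case: (l u c) (l r c) => [] [].
have jr : l u j != l r j.
  by move: uj; rewrite (flipE fs fj.1) [j == c]eq_sym (negbTE cj) addbF.
have ub : dq F u b = 1 by apply/dq_eq1; exists j.
have <- : b = p by apply: only => //; apply/(down_flip _ ub); exists j.
by rewrite (flipE fj Fc) (negbTE cj) addbF e.
Qed.

Lemma has_down r u : alive r -> alive u -> r <> u ->
  exists b, [/\ alive b, dq F u b = 1 & dq F r b < dq F r u].
Proof.
move=> lr lu ru.
have d0 : 0 < dq F u r by rewrite lt0n; apply/eqP => /(live_inj lu lr)/esym.
have hr : r < n by case/andP: lr.
have [b [i [lb fl ui]]] := live_step lu hr d0.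
have ub : dq F u b = 1 by apply/dq_eq1; exists i.
by exists b; split=> //; apply/(down_flip _ ub); exists i.
Qed.

Lemma adj_level r u b : dq F u b = 1 ->
  dq F r b = (dq F r u).+1 \/ dq F r u = (dq F r b).+1.
Proof.
move=> /dq_eq1[i fl]; have := flip_dq r fl; rewrite ![dq F _ r]dqC.
by case: ifP; [left|right].
Qed.

End Reps.

(* A vertex closest to [0] that differs from it at [i] differs from it at no
   other coordinate that is not already met closer to [0], so that distinct
   coordinates have distinct such vertices. *)
Lemma nonconstant_lt F : uniq F ->
  (forall i, i \in F -> exists2 v, v < n & l v i != l 0 i) -> size F < n.
Proof.
move=> uF H.
have min i : i \in F -> exists v, [/\ v < n, l v i != l 0 i &
    forall x, x < n -> l x i != l 0 i -> dq [::] 0 v <= dq [::] 0 x].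
  move=> iF; pose P m := [exists v : 'I_n, (l v i != l 0 i) && (dq [::] 0 v == m)].
  have [v hv vi] := H i iF.
  have exP : exists m, P m.
    by exists (dq [::] 0 v); apply/existsP; exists (Ordinal hv); rewrite /= vi eqxx.
  have [m /existsP[x /andP[xi /eqP em]] mm] := ex_minnP exP.
  exists x; split=> // y hy yi; rewrite em; apply: mm; apply/existsP.
  by exists (Ordinal hy); rewrite yi /=.
pose Q i v := [/\ v < n, l v i != l 0 i &
    forall x, x < n -> l x i != l 0 i -> dq [::] 0 v <= dq [::] 0 x].
have [g Hg] : exists g : 'I_K -> nat, forall i, i \in F -> Q i (g i).
  elim: F {uF H} min => [|i F IH] min; first by exists (fun=> 0).
  have [|g Hg] := IH; first by move=> j jF; apply: min; rewrite inE jF orbT.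
  have [v Hv] := min i (mem_head _ _).
  exists (fun j => if j == i then v else g j) => j; rewrite inE.
  by case: eqP => [->|_ /Hg].
have ginj : {in F &, injective g}.
  move=> i j iF jF eij; apply/eqP/negPn/negP => ij.
  have [h1 h2 h3] := Hg i iF; have [_ g2 g3] := Hg j jF; rewrite -eij in g2 g3.
  have v0 : g i <> 0 by move=> e; rewrite e eqxx in h2.
  (* If [i] and [j] share the vertex [g i], one step towards 0 flips a single coordinate, so [x]
     still differs from 0 at [i] or at [j]. Being closer to 0, it contradicts the minimality for
     that coordinate. *)
  have [x [c [hx _ fl cx lx]]] := geodesic_step h1 n_gt0 v0.
  rewrite ![dq _ _ 0]dqC in lx.
  have lt : ~ (dq [::] 0 (g i) <= dq [::] 0 x) by rewrite leqNgt lx.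
  case: (i =P c) => [ic|/eqP ic].
    apply: lt; apply: g3 => //; rewrite (flipE fl) // -ic.
    by rewrite [j == i]eq_sym (negbTE ij) addbF.
  by apply: lt; apply: h3 => //; rewrite (flipE fl) // (negbTE ic) addbF.
rewrite -(size_map g); have := uniq_leq_size (s1 := 0 :: map g F) (s2 := iota 0 n).
rewrite size_iota; apply.
  rewrite /= map_inj_in_uniq // uF andbT; apply/mapP => -[i iF e].
  by have [_ + _] := Hg i iF; rewrite -e eqxx.
move=> x; rewrite inE mem_iota /= => /predU1P[->//|/mapP[i iF ->]].
by have [] := Hg i iF.
Qed.

End Contraction.

(** * The subroutines of the labeller *)

Lemma ltS_cases i j : (i < j.+1) = (i == j) || (i < j).
Proof. by rewrite ltnS leq_eqVlt. Qed.

Section Labeller.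

Variables n w : nat.
Hypotheses (n_gt0 : 0 < n) (n_lt : n < 2 ^ w).
Implicit Types s : state.

Notation base := (base n w).

Definition lists tl td (N : nat -> seq nat) s :=
  forall a, a < n -> T s td a 0 = size (N a) /\
    forall j, j < size (N a) -> T s tl a j = nth 0 (N a) j.

Lemma init_row_spec (A : nat -> nat -> bool) s :
  base s -> (forall v, v < n -> T s tA (R s ru) v = A (R s ru) v) ->
  T s tnewdeg (R s ru) 0 = 0 ->
  let s' := exec w init_row s in let u := R s ru in
  let p := [seq v <- iota 0 n | A u v] in
  [/\ T s' tnewdeg u 0 = size p, forall j, j < size p -> T s' tnew u j = nth 0 p j,
      forall a j, a <> u -> T s' tnew a j = T s tnew a j &
      forall a j, a <> u -> T s' tnewdeg a j = T s tnewdeg a j].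
Proof.
move=> bs hA h0 /=; set u := R s ru in hA h0 *; have [hn _ _ _] := bs.
apply: (@for_base n w n (fun m s1 => let p := [seq v <- iota 0 m | A u v] in
  [/\ T s1 tnewdeg u 0 = size p, forall j, j < size p -> T s1 tnew u j = nth 0 p j,
      forall a j, a <> u -> T s1 tnew a j = T s tnew a j &
      forall a j, a <> u -> T s1 tnewdeg a j = T s tnewdeg a j])) => //.
move=> m s1 hm em F [b0 b1 b2 b3] [E1 E2 E3 E4]; have [FR FT] := F.
have iotaS : iota 0 m.+1 = rcons (iota 0 m) m by rewrite -addn1 iotaD cats1.
rewrite iotaS filter_rcons.
rewrite !execE /test /= em b1 b2 (FR ru isT) -/u (FT tA isT) hA //.
case Aum: (A u m) => //=.
have sz : size [seq v <- iota 0 m | A u v] < n.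
  by apply: leq_ltn_trans hm; rewrite size_filter -[X in _ <= X](size_iota 0 m) count_size.
rewrite !E1 (incE n_lt) // size_rcons; split.
- by rewrite !eqxx.
- move=> j; rewrite ltS_cases eqxx nth_rcons => /predU1P[->|hj]; first by rewrite ltnn !eqxx.
  by rewrite hj (ltn_eqF hj) /= E2.
- by move=> a j au; rewrite (introF eqP au) /= E3.
by move=> a j au; rewrite (introF eqP au) /= E4.
Qed.

Lemma init_lists_spec (A : nat -> nat -> bool) s :
  base s -> (forall u v, u < n -> v < n -> T s tA u v = A u v) ->
  (forall u, T s tnewdeg u 0 = 0) ->
  let s' := exec w init_lists s in
  lists tnew tnewdeg (fun u => [seq v <- iota 0 n | A u v]) s' /\
  forall u, u < n -> T s' trep u 0 = u.
Proof.
move=> bs hA h0 /=; have [hn _ _ _] := bs.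
pose N u := [seq v <- iota 0 n | A u v].
suff [] : (forall a, a < n -> [/\ T (exec w init_lists s) tnewdeg a 0 = size (N a),
    forall j, j < size (N a) -> T (exec w init_lists s) tnew a j = nth 0 (N a) j &
    T (exec w init_lists s) trep a 0 = a]) /\ 
   forall a, n <= a -> T (exec w init_lists s) tnewdeg a 0 = 0.
  move=> E _; split=> [a ha|u hu]; last by case: (E u hu).
  by have [] := E a ha.
apply: (@for_base n w n (fun m s1 => (forall a, a < m -> [/\ T s1 tnewdeg a 0 = size (N a),
    forall j, j < size (N a) -> T s1 tnew a j = nth 0 (N a) j &
    T s1 trep a 0 = a]) /\ forall a, m <= a -> T s1 tnewdeg a 0 = 0)) => //.
  by split=> // a _; apply: h0.
move=> m s1 hm em F bs1 [E1 E2]; have [FR FT] := F; have [b0 b1 b2 b3] := bs1.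
rewrite exec_seq exec_sto em b2; set s2 := sett s1 trep _ _ _.
have bs2 : base s2 by [].
have u2 : R s2 ru = m by [].
have hA2 v : v < n -> T s2 tA (R s2 ru) v = A (R s2 ru) v.
  by move=> hv; rewrite u2 /= (FT tA isT) hA.
have h2 : T s2 tnewdeg (R s2 ru) 0 = 0 by rewrite u2 /= E2.
have [K1 K2 K3 K4] := init_row_spec bs2 hA2 h2; rewrite u2 in K1 K2 K3 K4.
have K5 : T (exec w init_row s2) trep = T s2 trep by rewrite (exec_frame w init_row s2).2.
move: (exec w init_row s2) K1 K2 K3 K4 K5 => s3 K1 K2 K3 K4 K5.
split=> [a|a ha] /=; last by rewrite K4 /= ?E2 //; lia.
rewrite ltS_cases K5 /= => /predU1P[->|ha]; first by rewrite eqxx.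
rewrite (ltn_eqF ha) /=; have am : a <> m by lia.
have [G1 G2 G3] := E1 a ha; split=> // [|j hj]; first by rewrite K4.
by rewrite K3 //= G2.
Qed.

Lemma max_degree_spec s : base s ->
  let s' := exec w max_degree s in
  [/\ forall v, v < n -> T s tnewdeg v 0 <= R s' rD, R s' rr < n &
      0 < R s' rD -> T s tnewdeg (R s' rr) 0 = R s' rD].
Proof.
move=> bs /=; have [hn _ h0 _] := bs.
rewrite /max_degree exec_seq exec_mov exec_seq exec_mov /= h0.
set s1 := setr _ rr _; have bs1 : base s1 by [].
apply: (@for_base n w n (fun m s2 => [/\ forall v, v < m -> T s tnewdeg v 0 <= R s2 rD,
      R s2 rr < n & 0 < R s2 rD -> T s tnewdeg (R s2 rr) 0 = R s2 rD])) => //.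
move=> m s2 hm em F [b0 b1 b2 b3] [E1 E2 E3]; have [FR FT] := F.
rewrite !execE /test /= em b2 (FT tnewdeg isT) /=.
case: ltnP => h /=; rewrite ?em; split=> // v; rewrite ltS_cases => /predU1P[->|hv] //.
  exact: leq_trans (E1 v hv) (ltnW h).
exact: E1.
Qed.

Lemma copy_row_spec s : base s ->
  let s' := exec w copy_row s in
  (forall j, j < R s rD -> j < R s rg -> T s' tadj (R s rv) j = T s tnew (R s rv) j) /\
  (forall a j, a <> R s rv -> T s' tadj a j = T s tadj a j).
Proof.
move=> bs /=.
apply: (@for_base n w (R s rD) (fun m s1 =>
  (forall j, j < m -> j < R s rg -> T s1 tadj (R s rv) j = T s tnew (R s rv) j) /\
  (forall a j, a <> R s rv -> T s1 tadj a j = T s tadj a j))) => //.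
move=> m s1 hm em F [b0 b1 b2 b3] [E1 E2]; have [FR FT] := F.
rewrite !execE /test /= em (FR rg isT) (FR rv isT) (FT tnew isT).
case: ltnP => h /=; (split=> [j|a j av]; last by rewrite ?(introF eqP av) /= E2);
  rewrite ltS_cases => /predU1P[->|hj] hg.
- by rewrite !eqxx.
- by rewrite (ltn_eqF hj) andbF E1.
- by rewrite ltnNge h in hg.
exact: E1.
Qed.

Lemma copy_lists_spec N s : base s -> lists tnew tnewdeg N s ->
  (forall a, a < n -> size (N a) <= R s rD) ->
  let s' := exec w copy_lists s in
  lists tadj tdeg N s' /\
  forall v, v < n -> T s' tnewdeg v 0 = 0 /\ T s' tdist v 0 = 0.
Proof.
move=> bs LN hD /=; have [hn _ h0 _] := bs.
suff [] : (forall v, v < n -> [/\ T (exec w copy_lists s) tdeg v 0 = size (N v),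
   forall j, j < size (N v) -> T (exec w copy_lists s) tadj v j = nth 0 (N v) j,
   T (exec w copy_lists s) tnewdeg v 0 = 0 & T (exec w copy_lists s) tdist v 0 = 0]) /\
   (forall v, n <= v -> T (exec w copy_lists s) tnewdeg v 0 = T s tnewdeg v 0).
  by move=> E _; split=> v hv; have [] := E v hv.
apply: (@for_base n w n (fun m s1 => (forall v, v < m -> [/\ T s1 tdeg v 0 = size (N v),
   forall j, j < size (N v) -> T s1 tadj v j = nth 0 (N v) j,
   T s1 tnewdeg v 0 = 0 & T s1 tdist v 0 = 0]) /\
   (forall v, m <= v -> T s1 tnewdeg v 0 = T s tnewdeg v 0))) => //.
move=> m s1 hm em F bs1 [E1 E2]; have [FR FT] := F; have [b0 b1 b2 b3] := bs1.
have [Lm1 Lm2] := LN m hm.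
rewrite exec_seq exec_lk exec_seq exec_sto exec_seq /= em b2 E2 // Lm1.
set s2 := sett _ tdeg _ _ _; have bs2 : base s2 by [].
have [K1 K2] := copy_row_spec bs2.
have D2 : R s2 rD = R s rD by rewrite /= (FR rD isT).
rewrite D2 [R s2 rg]/= [R s2 rv]/= em in K1 K2.
have G := exec_frame w copy_row s2.
have v3 : R (exec w copy_row s2) rv = m by rewrite G.1.
have z3 : R (exec w copy_row s2) rzero = 0 by rewrite G.1.
have d3 : T (exec w copy_row s2) tdeg = T s2 tdeg by rewrite G.2.
have n3 : T (exec w copy_row s2) tnewdeg = T s1 tnewdeg by rewrite G.2.
have e3 : T (exec w copy_row s2) tdist = T s1 tdist by rewrite G.2.
move: (exec w copy_row s2) K1 K2 v3 z3 d3 n3 e3 {G} => s3 K1 K2 v3 z3 d3 n3 e3.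
rewrite ?execE /= v3 z3 d3 n3 e3 /=; split=> v hv; last first.
  by rewrite (gtn_eqF hv) /= E2 // ltnW.
move: hv; rewrite ltS_cases => /predU1P[->|hv].
  by rewrite !eqxx; split=> // j hj; rewrite K1 ?(leq_trans hj) ?hD //= (FT tnew isT) Lm2.
rewrite (ltn_eqF hv) /=; have [G1 G2 G3 G4] := E1 v hv; split=> // j hj.
by rewrite K2 /= ?G2 //; lia.
Qed.

Lemma star_spec k s : base s -> R s rk = k -> k + R s rD <= n ->
  forall v c, T (exec w star s) tL v c =
    if (k <= c < k + R s rD) && (v == T s tadj (R s rr) (c - k)) then 1 else T s tL v c.
Proof.
move=> bs hk hD; have [hn _ h0 _] := bs.
apply: (@for_base n w (R s rD) (fun m s1 => forall v c, T s1 tL v c =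
    if (k <= c < k + m) && (v == T s tadj (R s rr) (c - k)) then 1 else T s tL v c)) => //.
  by move=> v c; rewrite addn0 ltnNge; case: (k <= c).
move=> m s1 hm em F [b0 b1 b2 b3] E v c; have [FR FT] := F.
rewrite !execE /= em (FR rr isT) (FT tadj isT) (FR rk isT) hk b1.
rewrite modn_small; last by lia.
rewrite addnS ltS_cases E; case: (c =P k + m) => [->|]; last by rewrite andbF.
rewrite leq_addr addKn andbT /=; case: ifP => //= _.
by rewrite ltnn.
Qed.

(** The list is reversed because later finds displace earlier ones; the default value [u] of [nth]
    is the initial content of both registers. *)
Lemma downs_spec N (d : nat -> nat) s :
  base s -> R s ru < n -> lists tadj tdeg N s -> size (N (R s ru)) <= R s rD ->
  R s rg = size (N (R s ru)) ->
  (forall v, v \in N (R s ru) -> T s tdist v 0 = d v) ->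
  R s rp1 = R s ru -> R s rp2 = R s ru ->
  let s' := exec w downs s in let u := R s ru in
  let p := rev [seq v <- N u | d v < R s rdu] in
  R s' rp1 = nth u p 0 /\ R s' rp2 = nth u p 1.
Proof.
move=> bs hu LN hD hg hd h1 h2 /=; have [hn _ h0 _] := bs.
set u := R s ru in hu hg hd h1 h2 hD *.
have <- : take (R s rD) (N u) = N u by rewrite take_oversize.
apply: (@for_base n w (R s rD) (fun m s1 =>
  let p := rev [seq v <- take m (N u) | d v < R s rdu] in
  R s1 rp1 = nth u p 0 /\ R s1 rp2 = nth u p 1)) => //.
  by rewrite take0.
move=> m s1 hm em F [b0 b1 b2 b3] [E1 E2]; have [FR FT] := F.
rewrite !execE /test /= em (FR rg isT) hg (FR ru isT) -/u (FT tadj isT) (FT tdist isT) b2.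
rewrite (FR rdu isT).
case: ltnP => h /=; last first.
  by rewrite !take_oversize ?(leq_trans h) // in E1 E2 *.
rewrite (LN u hu).2 // hd ?mem_nth //.
rewrite (take_nth 0) // filter_rcons; case: ifP => // _.
by rewrite /= rev_rcons /= E1.
Qed.

Lemma fill_row_spec k (e1 e2 : nat -> bool) s :
  base s -> R s rk = k -> k + R s rD <= n -> R s rx = 0 ->
  (forall i, i < R s rD -> T s tL (R s rp1) (k + i) = e1 i) ->
  (forall i, i < R s rD -> T s tL (R s rp2) (k + i) = e2 i) ->
  let s' := exec w fill_row s in
  [/\ forall i, i < R s rD -> T s' tL (R s ru) (k + i) = e1 i || e2 i,
      R s' rx = \sum_(i < R s rD) (e1 i || e2 i) &
      forall a c, a <> R s ru \/ ~~ (k <= c < k + R s rD) -> T s' tL a c = T s tL a c].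
Proof.
move=> bs hk hD hx h1 h2 /=; have [hn _ h0 _] := bs.
apply: (@for_base n w (R s rD) (fun m s1 => 
  [/\ forall i, i < m -> T s1 tL (R s ru) (k + i) = e1 i || e2 i,
      R s1 rx = \sum_(i < m) (e1 i || e2 i) &
      forall a c, a <> R s ru \/ ~~ (k <= c < k + m) -> T s1 tL a c = T s tL a c])) => //.
  by split=> //; rewrite big_ord0.
move=> m s1 hm em F [b0 b1 b2 b3] [E1 E2 E3]; have [FR FT] := F.
have ekm : (R s1 rk + R s1 rs) %% 2 ^ w = k + m.
  by rewrite em (FR rk isT) hk modn_small; lia.
(* Column [k + m] is still untouched when it is read. This matters when [rp2] is the row being
   written, whose entry is then the seed. *)
have km a : T s1 tL a (k + m) = T s tL a (k + m) by apply: E3; right; lia.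
have sle : \sum_(i < m) (e1 i || e2 i) <= m.
  rewrite -[X in _ <= X]card_ord -sum1_card.
  by apply: leq_sum => i _; case: (_ || _).
rewrite exec_seq exec_add ekm exec_seq exec_lk exec_seq exec_lk /=.
rewrite (FR rp1 isT) (FR rp2 isT) !km h1 // h2 //.
rewrite ?exec_seq; set d := when EQ rb rone _; set s2 := setr _ rb _.
have a3 : R (exec w d s2) ra = e1 m || e2 m.
  by rewrite /d !execE /test /s2 /= b1; case: (e1 m) (e2 m) => [] [] /=; rewrite ?b1.
have G := exec_frame w d s2.
have u3 : R (exec w d s2) ru = R s ru by rewrite G.1 //= (FR ru isT).
have c3 : R (exec w d s2) rc = k + m by rewrite G.1.
have x3 : R (exec w d s2) rx = \sum_(i < m) (e1 i || e2 i) by rewrite G.1.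
have T3 : T (exec w d s2) tL = T s1 tL by rewrite G.2.
move: (exec w d s2) a3 u3 c3 x3 T3 {G} => s3 a3 u3 c3 x3 T3.
rewrite ?execE /= u3 c3 a3 x3 T3 big_ord_recr /=; split.
- move=> i; rewrite ltS_cases eqxx => /predU1P[->|hi]; first by rewrite eqxx.
  by rewrite eqn_add2l (ltn_eqF hi) /= E1.
- move: sle; set S := \sum_(i < m) _ => sle; rewrite modn_small //.
  by case: (e1 m || e2 m) => /=; lia.
move=> a c h; case: eqP => [ea|na] /=; last by rewrite E3 //; left.
case: eqP => [ec|nc]; last by rewrite E3 //; case: h; [left|right; lia].
by case: h => [|]; [rewrite ea | rewrite ec leq_addr ltn_add2l ltnSn].
Qed.

Lemma spread_row_spec k s : base s -> R s rk = k -> k + R s rD <= n ->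
  let s' := exec w spread_row s in
  (forall i, i < R s rD -> T s' tL (R s rv) (k + i) = T s tL (R s ra) (k + i)) /\
  (forall a c, a <> R s rv \/ ~~ (k <= c < k + R s rD) -> T s' tL a c = T s tL a c).
Proof.
move=> bs hk hD /=; have [hn _ h0 _] := bs.
apply: (@for_base n w (R s rD) (fun m s1 => 
  (forall i, i < m -> T s1 tL (R s rv) (k + i) = T s tL (R s ra) (k + i)) /\
  (forall a c, a <> R s rv \/ ~~ (k <= c < k + m) -> T s1 tL a c = T s tL a c))) => //.
move=> m s1 hm em F [b0 b1 b2 b3] [E1 E2]; have [FR FT] := F.
have ekm : (R s1 rk + R s1 rs) %% 2 ^ w = k + m.
  by rewrite em (FR rk isT) hk modn_small; lia.
have km a : T s1 tL a (k + m) = T s tL a (k + m) by apply: E2; right; lia.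
rewrite !execE /= ekm (FR ra isT) (FR rv isT) km; split.
  move=> i; rewrite ltS_cases eqxx => /predU1P[->|hi]; first by rewrite eqxx.
  by rewrite eqn_add2l (ltn_eqF hi) /= E1.
move=> a c h; case: eqP => [ea|na] /=; last by rewrite E2 //; left.
case: eqP => [ec|nc]; last by rewrite E2 //; case: h; [left|right; lia].
by case: h => [|]; [rewrite ea | rewrite ec leq_addr ltn_add2l ltnSn].
Qed.

Lemma spread_spec k s : base s -> R s rk = k -> k + R s rD <= n ->
  (forall v, v < n -> T s trep v 0 < n /\ T s trep (T s trep v 0) 0 = T s trep v 0) ->
  let s' := exec w spread s in
  (forall v i, v < n -> i < R s rD -> T s' tL v (k + i) = T s tL (T s trep v 0) (k + i)) /\
  (forall a c, ~~ (k <= c < k + R s rD) -> T s' tL a c = T s tL a c).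
Proof.
move=> bs hk hD hr /=; have [hn _ h0 _] := bs.
suff [E1 E2 E3] : [/\ (forall v, v < n -> forall i, i < R s rD ->
     T (exec w spread s) tL v (k + i) = T s tL (T s trep v 0) (k + i)),
   (forall v i, n <= v -> T (exec w spread s) tL v i = T s tL v i) &
   (forall a c, ~~ (k <= c < k + R s rD) -> T (exec w spread s) tL a c = T s tL a c)].
  by split=> // v i hv hi; apply: E1.
apply: (@for_base n w n (fun m s1 => [/\ (forall v, v < m -> forall i, i < R s rD ->
     T s1 tL v (k + i) = T s tL (T s trep v 0) (k + i)),
   (forall v i, m <= v -> T s1 tL v i = T s tL v i) &
   (forall a c, ~~ (k <= c < k + R s rD) -> T s1 tL a c = T s tL a c)])) => //.
move=> m s1 hm em F bs1 [E1 E2 E3]; have [FR FT] := F; have [b0 b1 b2 b3] := bs1.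
rewrite exec_seq exec_lk em b2 (FT trep isT); set s2 := setr s1 ra _.
have bs2 : base s2 by [].
have D2 : R s2 rD = R s rD by rewrite /= (FR rD isT).
have k2 : R s2 rk = k by rewrite /= (FR rk isT).
have [K1 K2] := @spread_row_spec k s2 bs2 k2 (eq_ind_r (fun z => k + z <= n) hD D2).
rewrite D2 [R s2 rv]/= [R s2 ra]/= em in K1 K2.
move: (exec w spread_row s2) K1 K2 => s3 K1 K2 /=.
have [hr1 hr2] := hr m hm.
split=> [v|v i hv|a c hc]; last 2 first.
- by rewrite K2 /= ?E2 //; lia.
- by rewrite K2 /= ?E3 //; right.
rewrite ltS_cases => /predU1P[->|hv] i hi; last by rewrite K2 /= ?E1 //; lia.
(* The row of a representative may already have been processed, but then it was copied from itself,
   since representatives are fixed by [trep]. *)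
rewrite K1 //=; case: (ltnP (T s trep m 0) m) => h; last by rewrite E2.
by rewrite E1 // hr2.
Qed.

Lemma relabel_spec s : base s ->
  forall y, y < n -> T (exec w relabel s) trep y 0 =
    if T s trep y 0 == R s rp1 then R s rp2 else T s trep y 0.
Proof.
move=> bs; have [hn _ h0 _] := bs.
suff [E _] : (forall y, y < n -> T (exec w relabel s) trep y 0 =
    if T s trep y 0 == R s rp1 then R s rp2 else T s trep y 0) /\
   forall y, n <= y -> T (exec w relabel s) trep y 0 = T s trep y 0 by [].
apply: (@for_base n w n (fun m s1 => (forall y, y < m -> T s1 trep y 0 =
    if T s trep y 0 == R s rp1 then R s rp2 else T s trep y 0) /\
   forall y, m <= y -> T s1 trep y 0 = T s trep y 0)) => //.
move=> m s1 hm em F [b0 b1 b2 b3] [E1 E2]; have [FR FT] := F.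
rewrite !execE /test /= em b2 (FR rp1 isT) E2 //.
case: (T s trep m 0 =P R s rp1) => h /=; rewrite ?em ?b2 ?(FR rp2 isT); split=> y.
- rewrite ltS_cases andbT => /predU1P[->|hy]; first by rewrite h !eqxx.
  by rewrite (ltn_eqF hy) E1.
- by move=> hy; rewrite (gtn_eqF hy) /= E2 // ltnW.
- rewrite ltS_cases => /predU1P[->|hy]; last by rewrite E1.
  by rewrite E2 // (introF eqP h).
by move=> hy; rewrite E2 // ltnW.
Qed.

Lemma finish_spec s : base s -> R s rD <= R s rrem -> R s rk + R s rrem = n ->
  let s' := exec w finish s in
  R s' rk = R s rk + R s rD /\ R s' rrem = R s rrem - R s rD.
Proof.
move=> bs hD hk; have [hn _ h0 _] := bs.
apply: (@for_base n w (R s rD) (fun m s1 =>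
  R s1 rk = R s rk + m /\ R s1 rrem = R s rrem - m)) => //.
  by rewrite /= addn0 subn0.
move=> m s1 hm em F [b0 b1 b2 b3] [E1 E2].
rewrite !execE /= E1 E2 b1 b3 (incE n_lt) ?(decE n_lt); lia.
Qed.

(** * Breadth-first search for a given level function *)

Section Bfs.

Variables (N : nat -> seq nat) (live : pred nat) (d : nat -> nat) (r : nat).
Hypothesis live_lt : forall v, live v -> v < n.
Hypothesis live_r : live r.
Hypothesis d_r : d r = 0.
Hypothesis N_live : forall u v, live u -> v \in N u -> live v.
Hypothesis N_sym : forall u v, live u -> v \in N u -> u \in N v.
Hypothesis N_d : forall u v, live u -> v \in N u -> d v = (d u).+1 \/ d u = (d v).+1.
Hypothesis down : forall u, live u -> u <> r -> exists2 v, v \in N u & d v < d u.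
Hypothesis d_lt : forall v, live v -> d v < n.

Definition bq (q : seq nat) s :=
  [/\ R s rtail = size q, uniq q, all live q,
      forall h, h < size q -> T s tqueue h 0 = nth 0 q h &
      forall v, v < n -> T s tdist v 0 = if v \in q then (d v).+1 else 0].

Lemma bfs_scan_spec q s :
  base s -> lists tadj tdeg N s -> size (N (R s ru)) <= R s rD ->
  bq q s -> R s ru \in q -> R s rg = size (N (R s ru)) ->
  R s rdu = (d (R s ru)).+2 %% 2 ^ w ->
  (forall v, live v -> v \notin q -> d (R s ru) < d v) ->
  exists q2 : seq nat, let s' := exec w bfs_scan s in
   [/\ bq (q ++ q2) s', all (fun v => d v == (d (R s ru)).+1) q2 &
       forall v, v \in N (R s ru) -> v \in q ++ q2].
Proof.
move=> bs LN hD Q uq hg hdu fresh /=; set u := R s ru in hD uq hg hdu fresh *.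
have [_ _ /allP lq _ _] := Q; have lu := lq u uq; have hu := live_lt lu.
suff [q2 [Q2 d2 c2]] : exists q2 : seq nat,
   [/\ bq (q ++ q2) (exec w bfs_scan s), all (fun v => d v == (d u).+1) q2 &
       forall v, v \in take (R s rD) (N u) -> v \in q ++ q2].
  by exists q2; split=> // v vN; apply: c2; rewrite take_oversize.
apply: (@for_base n w (R s rD) (fun m s1 => exists q2 : seq nat,
   [/\ bq (q ++ q2) s1, all (fun v => d v == (d u).+1) q2 &
       forall v, v \in take m (N u) -> v \in q ++ q2])) => //.
  by exists [::]; rewrite cats0 take0.
move=> m s1 hm em F [b0 b1 b2 b3] [q2 [Q2 d2 c2]]; have [FR FT] := F.
rewrite !execE /test /= em (FR rg isT) hg (FR ru isT) -/u (FT tadj isT) b2 (FR rdu isT) hdu.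
case: ltnP => h /=; last first.
  by exists q2; split=> // v; rewrite take_oversize ?(leq_trans h) // => hv;
     apply: c2; rewrite take_oversize.
rewrite (LN u hu).2 // (take_nth 0) //; set v := nth 0 (N u) m.
have vN : v \in N u by rewrite mem_nth.
have lv := N_live lu vN; have hv := live_lt lv.
have [e1 e2 e3 e4 e5] := Q2.
rewrite e5 //; case vq: (v \in q ++ q2) => /=.
  by exists q2; split=> // x; rewrite mem_rcons inE => /predU1P[->|/c2].
(* An undiscovered vertex lies farther out than [u], and levels of neighbours differ by exactly
   one. *)
have dv : d v = (d u).+1.
  have : v \notin q by apply: contraFN vq => vq; rewrite mem_cat vq.
  by move/(fresh v lv); case: (N_d lu vN) => -> //; rewrite ltnNge leqnSn.
exists (rcons q2 v); rewrite -rcons_cat; split; last 2 first.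
- by rewrite all_rcons d2 dv eqxx.
- by move=> x; rewrite !mem_rcons !inE => /predU1P[->|/c2->]; rewrite ?eqxx ?orbT.
have sq : size (q ++ q2) < n.
  apply: (uniq_size_lt e2 _ hv); last by rewrite vq.
  by apply/allP => x /(allP e3) /live_lt.
rewrite /bq /= e1 b1 (incE n_lt) // size_rcons; split=> //.
- by rewrite rcons_uniq vq.
- by rewrite all_rcons lv.
- move=> j; rewrite ltS_cases andbT nth_rcons => /predU1P[->|hj]; first by rewrite ltnn eqxx.
  by rewrite hj (ltn_eqF hj) e4.
move=> x hx; rewrite mem_rcons inE andbT; case: eqP => [->|] //=; last by rewrite e5.
(* For a stored vertex [(d v).+1 <= n < 2 ^ w]. The value in [rdu] can wrap around only if there is
   no further level to be written. *)
by rewrite -dv modn_small //; apply: leq_ltn_trans (d_lt lv) n_lt.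
Qed.

Lemma bfs_spec s :
  base s -> R s rr = r -> lists tadj tdeg N s -> (forall a, live a -> size (N a) <= R s rD) ->
  (forall v, v < n -> T s tdist v 0 = 0) ->
  exists q : seq nat, let s' := exec w bfs s in
    [/\ bq q s', forall v, live v -> v \in q &
        forall i j, i < size q -> j < size q -> d (nth 0 q i) < d (nth 0 q j) -> i < j].
Proof.
move=> bs hr LN hD h0; have [hn h1 hz _] := bs.
have rn := live_lt live_r.
rewrite /bfs 2!exec_seq 2!exec_sto exec_seq exec_mov /= hz h1 hr.
set s1 := setr _ rtail 1; have bs1 : base s1 by [].
pose srt (q : seq nat) := forall i j, i < size q -> j < size q ->
  d (nth 0 q i) < d (nth 0 q j) -> i < j.
pose inv m s2 := exists q : seq nat, [/\ bq q s2, r \in q, srt q,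
  forall j, j < m -> j < size q -> forall v, v \in N (nth 0 q j) -> v \in q &
  m < size q -> forall v, v \in q -> d v <= (d (nth 0 q m)).+1].
(* Descending from an undiscovered vertex one meets a discovered one, at the latest [r]. It has not
   been processed yet, since otherwise its undiscovered neighbour would be in [q]. *)
have out m q v : r \in q -> all live q ->
  (forall j, j < m -> j < size q -> forall v, v \in N (nth 0 q j) -> v \in q) ->
  live v -> v \notin q -> exists2 b, b \in q & m <= index b q /\ d b < d v.
  move=> rq lq clos; have [c] := ubnP (d v); elim: c v => // c IH v hc lv vq.
  have vr : v <> r by move=> e; rewrite e rq in vq.
  have [b bN db] := down lv vr; have lb := N_live lv bN; have vNb := N_sym lv bN.
  case bq: (b \in q).
    exists b => //; split=> //; rewrite leqNgt; apply: contra vq => hm.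
    by apply: (clos (index b q)); rewrite ?index_mem ?nth_index.
  have [|x xq [hx dx]] := IH b _ lb (negbT bq); first by lia.
  by exists x => //; split=> //; lia.
suff [q [Q rq sq clos _]] : inv n (exec w bfs_loop s1).
  have [e1 e2 e3 e4 e5] := Q.
  exists q; split=> // v lv; apply: contraT => vq.
  (* After [n] rounds an unprocessed entry would have index at least [n], but the queue has at most
     [n] entries. *)
  have [b bq [hb _]] := out n q v rq e3 clos lv vq.
  have : size q <= n by apply: (uniq_size_le e2); apply/allP => x /(allP e3)/live_lt.
  by rewrite leqNgt; case/negP; apply: leq_ltn_trans hb _; rewrite index_mem.
apply: (@for_base n w n inv) => //.
  exists [:: r]; split=> //; last 1 first.
  - by move=> _ v; rewrite inE => /eqP ->; rewrite /= ltnW.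
  - rewrite /bq /=; split=> //; first by rewrite live_r.
      by case=> // _; rewrite eqxx.
    by move=> v hv; rewrite inE h0 // andbT; case: eqP => // ->; rewrite d_r.
  - by rewrite inE eqxx.
  - by case=> [|i] [|j] //=; rewrite ltnn.
move=> m s2 hm em F bs2 [q [Q rq sq clos lev]].
have [FR FT] := F; have [b0 b1 b2 b3] := bs2.
have [e1 e2 e3 e4 e5] := Q.
rewrite exec_if /test /= em e1; case: ltnP => hq; last first.
  rewrite ?exec_skip; exists q; split=> //.
  - by move=> j hj jq; apply: clos => //; apply: leq_trans jq _.
  - by move=> h; rewrite ltnNge leqW // in h.
set u := nth 0 q m.
have uq : u \in q by rewrite mem_nth.
have lu : live u by apply: (allP e3).
have hu := live_lt lu.
rewrite 4!exec_seq !exec_lk exec_add /= em b2 b1 e4 // -/u e5 // uq (FT tdeg isT).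
have -> : T s1 tdeg u 0 = size (N u) by rewrite /= (LN u hu).1.
rewrite addn1.
set s3 := setr _ rdu _.
have bs3 : base s3 by [].
have LN3 : lists tadj tdeg N s3.
  by move=> a ha; rewrite /= (FT tadj isT) (FT tdeg isT); apply: LN.
have u3 : R s3 ru = u by [].
have hD3 : size (N (R s3 ru)) <= R s3 rD by rewrite u3 /= (FR rD isT) hD.
have Q3 : bq q s3 by [].
(* The queue is sorted by level, so the unprocessed vertex below [v] has at least the level of the
   head [u]. *)
have fresh v : live v -> v \notin q -> d (R s3 ru) < d v.
  move=> lv vq; have [b bq [hb db]] := out m q v rq e3 clos lv vq.
  rewrite u3; apply: leq_ltn_trans db; rewrite leqNgt; apply/negP => dlt.
  have := sq (index b q) m; rewrite index_mem nth_index // => /(_ bq hq dlt).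
  by rewrite ltnNge hb.
have [q2 [Q4 d4 c4]] := bfs_scan_spec bs3 LN3 hD3 Q3 uq erefl erefl fresh.
rewrite u3 in d4 c4.
have lev4 v : v \in q ++ q2 -> d v <= (d u).+1.
  rewrite mem_cat => /orP[/(lev hq) //|/(allP d4)/eqP -> //].
have sq4 : srt (q ++ q2).
  move=> i j hi hj; case: (ltnP i (size q)) => iq; last first.
    rewrite [nth 0 (q ++ q2) i]nth_cat [i < size q]ltnNge iq /= => dlt.
    have /eqP e : d (nth 0 q2 (i - size q)) == (d u).+1.
      by apply: (allP d4); rewrite mem_nth // -(ltn_add2l (size q)) subnKC // -size_cat.
    by have := lev4 _ (mem_nth 0 hj); rewrite leqNgt -e dlt.
  case: (ltnP j (size q)) => jq; last by move=> _; apply: leq_trans iq jq.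
  by rewrite !nth_cat iq jq; apply: sq.
exists (q ++ q2); split=> //.
- by rewrite mem_cat rq.
- move=> j; rewrite ltS_cases => /predU1P[->|hj] jq v.
    by rewrite nth_cat hq; apply: c4.
  rewrite nth_cat; case: ltnP => hjq; last by move: (leq_ltn_trans hjq hj); lia.
  by move=> /(clos j hj hjq); rewrite mem_cat => ->.
move=> h v /lev4 dv; apply: leq_trans dv _; rewrite ltnS leqNgt; apply/negP => dlt.
have := sq4 m.+1 m h; rewrite size_cat (leq_trans hq (leq_addr _ _)) [nth 0 (q ++ q2) m]nth_cat hq.
by move=> /(_ isT dlt); rewrite ltnNge leqnSn.
Qed.

End Bfs.
End Labeller.

(** * Correctness of the labeller *)

Section Cube.

Variables n w : nat.
Hypotheses (n_gt0 : 0 < n) (n_lt : n < 2 ^ w).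
Implicit Types s : state.
Notation base := (base n w).
Notation lists := (lists n).

Variables (K : nat) (l : nat -> 'I_K -> bool) (A : nat -> nat -> bool).
Notation dq := (dq l).
Notation flip := (flip l).
Hypothesis edge_dq : forall u v, u < n -> v < n -> A u v -> dq [::] u v = 1.
Hypothesis geodesic : forall u v, u < n -> v < n -> u <> v ->
  exists x, [/\ x < n, A u x & dq [::] x v < dq [::] u v].

Definition reps F rep :=
  [/\ forall v, v < n -> rep v < n, forall v, v < n -> dq F v (rep v) = 0 &
      forall u v, u < n -> v < n -> dq F u v = 0 -> rep u = rep v].

Definition nbrs F rep (N : nat -> seq nat) :=
  forall a, a < n -> uniq (N a) /\
    forall b, b \in N a <-> [/\ alive n rep a, alive n rep b & dq F a b = 1].

Lemma dq_lt F u v : u < n -> v < n -> dq F u v < n.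
Proof.
move=> hu hv; rewrite /dq cardE; apply: nonconstant_lt n_gt0 edge_dq geodesic _ (enum_uniq _) _.
move=> i; rewrite mem_enum inE => /andP[_ h].
case e: (l u i == l 0 i); last by exists u; rewrite ?e.
by exists v => //; rewrite -(eqP e) eq_sym.
Qed.

(** * Correctness of one contraction stage *)

Section Stage.

Variables (F : seq 'I_K) (N : nat -> seq nat) (rep : nat -> nat) (r D : nat).
Variable g : nat -> 'I_K.
Notation k := (size F).
Notation live := (alive n rep).
Hypothesis repP : reps F rep.
Hypothesis NP : nbrs F rep N.
Hypothesis live_r : live r.
Hypothesis N_r : size (N r) = D.
Hypothesis N_D : forall a, a < n -> size (N a) <= D.
Hypothesis gP : forall i, i < D -> flip F (g i) r (nth 0 (N r) i).
Hypothesis kD : k + D <= n.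

Let rep_lt : forall v, v < n -> rep v < n. Proof. by case: repP. Qed.
Let rep_dq : forall v, v < n -> dq F v (rep v) = 0. Proof. by case: repP. Qed.
Let dq_rep : forall u v, u < n -> v < n -> dq F u v = 0 -> rep u = rep v.
Proof. by case: repP. Qed.

Lemma live_ltn v : live v -> v < n.
Proof. by case/andP. Qed.

Lemma nbrsP u v : u < n -> v \in N u -> [/\ live u, live v & dq F u v = 1].
Proof. by move=> hu /((NP hu).2 v). Qed.

Lemma nbrs_in u v : live u -> live v -> dq F u v = 1 -> v \in N u.
Proof. by move=> lu lv e; apply/(NP (live_ltn lu)).2. Qed.

Definition row v i := l v (g i) != l r (g i).
Definition sz v := \sum_(i < D) row v i.

(** [e x i] is the entry for [x] at the time when [u] is processed: final bits for the closer
    neighbours, the seed for [u] itself. No closer neighbour means that [u] is [r]; one is the case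
    of [one_down], and then the default value brings in the seed; two are the case of
    [two_downs]. *)
Lemma row_step u : live u ->
  let p := rev [seq v <- N u | dq F r v < dq F r u] in
  let e p i := if p == u then u == nth 0 (N r) i else row p i in
  forall i, i < D -> e (nth u p 0) i || e (nth u p 1) i = row u i.
Proof.
move=> lu p e i hi; have hu := live_ltn lu.
have lc : live (nth 0 (N r) i) /\ dq F r (nth 0 (N r) i) = 1.
  by have [] := nbrsP (live_ltn live_r) (mem_nth 0 (etrans (congr1 _ N_r) hi)).
have inp v : v \in p -> [/\ live v, dq F u v = 1, dq F r v < dq F r u & v <> u].
  rewrite mem_rev mem_filter => /andP[dv vN]; have [_ lv e1] := nbrsP hu vN.
  by split=> // e2; rewrite e2 ltnn in dv.
have pin v : live v -> dq F u v = 1 -> dq F r v < dq F r u -> v \in p.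
  by move=> lv e1 e2; rewrite mem_rev mem_filter e2 nbrs_in.
have up : uniq p by rewrite rev_uniq filter_uniq //; case: (NP hu).
have Fg : g i \notin F by case: (gP hi).
rewrite /e; case: p inp pin up => [|a [|b p]] inp pin up.
- rewrite /= eqxx orbb; have -> : u = r.
    apply/eqP/negPn/negP => /eqP ur.
    have [b [lb e1 e2]] :=
      has_down edge_dq geodesic rep_lt rep_dq dq_rep live_r lu (nesym ur).
    by have := pin b lb e1 e2.
  rewrite /row eqxx; apply/negbTE/eqP => e1; case: lc => _; rewrite -e1 dqxx //.
- have [la e1 e2 e3] := inp a (mem_head _ _).
  rewrite /= eqxx (introF eqP e3) /row.
  rewrite (one_down edge_dq geodesic rep_lt rep_dq dq_rep lu lc.1 (live_ltn lc.1) (gP hi) e1 e2) //.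
  by move=> b lb f1 f2; have := pin b lb f1 f2; rewrite inE => /eqP.
have [la e1 e2 e3] := inp a (mem_head _ _).
have [|lb f1 f2 f3] := inp b; first by rewrite !inE eqxx orbT.
rewrite /= (introF eqP e3) (introF eqP f3) /row.
rewrite -(two_downs dq_rep la lb _ e1 f1 e2 f2 Fg) // => ab.
by move: up; rewrite ab /= inE eqxx.
Qed.

Lemma rows_spec s q :
  base s -> R s rk = k -> R s rD = D -> lists tadj tdeg N s ->
  bq n live (dq F r) q s -> (forall v, live v -> v \in q) ->
  (forall i j, i < size q -> j < size q ->
     dq F r (nth 0 q i) < dq F r (nth 0 q j) -> i < j) ->
  (forall v i, v < n -> i < D -> T s tL v (k + i) = (v == nth 0 (N r) i)) ->
  let s' := exec w rows s in
  [/\ forall v i, live v -> i < D -> T s' tL v (k + i) = row v i,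
      forall v, live v -> T s' tsz v 0 = sz v &
      forall a c, ~~ (k <= c < k + D) -> T s' tL a c = T s tL a c].
Proof.
move=> bs hk hD LN Q qall srt L0 /=; have [hn _ _ _] := bs.
have [q1 q2 q3 q4 q5] := Q.
pose good s1 v := (forall i, i < D -> T s1 tL v (k + i) = row v i) /\ T s1 tsz v 0 = sz v.
pose inv m s1 := [/\ forall j, j < m -> j < size q -> good s1 (nth 0 q j),
   forall v, v < n -> v \notin take m q -> forall i, i < D ->
      T s1 tL v (k + i) = (v == nth 0 (N r) i) &
   forall a c, ~~ (k <= c < k + D) -> T s1 tL a c = T s tL a c].
suff [E1 E2 E3] : inv n (exec w rows s).
  have E v : live v -> good (exec w rows s) v.
    move=> lv; have vq := qall v lv.
    rewrite -(nth_index 0 vq); apply: E1; last by rewrite index_mem.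
    rewrite -index_mem in vq; apply: leq_trans vq _; apply: (uniq_size_le q2).
    by apply/allP => x /(allP q3)/live_ltn.
  by split=> // [v i /E[] G _|v /E[]] //; apply: G.
apply: (@for_base n w n inv) => //.
  by split=> // v hv _ i hi; apply: L0.
move=> m s1 hm em G bs1 [E1 E2 E3]; have [FR FT] := G; have [b0 b1 b2 b3] := bs1.
rewrite exec_if /test /= em (FR rtail isT) q1; case: ltnP => hq; last first.
  rewrite ?exec_skip; split=> //.
    by move=> j hj jq; apply: E1 => //; apply: leq_trans jq _.
  by move=> v hv; rewrite take_oversize ?(leqW hq) // => vq; apply: E2; rewrite ?take_oversize.
set u := nth 0 q m; have uq : u \in q by rewrite mem_nth.
have lu : live u by apply: (allP q3).
have hu := live_ltn lu.
rewrite 5!exec_seq !exec_lk !exec_mov /= em b2 (FT tqueue isT) q4 // -/u.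
rewrite (FT tdist isT) q5 // uq (FT tdeg isT) (LN u hu).1.
set s2 := setr _ rp2 _; have bs2 : base s2 by [].
have u2 : R s2 ru = u by [].
have LN2 : lists tadj tdeg N s2.
  by move=> a ha; rewrite /= (FT tadj isT) (FT tdeg isT); apply: LN.
have D2 : R s2 rD = D by rewrite /= (FR rD isT).
have hd2 v : v \in N (R s2 ru) -> T s2 tdist v 0 = (dq F r v).+1.
  move=> vN; have [_ lv _] := nbrsP hu vN.
  by rewrite /= (FT tdist isT) q5 ?live_ltn // qall.
have hD2 : size (N (R s2 ru)) <= R s2 rD by rewrite D2 u2 N_D.
have := @downs_spec n w N (fun v => (dq F r v).+1) s2 bs2 hu LN2 hD2 erefl hd2 erefl erefl.
rewrite /=; have -> : [seq v <- N u | (dq F r v).+1 < (dq F r u).+1] =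
  [seq v <- N u | dq F r v < dq F r u] by apply: eq_filter.
set p := rev _; case=> P1 P2.
rewrite 3!exec_seq exec_mov.
have G3 := exec_frame w downs s2.
have u3 : R (exec w downs s2) ru = u by rewrite G3.1.
have bs3 := base_exec (c := downs) isT bs2.
have k3 : R (exec w downs s2) rk = k by rewrite G3.1 //= (FR rk isT).
have D3 : R (exec w downs s2) rD = D by rewrite G3.1.
have L3 : T (exec w downs s2) tL = T s1 tL by rewrite G3.2.
have S3 : T (exec w downs s2) tsz = T s1 tsz by rewrite G3.2.
move: (exec w downs s2) P1 P2 u3 bs3 k3 D3 L3 S3 {G3} => s3 P1 P2 u3 bs3 k3 D3 L3 S3.
set s4 := setr s3 rx _.
have bs4 : base s4 by case: bs3.
have unew : u \notin take m q.
  apply/negP => /(nthP 0)[j]; rewrite size_takel ?(ltnW hq) // => hj.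
  rewrite nth_take // => /eqP; rewrite nth_uniq // ?(ltn_trans hj) // => /eqP e.
  by rewrite e ltnn in hj.
pose e x i := if x == u then u == nth 0 (N r) i else row x i.
(* A closer neighbour precedes [u] in the queue by [srt], so its row is finished; the row of [u]
   still holds the seed. *)
have LE x : x = u \/ x \in p -> forall i, i < D -> T s1 tL x (k + i) = e x i.
  move=> hx i hi; rewrite /e; case: (x =P u) => [->|xu]; first by rewrite E2.
  case: hx => // hx; have : x \in N u /\ dq F r x < dq F r u.
    by move: hx; rewrite mem_rev mem_filter => /andP[].
  case=> xN dx; have [_ lx _] := nbrsP hu xN; have xq := qall x lx.
  rewrite -(nth_index 0 xq) (E1 (index x q) _ _).1 ?index_mem //.
  by apply: srt; rewrite ?index_mem ?nth_index.
have pe i : nth u p i = u \/ nth u p i \in p.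
  by case: (ltnP i (size p)) => h; [right; rewrite mem_nth | left; rewrite nth_default].
have h1 i : i < R s4 rD -> T s4 tL (R s4 rp1) (k + i) = e (nth u p 0) i.
  by rewrite /= D3 P1 L3 => hi; apply: LE.
have h2 i : i < R s4 rD -> T s4 tL (R s4 rp2) (k + i) = e (nth u p 1) i.
  by rewrite /= D3 P2 L3 => hi; apply: LE.
have kD4 : k + R s4 rD <= n by rewrite /= D3.
have z4 : R s4 rx = 0 by case: bs3.
have [K1 K2 K3] := fill_row_spec n_gt0 n_lt bs4 k3 kD4 z4 h1 h2.
rewrite [R s4 rD]/= D3 [R s4 ru]/= u3 in K1 K2 K3.
have rs := row_step lu; rewrite -/p -/e in rs.
have {}K1 i : i < D -> T (exec w fill_row s4) tL u (k + i) = row u i.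
  by move=> hi; rewrite K1 // -rs.
have {}K2 : R (exec w fill_row s4) rx = sz u.
  by rewrite K2; apply: eq_bigr => i _; rewrite -rs.
have G5 := exec_frame w fill_row s4.
have u5 : R (exec w fill_row s4) ru = u by rewrite G5.1.
have z5 : R (exec w fill_row s4) rzero = 0 by rewrite G5.1 //; case: bs3.
have S5 : T (exec w fill_row s4) tsz = T s1 tsz by rewrite G5.2.
move: (exec w fill_row s4) K1 K2 K3 u5 z5 S5 {G5} => s5 K1 K2 K3 u5 z5 S5.
rewrite ?exec_sto /inv /good /= u5 z5 K2 S5; split.
- move=> j; rewrite ltS_cases => /predU1P[->|hj] jq; first by rewrite -/u eqxx.
  have ju : nth 0 q j <> u.
    by move/eqP; rewrite nth_uniq // => /eqP e'; rewrite e' ltnn in hj.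
  have [g1 g2] := E1 j hj jq; rewrite (introF eqP ju) /=; split=> // i hi.
  by rewrite K3 /= ?L3 ?g1 //; left.
- move=> v hv; rewrite (take_nth 0) // mem_rcons inE negb_or => /andP[/eqP vu vq] i hi.
  by rewrite K3 /= ?L3 ?E2 //; left.
by move=> a c hc; rewrite K3 /= ?L3 ?E3 //; right.
Qed.

Notation G := [seq g i | i <- iota 0 D].
Notation F' := (F ++ G).

(** Two edges at [r] that flip the same coordinate would end in the same live vertex, but the list
    of [r] has no repetitions. *)
Lemma g_inj i j : i < D -> j < D -> g i = g j -> i = j.
Proof.
move=> hi hj e; have hr := live_ltn live_r.
have [_ l1 _] := nbrsP hr (mem_nth 0 (etrans (congr1 _ N_r) hi)).
have [_ l2 _] := nbrsP hr (mem_nth 0 (etrans (congr1 _ N_r) hj)).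
have /eqP : nth 0 (N r) i = nth 0 (N r) j.
  by apply: (live_inj dq_rep l1 l2); apply: flip_inj (gP hi) _; rewrite e; apply: gP.
by rewrite nth_uniq ?N_r // => [/eqP|]; last by case: (NP hr).
Qed.

Lemma uniq_new : uniq F -> uniq F'.
Proof.
move=> uF; rewrite cat_uniq uF /=; apply/andP; split.
  by apply/hasPn => x /mapP[i]; rewrite mem_iota /= add0n => hi ->; case: (gP hi).
rewrite map_inj_in_uniq ?iota_uniq // => i j; rewrite !mem_iota !add0n /=.
exact: g_inj.
Qed.

Lemma G_nonconstant i : i < D -> exists2 v, v < n & l v (g i) != l 0 (g i).
Proof.
move=> hi; have hr := live_ltn live_r; have := gP hi; set c := nth 0 (N r) i => fl.
have [_ lc _] := nbrsP hr (mem_nth 0 (etrans (congr1 _ N_r) hi)).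
case e: (l r (g i) == l 0 (g i)); last by exists r; rewrite ?e.
exists c; first exact: live_ltn lc.
by rewrite (flipE fl fl.1) eqxx (eqP e); case: (l 0 _).
Qed.

(** The edge flips [c] only. If [c] is one of the [D] new coordinates, exactly one summand of [sz]
    changes; otherwise none does. *)
Lemma sz_eq u v c : flip F c u v -> (sz u == sz v) = (c \notin G).
Proof.
move=> fl.
have rowE i : i < D -> row v i = row u i (+) (g i == c).
  move=> hi; rewrite /row (flipE fl); last by case: (gP hi).
  by case: (l u _) (_ == c) (l r _) => [] [] [].
case cG: (c \in G) => /=.
  have /mapP[i] := cG; rewrite mem_iota add0n /= => hi ec; apply/negbTE/eqP.
  have D1 x : sz x = row x i + \sum_(j < D | j != Ordinal hi) row x j.
    by rewrite /sz (bigD1 (Ordinal hi)).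
  rewrite !D1 rowE // ec eqxx; have -> : \sum_(j < D | j != Ordinal hi) row v j =
     \sum_(j < D | j != Ordinal hi) row u j.
    apply: eq_bigr => j ji; rewrite rowE // ec; case: eqP => [/g_inj e|_]; last by rewrite addbF.
    by case/eqP: ji; apply: val_inj; apply: e.
  by case: (row u i) => /= /eqP; rewrite ?add0n ?add1n ?(gtn_eqF (ltnSn _)) ?(ltn_eqF (ltnSn _)).
apply/eqP; apply: eq_bigr => i _; rewrite rowE //; case: eqP => [e|]; last by rewrite addbF.
by case/negP: (negbT cG); apply/mapP; exists (i : nat); rewrite ?mem_iota //= add0n.
Qed.

Lemma dq_new0 u v : dq F u v = 0 -> dq F' u v = 0.
Proof.
by move/dq_eq0 => E; apply/dq_eq0 => i; rewrite mem_cat negb_or => /andP[/E].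
Qed.

Lemma sz_dq u v : u < n -> v \in N u -> sz u <> sz v -> dq F' u v = 0.
Proof.
move=> hu vN /eqP; have [_ _ /dq_eq1[c fl]] := nbrsP hu vN.
rewrite (sz_eq fl) negbK => cG; apply/dq_eq0 => i; rewrite mem_cat negb_or => /andP[Fi Gi].
by rewrite (flipE fl Fi); case: eqP => [e|]; [rewrite e cG in Gi | rewrite addbF].
Qed.

(** What holds halfway through the merging: vertices are identified only if they agree outside [F'],
    and the old classes stay together. That all necessary merges happen is shown only at the end. *)
Definition uinv s :=
  [/\ forall v, v < n -> T s trep v 0 < n,
      forall v, v < n -> dq F' v (T s trep v 0) = 0 &
      forall x y, x < n -> y < n -> rep x = rep y -> T s trep x 0 = T s trep y 0].

Definition coarser s s' := forall x y, x < n -> y < n ->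
  T s trep x 0 = T s trep y 0 -> T s' trep x 0 = T s' trep y 0.

Lemma unite_edge_spec s : base s -> lists tadj tdeg N s ->
  (forall v, live v -> T s tsz v 0 = sz v) ->
  R s ru < n -> R s rj < size (N (R s ru)) -> R s ra = sz (R s ru) -> uinv s ->
  let s' := exec w unite_edge s in let u := R s ru in let v := nth 0 (N u) (R s rj) in
  [/\ uinv s', coarser s s' & sz u <> sz v -> T s' trep u 0 = T s' trep v 0].
Proof.
move=> bs LN hs hu hj ha U /=; have [hn h1 hz _] := bs.
set u := R s ru in hu hj ha *; set v := nth 0 _ _.
have vN : v \in N u by rewrite mem_nth.
have [lu lv d1] := nbrsP hu vN; have hv := live_ltn lv.
rewrite /unite_edge exec_seq exec_lk exec_seq exec_lk exec_if /test /= hz -/u.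
rewrite (LN u hu).2 // -/v hs // ha; case: eqP => [e|ne]; first by split.
rewrite exec_if /test /= hn hv 2!exec_seq !exec_lk exec_if /test /= -/u hz.
case: eqP => [e|ne2]; first by split.
set s1 := setr _ rp2 _; have bs1 : base s1 by [].
have E y : y < n -> T (exec w relabel s1) trep y 0 =
    if T s trep y 0 == T s trep u 0 then T s trep v 0 else T s trep y 0.
  by move=> hy; rewrite (relabel_spec bs1 hy).
have [U1 U2 U3] := U; split.
- split=> [x hx|x hx|x y hx hy e]; rewrite !E //; first by case: ifP => _; apply: U1.
    case: eqP => [e|_]; last exact: U2.
    have d2 := sz_dq hu vN ne.
    rewrite (eq_dq _ (U2 x hx)) e -(eq_dq _ (U2 u hu)) (eq_dq _ d2); exact: U2.
  by rewrite (U3 x y).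
- by move=> x y hx hy e; rewrite !E // e.
by move=> _; rewrite !E // eqxx; case: ifP.
Qed.

Lemma unite_row_spec s : base s -> R s rD = D -> lists tadj tdeg N s ->
  (forall v, live v -> T s tsz v 0 = sz v) ->
  R s ru < n -> R s rg = size (N (R s ru)) ->
  (live (R s ru) -> R s ra = sz (R s ru)) -> uinv s ->
  let s' := exec w unite_row s in let u := R s ru in
  [/\ uinv s', coarser s s' &
      forall v, v \in N u -> sz u <> sz v -> T s' trep u 0 = T s' trep v 0].
Proof.
move=> bs hD LN hs hu hg ha U /=; set u := R s ru in hu hg ha *.
pose inv m s1 := [/\ uinv s1, coarser s s1 &
  forall j, j < m -> j < size (N u) -> sz u <> sz (nth 0 (N u) j) ->
    T s1 trep u 0 = T s1 trep (nth 0 (N u) j) 0].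
suff [I1 I2 I3] : inv D (exec w unite_row s).
  split=> // v vN; rewrite -(nth_index 0 vN); apply: I3; last by rewrite index_mem.
  by apply: leq_trans (N_D hu); rewrite index_mem.
apply: (@for_base n w D inv) => //; first by split.
move=> m s1 hm em Fr bs1 [I1 I2 I3]; have [FR FT] := Fr.
rewrite exec_if /test /= em (FR rg isT) hg; case: ltnP => hmN; last first.
  by rewrite ?exec_skip; split=> // j hj jN; apply: I3 => //; apply: leq_trans jN _.
have u1 : R s1 ru = u by rewrite (FR ru isT).
have LN1 : lists tadj tdeg N s1 by move=> a; rewrite (FT tadj isT) (FT tdeg isT); apply: LN.
have hs1 v : live v -> T s1 tsz v 0 = sz v by rewrite (FT tsz isT); apply: hs.
have hu1 : R s1 ru < n by rewrite u1.
have hj1 : R s1 rj < size (N (R s1 ru)) by rewrite u1 em.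
have lu : live u by have [] := nbrsP hu (mem_nth 0 hmN).
have ha1 : R s1 ra = sz (R s1 ru) by rewrite u1 (FR ra isT) ha.
have [J1 J2 J3] := unite_edge_spec bs1 LN1 hs1 hu1 hj1 ha1 I1.
rewrite u1 em in J3.
split=> //; first by move=> x y hx hy e; apply: J2 => //; apply: I2.
move=> j; rewrite ltS_cases => /predU1P[->|hj] jN ne; first exact: J3.
apply: J2 => //; last exact: I3.
by have [_ lv _] := nbrsP hu (mem_nth 0 jN); apply: live_ltn.
Qed.

Lemma unite_spec s : base s -> R s rD = D -> lists tadj tdeg N s ->
  (forall v, live v -> T s tsz v 0 = sz v) -> (forall v, v < n -> T s trep v 0 = rep v) ->
  reps F' (fun v => T (exec w unite s) trep v 0).
Proof.
move=> bs hD LN hs hrep; have [hn _ _ _] := bs.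
pose inv m s1 := uinv s1 /\ forall u, u < m -> forall v, v \in N u -> sz u <> sz v ->
    T s1 trep u 0 = T s1 trep v 0.
suff [[U1 U2 U3] E] : inv n (exec w unite s).
  (* Vertices that agree outside [F'] are joined by a geodesic of the original graph all of whose
     edges flip coordinates in [F']. An edge flipping a coordinate of [F] stays in an old class; one
     flipping a coordinate of [G] gives an edge between old representatives with different [sz],
     whose ends were united. *)
  split=> // u v hu hv; have [m] := ubnP (dq [::] u v); elim: m u hu => // m IH u hu hm d0.
  case: (u =P v) => [->//|uv].
  have [x [i [hx ax fl ui lx]]] := geodesic_step edge_dq geodesic hu hv uv.
  have Fi : i \in F'.
    by apply/negPn/negP => Fi; have /dq_eq0/(_ i Fi) e := d0; rewrite e eqxx in ui.
  have ux := flip_in Fi fl.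
  transitivity (T (exec w unite s) trep x 0); last first.
    by apply: IH => //; [apply: leq_trans lx _ | rewrite -(eq_dq _ ux)].
  case iF: (i \in F).
    by apply: U3 => //; apply: dq_rep => //; apply: flip_in iF fl.
  have iG : i \in G by move: Fi; rewrite mem_cat iF.
  have rr z : z < n -> T (exec w unite s) trep z 0 = T (exec w unite s) trep (rep z) 0.
    move=> hz; apply: U3; rewrite ?rep_lt //; symmetry.
    by have /andP[_ /eqP] := live_rep rep_lt rep_dq dq_rep hz.
  have /= fl2 : flip F i (rep u) (rep x).
    have := flipW (negbT iF) fl; case=> _ fe; split; first by rewrite iF.
    move=> j jF; rewrite -fe //.
    by have /dq_eq0 <- := rep_dq hu => //; have /dq_eq0 <- := rep_dq hx.
  rewrite (rr u hu) (rr x hx); apply: E; rewrite ?rep_lt //.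
    apply: nbrs_in; try exact: (live_rep rep_lt rep_dq dq_rep).
    by apply/dq_eq1; exists i.
  by apply/eqP; rewrite (sz_eq fl2) iG.
apply: (@for_base n w n inv) => //.
  split=> //; split=> /= [v hv|v hv|x y hx hy]; rewrite !hrep //; first exact: rep_lt.
  exact: dq_new0 (rep_dq hv).
move=> m s1 hm em Fr bs1 [I1 I2]; have [FR FT] := Fr; have [b0 b1 b2 b3] := bs1.
rewrite exec_seq exec_lk exec_seq exec_lk /= em b2 (FT tdeg isT) (FT tsz isT) (LN m hm).1.
set s2 := setr _ ra _; have bs2 : base s2 by [].
have u2 : R s2 ru = m by [].
have LN2 : lists tadj tdeg N s2 by move=> a; rewrite /= (FT tadj isT) (FT tdeg isT); apply: LN.
have hs2 v : live v -> T s2 tsz v 0 = sz v by rewrite /= (FT tsz isT); apply: hs.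
have D2 : R s2 rD = D by rewrite /= (FR rD isT).
have hu2 : R s2 ru < n by rewrite u2.
have hg2 : R s2 rg = size (N (R s2 ru)) by rewrite u2.
have ha2 : live (R s2 ru) -> R s2 ra = sz (R s2 ru) by rewrite u2; apply: hs.
have U2 : uinv s2 by [].
have [J1 J2 J3] := unite_row_spec bs2 D2 LN2 hs2 hu2 hg2 ha2 U2.
rewrite u2 in J3.
split=> // u; rewrite ltS_cases => /predU1P[->|hu] v vN ne; first exact: J3.
have hun : u < n by apply: ltn_trans hm.
apply: J2 => //; last exact: I2.
by have [_ lv _] := nbrsP hun vN; apply: live_ltn.
Qed.

(** [E] is the set of old edges scanned so far and [M] holds the new lists. A stamp of the current
    stage marks exactly the pairs already recorded, which keeps the lists free of repetitions. *)
Definition building (rep' : nat -> nat) (E : nat -> nat -> Prop) M s :=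
  [/\ lists tnew tnewdeg M s,
      forall a, a < n -> uniq (M a) /\ all (fun b => b < n) (M a),
      forall a b, a < n -> (T s tstamp a b = R s rst1 <-> b \in M a),
      forall a b, T s tstamp a b <= R s rst1 &
      forall a b, a < n -> (b \in M a <-> a <> b /\
        exists u v, [/\ E u v, rep' u = a & rep' v = b])].

Lemma rebuild_row_spec rep' (E : nat -> nat -> Prop) M s :
  base s -> R s rD = D -> lists tadj tdeg N s -> R s ru < n ->
  R s rg = size (N (R s ru)) -> R s ra = rep' (R s ru) ->
  (forall v, v < n -> T s trep v 0 = rep' v) -> (forall v, v < n -> rep' v < n) ->
  building rep' E M s ->
  exists M', building rep' (fun u v => E u v \/ (u = R s ru /\ v \in N u)) M'
    (exec w rebuild_row s).
Proof.
move=> bs hD LN hu hg ha hrep rep'_lt B; set u := R s ru in hu hg ha *.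
pose inv m s1 := exists M', building rep'
  (fun x v => E x v \/ (x = u /\ v \in take m (N u))) M' s1.
suff [M' B'] : inv D (exec w rebuild_row s).
  exists M'; case: B' => B1 B2 B3 B4 B5; split=> // a b ha'; rewrite B5 // take_oversize ?N_D //.
  by split=> -[ab [x [v [h e1 e2]]]]; split=> //; exists x, v; split=> //;
    case: h => [|[-> vN]]; auto.
apply: (@for_base n w D inv) => //.
  exists M; case: B => B1 B2 B3 B4 B5; split=> // a b ha'; rewrite B5 // take0.
  by split=> -[ab [x [v [h e1 e2]]]]; split=> //; exists x, v; split=> //; intuition.
move=> m s1 hm em Fr [b0 b1 b2 b3] [M1 B1]; have [FR FT] := Fr.
have [c1 c2 c3 c4 c5] := B1.
rewrite exec_if /test /= em (FR rg isT) hg; case: ltnP => hmN; last first.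
  by rewrite ?exec_skip; exists M1; move: B1; rewrite !take_oversize ?(leq_trans hmN).
rewrite exec_seq exec_lk exec_seq exec_lk /= em (FR ru isT) -/u (FT tadj isT) (LN u hu).2 //.
set v := nth 0 (N u) m; have vN : v \in N u by rewrite mem_nth.
have [lu lv _] := nbrsP hu vN; have hv := live_ltn lv.
rewrite b2 (FT trep isT) hrep //.
have ra1 : R s1 ra = rep' u by rewrite (FR ra isT).
set a := rep' u in ra1 *; set b := rep' v.
have ha' : a < n by apply: rep'_lt.
have hb : b < n by apply: rep'_lt.
have takeE x : x \in take m.+1 (N u) = (x == v) || (x \in take m (N u)).
  by rewrite (take_nth 0) // mem_rcons inE.
have same s2 : T s2 tnew = T s1 tnew -> T s2 tnewdeg = T s1 tnewdeg ->
   T s2 tstamp = T s1 tstamp -> R s2 rst1 = R s1 rst1 -> a = b \/ b \in M1 a -> inv m.+1 s2.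
  move=> t1 t2 t3 t4 hab; exists M1; split=> //.
  - by move=> x hx; rewrite t1 t2; apply: c1.
  - by move=> x y hx; rewrite t3 t4; apply: c3.
  - by move=> x y; rewrite t3 t4.
  move=> x y hx; rewrite c5 //; split=> -[xy [z [t [h e1 e2]]]]; split=> //.
    by exists z, t; split=> //; case: h => [|[-> tt]]; [left|right; rewrite takeE tt orbT].
  case: h => [Ez|[zu]]; first by exists z, t; split=> //; left.
  rewrite takeE => /predU1P[tv|tt]; last by exists z, t; split=> //; right.
  rewrite zu tv -/a -/b in e1 e2; rewrite -e1 -e2 in xy *.
  by case: hab => // /c5 -/(_ ha')[].
rewrite exec_if /test /= ra1; case: (a =P b) => [ab|ab]; first by apply: same => //; left.
rewrite exec_seq exec_lk exec_if /test /= ra1.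
case: eqP => [st|st]; first by apply: same => //; right; apply/(c3 a b ha').
have bM : b \notin M1 a by apply/negP => /(c3 a b ha').
have [uM aM] := c2 a ha'.
have sM : size (M1 a) < n by apply: uniq_size_lt uM aM hb bM.
have [cd cl] := c1 a ha'.
rewrite !execE /= ra1 b2 b1 cd (incE n_lt) //.
exists (fun x => if x == a then rcons (M1 a) b else M1 x); split=> /=.
- move=> x hx /=; have [d1 d2] := c1 x hx; case: eqP => [->|xa] /=; last by rewrite d1.
  rewrite size_rcons; split=> // j; rewrite ltS_cases nth_rcons => /predU1P[->|hj].
    by rewrite eqxx ltnn.
  by rewrite (ltn_eqF hj) hj /= cl.
- move=> x hx; case: eqP => _; last exact: c2.
  by rewrite rcons_uniq bM uM all_rcons hb aM.
- move=> x y hx; case: (x =P a) => [->|xa] /=; last exact: c3.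
  rewrite mem_rcons inE; case: (y =P b) => [->|yb] //=; exact: c3.
- by move=> x y; case: ifP.
move=> x y hx; have -> : (y \in (if x == a then rcons (M1 a) b else M1 x)) <->
    (x = a /\ y = b) \/ y \in M1 x.
  case: (x =P a) => [->|xa]; last by intuition.
  by rewrite mem_rcons inE; split=> [/predU1P[]|[[_ ->]|->]]; rewrite ?eqxx ?orbT; auto.
rewrite c5 //; split=> [[[-> ->]|[xy [z [t [h e1 e2]]]]]|[xy [z [t [h e1 e2]]]]].
- by split=> //; exists u, v; split=> //; right; rewrite takeE eqxx.
- split=> //; exists z, t; split=> //.
  by case: h => [|[-> tt]]; [left|right; rewrite takeE tt orbT].
case: h => [Ez|[zu]]; first by right; split=> //; exists z, t; split=> //; left.
rewrite takeE => /predU1P[tv|tt]; first by left; rewrite -e1 -e2 zu tv.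
by right; split=> //; exists z, t; split=> //; right.
Qed.

Lemma rebuild_spec rep' s :
  base s -> R s rD = D -> lists tadj tdeg N s ->
  (forall v, v < n -> T s trep v 0 = rep' v) -> reps F' rep' ->
  (forall v, v < n -> T s tnewdeg v 0 = 0) ->
  (forall a b, T s tstamp a b < R s rst1) ->
  (exists M, lists tnew tnewdeg M (exec w rebuild s) /\ nbrs F' rep' M) /\
  (forall a b, T (exec w rebuild s) tstamp a b <= R s rst1).
Proof.
move=> bs hD LN hrep rP h0 hst; have [hn _ _ _] := bs.
have [rep'_lt rep'_dq dq_rep'] := rP.
pose inv m s1 := exists M, building rep' (fun u v => u < m /\ v \in N u) M s1.
have F1 := exec_frame w rebuild s.
suff [M [B1 B2 B3 B4 B5]] : inv n (exec w rebuild s).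
  split; last by move=> a b; rewrite -(F1.1 rst1 isT).
  exists M; split=> // a ha; split; first by case: (B2 a ha).
  move=> b; rewrite B5 //; split=> [[ab [u [v [[hu vN] eu ev]]]]|[la lb d1]].
    have [lu lv d] := nbrsP hu vN; have hv := live_ltn lv.
    have l1 : alive n rep' a by rewrite -eu; exact: (live_rep rep'_lt rep'_dq dq_rep' hu).
    have l2 : alive n rep' b by rewrite -ev; exact: (live_rep rep'_lt rep'_dq dq_rep' hv).
    split=> //; have /dq_eq1[c fl] := d.
    (* An edge with a coordinate in [G] has both ends in one new class, but here the new
       representatives [a] and [b] differ. *)
    have cF : c \notin F'.
      apply/negP; rewrite mem_cat (negbTE fl.1) /= => cG.
      have : dq F' u v = 0 by apply: (sz_dq hu vN); apply/eqP; rewrite (sz_eq fl) cG.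
      by move/(dq_rep' u v hu hv); rewrite eu ev.
    apply/dq_eq1; exists c; split=> // j jF.
    have jF0 : j \notin F by move: jF; rewrite mem_cat negb_or => /andP[].
    rewrite -eu -ev; have /dq_eq0 <- := rep'_dq u hu => //.
    by have /dq_eq0 <- := rep'_dq v hv => //; rewrite fl.2.
  have /andP[_ /eqP ea] := la; have /andP[hb /eqP eb] := lb.
  split=> [ab|]; first by rewrite ab dqxx in d1.
  have d0 : 0 < dq F' a b by rewrite d1.
  (* Conversely, new neighbours [a] and [b] come from an original edge from the class of [a]. Its
     coordinate must be the only one separating [a] from [b], so it ends in the class of [b]; the
     old representatives of its ends form an edge that was scanned. *)
  have [x [y [i [[hx hy] axy dx li [Fi fl]]]]] := contracted_edge edge_dq geodesic ha hb d0.
  have iF0 : i \notin F by move: Fi; rewrite mem_cat negb_or => /andP[].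
  have fl2 : flip F i (rep x) (rep y).
    split=> // j jF; have /dq_eq0 <- := rep_dq hx => //.
    by have /dq_eq0 <- := rep_dq hy => //; rewrite (flipW iF0 fl).2.
  exists (rep x), (rep y); split.
  - split; first exact: rep_lt.
    apply: nbrs_in; try exact: (live_rep rep_lt rep_dq dq_rep).
    by apply/dq_eq1; exists i.
  - rewrite -[RHS]ea; apply: dq_rep' => //; first exact: rep_lt.
    by rewrite dqC (eq_dq _ dx); apply/dq_new0/rep_dq.
  rewrite -[RHS]eb; apply: dq_rep' => //; first exact: rep_lt.
  have /dq_eq1[c flc] := d1.
  have ci : i = c by have := flc.2 i Fi; rewrite li => /esym/eqP.
  have yb : dq F' y b = 0.
    apply/dq_eq0 => j jF; rewrite (flipE flc jF) (flipE (flipW Fi fl) jF) ci.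
    by have /dq_eq0 -> := dx.
  by rewrite dqC -(eq_dq _ yb); apply/dq_new0/rep_dq.
apply: (@for_base n w n inv) => //.
  exists (fun=> [::]); split=> //= [a ha|a b ha|a b|a b ha]; first by rewrite h0.
  - by split=> // e; have := hst a b; rewrite e ltnn.
  - exact: ltnW.
  by split=> // -[_ [u [v [[]]]]].
move=> m s1 hm em Fr bs1 [M B]; have [FR FT] := Fr; have [b0 b1 b2 b3] := bs1.
rewrite exec_seq exec_lk exec_seq exec_lk /= em b2 (FT tdeg isT) (LN m hm).1 (FT trep isT) hrep //.
set s2 := setr _ ra _; have bs2 : base s2 by [].
have D2 : R s2 rD = D by rewrite /= (FR rD isT).
have LN2 : lists tadj tdeg N s2 by move=> a; rewrite /= (FT tadj isT) (FT tdeg isT); apply: LN.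
have hu2 : R s2 ru < n by rewrite /= em.
have hg2 : R s2 rg = size (N (R s2 ru)) by rewrite /= em.
have ha2 : R s2 ra = rep' (R s2 ru) by rewrite /= em.
have r2 v : v < n -> T s2 trep v 0 = rep' v by rewrite /= (FT trep isT); apply: hrep.
have B2 : building rep' (fun u v => u < m /\ v \in N u) M s2 by [].
have [M' [B1' B2' B3' B4' B5']] := rebuild_row_spec bs2 D2 LN2 hu2 hg2 ha2 r2 rep'_lt B2.
exists M'; split=> // a b ha; rewrite B5' // [R s2 ru]/= em.
split=> -[ab [u [v [h e1 e2]]]]; split=> //; exists u, v; split=> //.
  by case: h => [[hu ?]|[-> ?]]; split=> //; rewrite ltnW.
by case: h; rewrite ltS_cases => /predU1P[->|hu] vN; [right|left].
Qed.

End Stage.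

(** Each stage writes bits relative to its own root, so a column agrees with [l] only up to the
    complement [be], which does not affect Hamming distances. [F] lists the coordinates in the order
    of the columns. *)
Definition labelled F s := exists be : 'I_K -> bool,
  forall v i, v < n -> i \in F -> T s tL v (index i F) = (l v i != be i).

(** Nonconstancy of the coordinates in [F] yields [size F < n] by [nonconstant_lt]; the bound on the
    stamps makes stage number [t.+1] a fresh stamp. *)
Definition inv F t s :=
  [/\ [/\ base s, R s rk = size F, R s rrem = n - size F & uniq F],
      (forall i, i \in F -> exists2 v, v < n & l v i != l 0 i),
      labelled F s /\ (forall v c, v < n -> size F <= c -> T s tL v c = 0),
      reps F (fun v => T s trep v 0) &
      (exists N, lists tnew tnewdeg N s /\ nbrs F (fun v => T s trep v 0) N) /\
      forall a b, T s tstamp a b <= t].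

Lemma inv_size F t s : inv F t s -> size F < n.
Proof.
case=> [[_ _ _ uF] nc _ _ _]; exact: (nonconstant_lt n_gt0 edge_dq geodesic uF nc).
Qed.

Lemma star_coords F rep N r D : nbrs F rep N -> r < n -> size (N r) = D -> 0 < D ->
  exists g : nat -> 'I_K, forall i, i < D -> flip F (g i) r (nth 0 (N r) i).
Proof.
move=> NP hr N_r D0.
have ex i : i < D -> exists c, flip F c r (nth 0 (N r) i).
  move=> hi; apply/dq_eq1; have : nth 0 (N r) i \in N r by rewrite mem_nth // N_r.
  by move/((NP r hr).2 _) => [].
have [c0 _] := ex 0 D0.
suff pick m : m <= D -> exists g : nat -> 'I_K, forall i, i < m -> flip F (g i) r (nth 0 (N r) i).
  exact: pick (leqnn D).
elim: m => [|m IH] hm; first by exists (fun=> c0).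
have [g gP] := IH (ltnW hm); have [c fc] := ex m hm.
exists (fun i => if i == m then c else g i) => i; rewrite ltS_cases.
by case: eqP => [->|_] //= /gP.
Qed.

Lemma contract_spec F t s :
  inv F t s -> R s rst1 = t.+1 -> R s rr < n -> 0 < R s rD -> 
  (forall v, v < n -> T s tnewdeg v 0 <= R s rD) -> T s tnewdeg (R s rr) 0 = R s rD ->
  ~~ (R s rrem < R s rD) ->
  exists F', size F < size F' /\ inv F' t.+1 (exec w contract s).
Proof.
move=> I hst hr D0 hmax hdeg hrem; have szF := inv_size I.
case: I => -[bs hk hre uF] nc [[be lab] fresh] rP [[N [LN NP]] st].
set D := R s rD in D0 hmax hdeg hrem; set r := R s rr in hr hdeg.
have [rep_lt rep_dq dq_rep] := rP; set rep := fun v => T s trep v 0 in rP NP rep_lt rep_dq dq_rep *.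
have N_D a : a < n -> size (N a) <= D by move=> ha; rewrite -(LN a ha).1; apply: hmax.
have N_r : size (N r) = D by rewrite -(LN r hr).1.
have live_r : alive n rep r.
  have : nth 0 (N r) 0 \in N r by rewrite mem_nth // N_r.
  by move/((NP r hr).2 _) => [].
have kD : size F + D <= n by move: hrem; rewrite hre; lia.
have [g gP] := star_coords NP hr N_r D0.
have nlive u v : u < n -> v \in N u -> [/\ alive n rep u, alive n rep v & dq F u v = 1].
  by move=> hu /((NP u hu).2 v).
rewrite /contract exec_seq.
have [L1 Z1] := copy_lists_spec n_gt0 n_lt bs LN N_D.
have bs1 := base_exec (c := copy_lists) isT bs.
have G1 := exec_frame w copy_lists s.
have D1 : R (exec w copy_lists s) rD = D by rewrite G1.1.
have k1 : R (exec w copy_lists s) rk = size F by rewrite G1.1.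
have r1 : R (exec w copy_lists s) rr = r by rewrite G1.1.
have t1 : R (exec w copy_lists s) rst1 = t.+1 by rewrite G1.1.
have m1 : R (exec w copy_lists s) rrem = n - size F by rewrite G1.1.
have tl1 : T (exec w copy_lists s) tL = T s tL by rewrite G1.2.
have tr1 : T (exec w copy_lists s) trep = T s trep by rewrite G1.2.
have ts1 : T (exec w copy_lists s) tstamp = T s tstamp by rewrite G1.2.
move: (exec w copy_lists s) L1 Z1 bs1 D1 k1 r1 t1 m1 tl1 tr1 ts1 {G1} =>
  s1 L1 Z1 bs1 D1 k1 r1 t1 m1 tl1 tr1 ts1.
rewrite exec_seq.
have kD1 : size F + R s1 rD <= n by rewrite D1.
have lab2 := star_spec n_gt0 n_lt bs1 k1 kD1; rewrite D1 r1 tl1 in lab2.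
have bs2 := base_exec (c := star) isT bs1.
have G2 := exec_frame w star s1.
have D2 : R (exec w star s1) rD = D by rewrite G2.1.
have k2 : R (exec w star s1) rk = size F by rewrite G2.1.
have r2 : R (exec w star s1) rr = r by rewrite G2.1.
have t2 : R (exec w star s1) rst1 = t.+1 by rewrite G2.1.
have m2 : R (exec w star s1) rrem = n - size F by rewrite G2.1.
have L2 : lists tadj tdeg N (exec w star s1) by move=> a; rewrite !G2.2 //; apply: L1.
have Z2 v : v < n -> T (exec w star s1) tnewdeg v 0 = 0 /\ T (exec w star s1) tdist v 0 = 0.
  by rewrite !G2.2 //; apply: Z1.
have tr2 : T (exec w star s1) trep = T s trep by rewrite G2.2.
have ts2 : T (exec w star s1) tstamp = T s tstamp by rewrite G2.2.
move: (exec w star s1) lab2 bs2 D2 k2 r2 t2 m2 L2 Z2 tr2 ts2 {G2} =>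
  s2 lab2 bs2 D2 k2 r2 t2 m2 L2 Z2 tr2 ts2.
rewrite exec_seq.
have [||||||||q [Q Qall srt]] := @bfs_spec n w n_gt0 n_lt N (alive n rep) (dq F r) r
    _ live_r (dqxx l F r) _ _ _ _ _ s2 bs2 r2 L2.
- by move=> v /andP[].
- by move=> u v /andP[hu _] /(nlive u v hu)[].
- move=> u v /andP[hu _] /(nlive u v hu)[lu lv e]; apply/(NP v _).2; first by case/andP: lv.
  by split=> //; rewrite dqC.
- by move=> u v /andP[hu _] /(nlive u v hu)[_ _ /(adj_level r)].
- move=> u lu ur; have [b [lb e1 e2]] :=
    has_down edge_dq geodesic rep_lt rep_dq dq_rep live_r lu (nesym ur).
  by exists b => //; apply/(NP u _).2; [case/andP: lu|].
- by move=> v /andP[hv _]; apply: dq_lt.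
- by move=> a /andP[ha _]; rewrite D2 N_D.
- by move=> v /Z2[].
have bs3 := base_exec (c := bfs) isT bs2.
have G3 := exec_frame w bfs s2.
have D3 : R (exec w bfs s2) rD = D by rewrite G3.1.
have k3 : R (exec w bfs s2) rk = size F by rewrite G3.1.
have t3 : R (exec w bfs s2) rst1 = t.+1 by rewrite G3.1.
have m3 : R (exec w bfs s2) rrem = n - size F by rewrite G3.1.
have L3 : lists tadj tdeg N (exec w bfs s2) by move=> a; rewrite !G3.2 //; apply: L2.
have Z3 v : v < n -> T (exec w bfs s2) tnewdeg v 0 = 0 by rewrite G3.2 // => /Z2[].
have tr3 : T (exec w bfs s2) trep = T s trep by rewrite G3.2.
have ts3 : T (exec w bfs s2) tstamp = T s tstamp by rewrite G3.2.
have lab3 v c : T (exec w bfs s2) tL v c = 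
    if (size F <= c < size F + D) && (v == T s1 tadj r (c - size F)) then 1 else T s tL v c.
  by rewrite G3.2.
move: (exec w bfs s2) Q bs3 D3 k3 t3 m3 L3 Z3 tr3 ts3 lab3 {G3} =>
  s3 Q bs3 D3 k3 t3 m3 L3 Z3 tr3 ts3 lab3.
have lab3' v i : v < n -> i < D -> T s3 tL v (size F + i) = (v == nth 0 (N r) i).
  move=> hv hi; rewrite lab3 leq_addr ltn_add2l hi addKn /= (L1 r hr).2 ?N_r //.
  by rewrite fresh ?leq_addr //; case: eqP.
rewrite exec_seq.
have [K1 K2 K3] := rows_spec rP NP live_r N_r N_D gP kD bs3 k3 D3 L3 Q Qall srt lab3'.
have bs4 := base_exec (c := rows) isT bs3.
have G4 := exec_frame w rows s3.
have D4 : R (exec w rows s3) rD = D by rewrite G4.1.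
have k4 : R (exec w rows s3) rk = size F by rewrite G4.1.
have t4 : R (exec w rows s3) rst1 = t.+1 by rewrite G4.1.
have m4 : R (exec w rows s3) rrem = n - size F by rewrite G4.1.
have L4 : lists tadj tdeg N (exec w rows s3) by move=> a; rewrite !G4.2 //; apply: L3.
have Z4 v : v < n -> T (exec w rows s3) tnewdeg v 0 = 0 by rewrite G4.2 //; apply: Z3.
have tr4 : T (exec w rows s3) trep = T s trep by rewrite G4.2.
have ts4 : T (exec w rows s3) tstamp = T s tstamp by rewrite G4.2.
move: (exec w rows s3) K1 K2 K3 bs4 D4 k4 t4 m4 L4 Z4 tr4 ts4 {G4} =>
  s4 K1 K2 K3 bs4 D4 k4 t4 m4 L4 Z4 tr4 ts4.
rewrite exec_seq.
have kD4 : size F + R s4 rD <= n by rewrite D4.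
have rep4 v : v < n -> T s4 trep v 0 < n /\ T s4 trep (T s4 trep v 0) 0 = T s4 trep v 0.
  move=> hv; rewrite tr4; have /andP[h /eqP e] := live_rep rep_lt rep_dq dq_rep hv.
  by split.
have [K4 K5] := spread_spec n_gt0 n_lt bs4 k4 kD4 rep4; rewrite D4 tr4 in K4 K5.
have bs5 := base_exec (c := spread) isT bs4.
have G5 := exec_frame w spread s4.
have D5 : R (exec w spread s4) rD = D by rewrite G5.1.
have k5 : R (exec w spread s4) rk = size F by rewrite G5.1.
have t5 : R (exec w spread s4) rst1 = t.+1 by rewrite G5.1.
have m5 : R (exec w spread s4) rrem = n - size F by rewrite G5.1.
have L5 : lists tadj tdeg N (exec w spread s4) by move=> a; rewrite !G5.2 //; apply: L4.
have Z5 v : v < n -> T (exec w spread s4) tnewdeg v 0 = 0 by rewrite G5.2 //; apply: Z4.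
have tr5 v : v < n -> T (exec w spread s4) trep v 0 = rep v by rewrite G5.2 // tr4.
have ts5 : T (exec w spread s4) tstamp = T s tstamp by rewrite G5.2.
have sz5 v : alive n rep v -> T (exec w spread s4) tsz v 0 = sz r D g v.
  by rewrite G5.2 //; apply: K2.
move: (exec w spread s4) K4 K5 bs5 D5 k5 t5 m5 L5 Z5 tr5 ts5 sz5 {G5} =>
  s5 K4 K5 bs5 D5 k5 t5 m5 L5 Z5 tr5 ts5 sz5.
rewrite exec_seq.
have rP6 := unite_spec rP NP live_r N_r N_D gP bs5 D5 L5 sz5 tr5.
have bs6 := base_exec (c := unite) isT bs5.
have G6 := exec_frame w unite s5.
have D6 : R (exec w unite s5) rD = D by rewrite G6.1.
have k6 : R (exec w unite s5) rk = size F by rewrite G6.1.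
have t6 : R (exec w unite s5) rst1 = t.+1 by rewrite G6.1.
have m6 : R (exec w unite s5) rrem = n - size F by rewrite G6.1.
have L6 : lists tadj tdeg N (exec w unite s5) by move=> a; rewrite !G6.2 //; apply: L5.
have Z6 v : v < n -> T (exec w unite s5) tnewdeg v 0 = 0 by rewrite G6.2 //; apply: Z5.
have tl6 : T (exec w unite s5) tL = T s5 tL by rewrite G6.2.
have ts6 : T (exec w unite s5) tstamp = T s tstamp by rewrite G6.2.
move: (exec w unite s5) rP6 bs6 D6 k6 t6 m6 L6 Z6 tl6 ts6 {G6} =>
  s6 rP6 bs6 D6 k6 t6 m6 L6 Z6 tl6 ts6.
rewrite exec_seq.
have st6 a b : T s6 tstamp a b < R s6 rst1 by rewrite ts6 t6 ltnS.
have [[M [LM NM]] st7] := rebuild_spec rP NP live_r N_r N_D gP bs6 D6 L6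
  (fun v _ => erefl) rP6 Z6 st6.
have bs7 := base_exec (c := rebuild) isT bs6.
have G7 := exec_frame w rebuild s6.
have D7 : R (exec w rebuild s6) rD = D by rewrite G7.1.
have k7 : R (exec w rebuild s6) rk = size F by rewrite G7.1.
have m7 : R (exec w rebuild s6) rrem = n - size F by rewrite G7.1.
have tl7 : T (exec w rebuild s6) tL = T s5 tL by rewrite G7.2.
have tr7 : T (exec w rebuild s6) trep = T s6 trep by rewrite G7.2.
move: (exec w rebuild s6) LM st7 bs7 D7 k7 m7 tl7 tr7 {G7} =>
  s7 LM st7 bs7 D7 k7 m7 tl7 tr7.
have [||k8 m8] := finish_spec n_gt0 n_lt bs7.
- by rewrite D7 m7; lia.
- by rewrite k7 m7; lia.
have bs8 := base_exec (c := finish) isT bs7.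
have G8 := (exec_frame w finish s7).2.
rewrite k7 D7 in k8; rewrite m7 D7 in m8.
have tl8 : T (exec w finish s7) tL = T s5 tL by rewrite G8.
have tr8 : T (exec w finish s7) trep = T s6 trep by rewrite G8.
have L8 : lists tnew tnewdeg M (exec w finish s7) by move=> a; rewrite !G8 //; apply: LM.
have ts8 : T (exec w finish s7) tstamp = T s7 tstamp by rewrite G8.
move: (exec w finish s7) bs8 k8 m8 tl8 tr8 L8 ts8 {G8} => s8 bs8 k8 m8 tl8 tr8 L8 ts8.
pose G := [seq g i | i <- iota 0 D]; exists (F ++ G).
have sG : size G = D by rewrite size_map size_iota.
rewrite size_cat sG; split; first by lia.
split; first by rewrite size_cat sG k8 m8 subnDA; split=> //; apply: (uniq_new rP NP live_r N_r gP).
- move=> i; rewrite mem_cat => /orP[/nc //|/mapP[j]]; rewrite mem_iota add0n /= => hj ->.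
  exact: (G_nonconstant NP live_r N_r gP hj).
- split; last first.
    move=> v c hv; rewrite size_cat sG tl8 => hc.
    have h : (size F <= c < size F + D) = false by rewrite [c < _]ltnNge hc andbF.
    by rewrite K5 ?K3 ?lab3 ?h //= fresh // (leq_trans _ hc) ?leq_addr.
  (* The new columns are complemented by the bits of the root [r] of this stage. *)
  exists (fun i => if i \in F then be i else l r i) => v i hv iF'; rewrite tl8 index_cat.
  case iF: (i \in F).
    have idx : index i F < size F by rewrite index_mem.
    have h : (size F <= index i F < size F + D) = false by rewrite leqNgt idx.
    by rewrite K5 ?K3 ?lab3 ?h //= lab.
  move: iF'; rewrite mem_cat iF /= => /mapP[j]; rewrite mem_iota add0n /= => hj ei.
  have -> : index i G = j.
    have uG : uniq G.
      by have := uniq_new rP NP live_r N_r gP uF; rewrite cat_uniq => /and3P[].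
    have e : nth i G j = i by rewrite (nth_map 0) ?size_iota // nth_iota // -ei.
    by rewrite -{1}e index_uniq ?sG.
  rewrite K4 // K1 //; last exact: (live_rep rep_lt rep_dq dq_rep).
  have gF : g j \notin F by rewrite -ei iF.
  by rewrite /row -ei; have /dq_eq0 -> := rep_dq v hv; rewrite ?iF.
- by rewrite tr8.
split; first by exists M; rewrite tr8.
by move=> a b; rewrite ts8 -t6.
Qed.

Lemma stage_spec F t s : inv F t s -> R s rst = t -> t < n ->
  exists F', inv F' t.+1 (exec w stage s) /\
   (size F < size F' /\ (exists2 v, v < n & 0 < T s tnewdeg v 0) \/
    F' = F /\ forall v, v < n -> T (exec w stage s) tnewdeg v 0 = 0).
Proof.
move=> I ht tn; have szF := inv_size I.
have [[bs hk hre uF] nc lab rP [[N [LN NP]] st]] := I; have [b0 b1 b2 b3] := bs.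
rewrite /stage exec_seq exec_add ht b1 (incE n_lt) //; set s1 := setr s rst1 _.
have bs1 : base s1 by [].
have [M1 M2 M3] := max_degree_spec n_gt0 bs1.
rewrite exec_seq.
have bs2 := base_exec (c := max_degree) isT bs1.
have G := exec_frame w max_degree s1.
have k2 : R (exec w max_degree s1) rk = size F by rewrite G.1.
have m2 : R (exec w max_degree s1) rrem = n - size F by rewrite G.1.
have t2 : R (exec w max_degree s1) rst1 = t.+1 by rewrite G.1.
have T2 x : T (exec w max_degree s1) x = T s x by rewrite G.2.
move: (exec w max_degree s1) M1 M2 M3 bs2 k2 m2 t2 T2 {G} => s2 M1 M2 M3 bs2 k2 m2 t2 T2.
have I2 : inv F t s2.
  split=> //; rewrite /labelled ?T2 //; split; rewrite ?T2 //.
  by exists N; split=> // a; rewrite !T2; apply: LN.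
rewrite exec_if /test; have [_ _ -> _] := bs2; case: (posnP (R s2 rD)) => D0.
  exists F; split; last by right; split=> // v /M1; rewrite D0 leqn0 ?exec_skip T2 => /eqP.
  by rewrite ?exec_skip; case: I2 => A1 A2 A3 A4 [A5 A6]; split=> //; split=> // a b; apply: leqW.
have N_r : size (N (R s2 rr)) = R s2 rD by rewrite -(LN _ M2).1; apply: M3.
have [g gP] := star_coords NP M2 N_r D0.
have live_r : alive n (fun v => T s trep v 0) (R s2 rr).
  have : nth 0 (N (R s2 rr)) 0 \in N (R s2 rr) by rewrite mem_nth // N_r.
  by move/((NP _ M2).2 _) => [].
(* The enlarged list still consists of distinct nonconstant coordinates, so it is shorter than [n]:
   on a partial cube the test of [rrem] never blocks a contraction. *)
have room : size (F ++ [seq g i | i <- iota 0 (R s2 rD)]) < n.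
  apply: (nonconstant_lt n_gt0 edge_dq geodesic).
    exact: (uniq_new rP NP live_r N_r gP).
  move=> i; rewrite mem_cat => /orP[/nc //|/mapP[j]]; rewrite mem_iota add0n /= => hj ->.
  exact: (G_nonconstant NP live_r N_r gP hj).
rewrite size_cat size_map size_iota in room.
have hrem : ~~ (R s2 rrem < R s2 rD) by rewrite m2; lia.
rewrite exec_if /test (negbTE hrem).
have hmax v : v < n -> T s2 tnewdeg v 0 <= R s2 rD by rewrite T2; apply: M1.
have hdeg : T s2 tnewdeg (R s2 rr) 0 = R s2 rD by rewrite T2; apply: M3.
have [F' [h I']] := contract_spec I2 t2 M2 D0 hmax hdeg hrem.
by exists F'; split=> //; left; split=> //; exists (R s2 rr); rewrite // M3.
Qed.

Lemma stages_spec s : inv [::] 0 s ->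
  exists F, [/\ inv F n (exec w stages s) &
    forall u v, u < n -> v < n -> dq F u v = 0].
Proof.
move=> I; have [[bs _ _ _] _ _ _ _] := I; have [hn _ _ _] := bs.
(* Every stage lengthens [F] or finds no edges left. As [size F < n], after [n] stages the second
   case holds; a contracted graph without edges is a single vertex by [live_step]. *)
pose J t s := exists F, inv F t s /\
  (t <= size F \/ forall v, v < n -> T s tnewdeg v 0 = 0).
suff [F [I' h]] : J n (exec w stages s).
  exists F; split=> // u v hu hv; have szF := inv_size I'.
  case: I' => _ _ _ rP [[N [LN NP]] _].
  case: h => [|h]; first by rewrite leqNgt szF.
  have [rep_lt rep_dq dq_rep] := rP.
  case: (posnP (dq F u v)) => // d0.
  have lu := live_rep rep_lt rep_dq dq_rep hu.
  rewrite (eq_dq _ (rep_dq u hu)) in d0.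
  have [b [i [lb fl _]]] := live_step edge_dq geodesic rep_lt rep_dq dq_rep lu hv d0.
  have hru := rep_lt u hu.
  have : b \in N (T (exec w stages s) trep u 0).
    by apply/(NP _ hru).2; split=> //; apply/dq_eq1; exists i.
  by have := h _ hru; rewrite (LN _ hru).1 => /size0nil ->.
apply: (@for_base n w n J) => //.
  by exists [::]; split; last by left.
move=> t s1 ht et Fr bs1 [F [I1 h]].
have [F' [I2 h2]] := stage_spec I1 et ht.
exists F'; split=> //.
case: h2 => [[h2 [v hv]]|[eF h2]]; last by right.
case: h => [h|->] //; by left; apply: leq_ltn_trans h h2.
Qed.

Lemma dq1_edge u v : u < n -> v < n -> dq [::] u v = 1 -> A u v.
Proof.
move=> hu hv d1; have uv : u <> v by move=> e; rewrite e dqxx in d1.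
have [x [hx ax]] := geodesic hu hv uv; rewrite d1 ltnS leqn0 => /eqP d0.
case: (x =P v) => [<- //|xv]; have [y [_ _]] := geodesic hx hv xv.
by rewrite d0.
Qed.

Lemma labeller_spec s :
  base s -> R s rk = 0 -> R s rrem = n ->
  (forall u v, u < n -> v < n -> T s tA u v = A u v) ->
  (forall t i j, 0 < t -> T s t i j = 0) ->
  let s' := exec w (init_lists ;; stages) s in
  exists k, R s' rk = k /\ k <= n /\ valid n k A (T s' tL).
Proof.
move=> bs hk hr hA fresh /=; rewrite exec_seq.
have [LN E] := init_lists_spec n_gt0 n_lt bs hA (fun u => fresh tnewdeg u 0 isT).
have bs1 := base_exec (c := init_lists) isT bs.
have G := exec_frame w init_lists s.
have inj u v : u < n -> v < n -> dq [::] u v = 0 -> u = v.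
  move=> hu hv d0; apply/eqP/negPn/negP => /eqP uv.
  by have [x [_ _]] := geodesic hu hv uv; rewrite d0.
have rP : reps [::] (fun v => T (exec w init_lists s) trep v 0).
  by split=> [v hv|v hv|u v hu hv]; rewrite !E ?dqxx //; apply: inj.
have I : inv [::] 0 (exec w init_lists s).
  split=> //.
  - by rewrite !G.1 // subn0.
  - split; first by exists (fun=> false).
    by move=> v c _ _; rewrite G.2 ?fresh.
  split; last by move=> a b; rewrite G.2 ?fresh.
  eexists; split; first exact: LN.
  move=> a ha; split; first exact/filter_uniq/iota_uniq.
  move=> b; rewrite mem_filter mem_iota /= add0n; split=> [/andP[ab hb]|[la lb d1]].
    by rewrite /alive !E // !eqxx ha hb edge_dq.
  by have /andP[hb _] := lb; rewrite hb andbT dq1_edge.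
have [F [I' d0]] := stages_spec I.
move: (exec w stages _) I' => s1 I'; exists (size F); have szF := inv_size I'.
case: I' => -[_ -> _ uF] _ [[be lab] _] _ _; split=> //; split; first exact: ltnW.
have labE v (c : 'I_(size F)) : v < n ->
    T s1 tL v c = (l v (tnth (in_tuple F) c) != be (tnth (in_tuple F) c)).
  move=> hv; rewrite -lab ?mem_tnth // (tnth_nth (tnth (in_tuple F) c)) /=.
  by rewrite index_uniq.
(* The complements cancel, and by [d0] the coordinates outside [F] separate no vertices. *)
have hdE u v : u < n -> v < n -> hd (size F) (T s1 tL u) (T s1 tL v) = dq [::] u v.
  move=> hu hv; rewrite /hd.
  transitivity (\sum_(i <- F) (l u i != l v i)).
    rewrite big_tnth; apply: eq_bigr => c _; rewrite !labE //.
    by case: (l u _) (l v _) (be _) => [] [] [].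
  rewrite big_uniq //= /dq -sum1_card big_mkcond [RHS]big_mkcond /=.
  apply: eq_bigr => i _; rewrite inE /=; case iF: (i \in F); first by case: (_ != _).
  by have /dq_eq0 -> := d0 u v hu hv; rewrite ?iF ?eqxx.
split.
- by move=> u i hu hi; rewrite (labE u (Ordinal hi) hu); case: (_ != _).
- by move=> u v hu hv auv; rewrite hdE // edge_dq.
move=> u v hu hv uv; have [x [hx ax lx]] := geodesic hu hv uv.
by exists x; split=> //; rewrite !hdE.
Qed.

End Cube.

(** * Running time *)

Definition weight := cost_bound (fun=> 1).

Fixpoint depth (p : pred nat) (c : cmd) : nat :=
  match c with
  | Seq c d | If _ _ _ c d => maxn (depth p c) (depth p d)
  | For x y c => p y + depth p c
  | _ => 0
  end.

(** The bound is a polynomial in [n] and [D] with nonnegative coefficients. Its degrees are at most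
    the nesting depths of the two kinds of loops, and its value at 1, the sum of the coefficients,
    is [weight]. *)
Lemma cost_bound_le n D c : 0 < n -> 0 < D ->
  cost_bound (fun y => if y == rD then D else n) c <=
  weight c * (n ^ depth (predC1 rD) c * D ^ depth (pred1 rD) c).
Proof.
move=> n0 D0; set env := fun y => _.
have mon a b a' b' : a <= a' -> b <= b' -> n ^ a * D ^ b <= n ^ a' * D ^ b'.
  by move=> h1 h2; apply: leq_mul; apply: leq_pexp2l.
have seq c1 c2 B1 B2 W1 W2 : B1 <= W1 * (n ^ depth (predC1 rD) c1 * D ^ depth (pred1 rD) c1) ->
   B2 <= W2 * (n ^ depth (predC1 rD) c2 * D ^ depth (pred1 rD) c2) ->
   B1 + B2 <= (W1 + W2) * (n ^ maxn (depth (predC1 rD) c1) (depth (predC1 rD) c2) *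
     D ^ maxn (depth (pred1 rD) c1) (depth (pred1 rD) c2)).
  move=> h1 h2; rewrite mulnDl; apply: leq_add.
    by apply: leq_trans h1 _; rewrite leq_mul2l mon ?leq_maxl ?orbT.
  by apply: leq_trans h2 _; rewrite leq_mul2l mon ?leq_maxr ?orbT.
elim: c => //= [c1 IH1 c2 IH2|lt y z c1 IH1 c2 IH2|x y c IH]; first exact: seq.
  have := seq _ _ _ _ _ _ IH1 IH2; set X := n ^ _ * D ^ _ => h.
  rewrite /weight /= -/(weight c1) -/(weight c2) mulnDl; apply: leq_add h.
  by rewrite leq_pmulr // muln_gt0 !expn_gt0 n0 D0.
set X := n ^ _ * D ^ _ in IH.
have X0 : 0 < X by rewrite muln_gt0 !expn_gt0 n0 D0.
have -> : n ^ ((y != rD) + depth (predC1 rD) c) * D ^ ((y == rD) + depth (pred1 rD) c) = env y * X.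
  by rewrite /env /X; case: (y == rD); rewrite !expnD /=; lia.
rewrite /weight /= -/(weight c).
have e0 : 0 < env y by rewrite /env; case: ifP.
move: (cost_bound env c) (weight c) (env y) X IH X0 e0 => B W e X IH X0 e0.
nia.
Qed.

Section Time.

Variables n w : nat.
Hypotheses (n_gt0 : 0 < n) (n_lt : n < 2 ^ w).
Implicit Types s : state.
Notation base := (base n w).

Lemma cost_le2 D c s : 0 < D ->
  all (fun y => y \notin wr c) (bounds c) ->
  {in bounds c, forall y, R s y <= if y == rD then D else n} ->
  cost w c s <= weight c * (n ^ depth (predC1 rD) c * D ^ depth (pred1 rD) c).
Proof.
move=> D0 /allP H1 H2.
apply: leq_trans (cost_bound_le c n_gt0 D0); apply: cost_le => y hy.
by split; [apply: H1 | apply: H2].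
Qed.

(* The potential that pays for relabelling: the number of vertices of the
   contracted graph. *)
Definition classes s := size (undup [seq T s trep v 0 | v <- iota 0 n]).

Lemma classes_le s : classes s <= n.
Proof. by rewrite -[X in _ <= X](size_iota 0) -(size_map (fun v => T s trep v 0)) size_undup. Qed.

Lemma classes_frame c s : trep \notin wt c -> classes (exec w c s) = classes s.
Proof. by move=> h; rewrite /classes exec_wt. Qed.

(** The value [R s rp1] disappears from the representatives, and no value appears that was not there
    before. *)
Lemma classes_relabel s u v : base s -> u < n -> v < n ->
  T s trep u 0 = R s rp1 -> T s trep v 0 = R s rp2 -> R s rp1 <> R s rp2 ->
  classes (exec w relabel s) < classes s.
Proof.
move=> bs hu hv eu ev ne; rewrite /classes.
have E := relabel_spec bs.
set L := [seq T s trep v 0 | v <- iota 0 n].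
have inL x : x < n -> T s trep x 0 \in L by move=> hx; apply: map_f; rewrite mem_iota.
have := @uniq_leq_size _
  (R s rp1 :: undup [seq T (exec w relabel s) trep v 0 | v <- iota 0 n]) (undup L).
apply.
  rewrite /= undup_uniq andbT mem_undup; apply/mapP => -[x]; rewrite mem_iota add0n /= => hx.
  by rewrite E //; case: eqP => // h1 h2; apply: h1.
move=> y; rewrite inE !mem_undup => /predU1P[->|/mapP[x]]; first by rewrite -eu inL.
by rewrite mem_iota add0n /= => hx ->; rewrite E //; case: ifP => _; rewrite ?inL // -ev inL.
Qed.

Definition wrel := weight relabel.
Definition pot s := wrel * n * classes s.

(** A relabelling costs at most [wrel * n], which is what the potential releases when one class
    disappears; the 12 pays for the other instructions. *)
Lemma unite_edge_cost s : base s -> R s ru < n ->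
  cost w unite_edge s + pot (exec w unite_edge s) <= 12 + pot s.
Proof.
move=> bs hu; have [hn h1 hz _] := bs; rewrite /unite_edge.
have cS c d s' : cost w (c ;; d) s' = cost w c s' + cost w d (exec w c s') by [].
have cI lt y z c d s' : cost w (If lt y z c d) s' =
  2 + (if test lt y z s' then cost w c s' else cost w d s') by [].
have cO i s' : cost w (Op i) s' = 1 by [].
have cK s' : cost w Skip s' = 0 by [].
rewrite !cS !cO !exec_seq !cI !exec_if !cK !cS !cO !exec_seq !cI !exec_if !cK !exec_lk !exec_skip.
set s1 := setr _ rb _; set s2 := setr _ rp2 _.
have P1 : pot s1 = pot s by [].
have P2 : pot s2 = pot s by [].
case: ifP => _; first by rewrite P1; lia.
case: ifP => [lt|_]; last by rewrite P1; lia.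
case: ifP => [_|/eqP ne]; first by rewrite P2; lia.
have cr : cost w relabel s2 <= wrel * n.
  have := @cost_le2 1 relabel s2 isT isT; rewrite muln1 expn1; apply=> y.
  by rewrite inE => /eqP -> /=; rewrite hn.
have bs2 : base s2 by [].
have hv2 : R s2 rv < n by move: lt; rewrite /test /= hn.
have hl := classes_relabel bs2 hu hv2.
have {}hl : classes (exec w relabel s2) < classes s2.
  by apply: hl => //=; rewrite ?hz.
have : wrel * n * (classes (exec w relabel s2)).+1 <= pot s2 by rewrite /pot leq_mul2l hl orbT.
rewrite P2 /pot mulnS; lia.
Qed.

Lemma unite_row_cost s : base s -> R s ru < n ->
  cost w unite_row s + pot (exec w unite_row s) <= 3 + R s rD * 17 + pot s.
Proof.
move=> bs hu.
apply: (@for_cost w 14 pot (fun _ _ => True)) => // i s' hi ei Fr _; split=> //.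
have bs' := base_frame Fr isT bs.
rewrite [cost w _ s']/(2 + (if test LT rj rg s' then cost w unite_edge s' else 0)).
rewrite -[pot (setr _ _ _)]/(pot (exec w (when LT rj rg unite_edge) s')) exec_if.
case: ifP => _; last by rewrite exec_skip; lia.
have := @unite_edge_cost s' bs'; rewrite Fr.1 // => /(_ hu); lia.
Qed.

Lemma unite_cost s : base s -> 0 < R s rD ->
  cost w unite s + pot (exec w unite s) <= 28 * (n * R s rD) + pot s.
Proof.
move=> bs D0; have [hn _ _ _] := bs.
(* The 17 is 3 for a round, 2 for the guard and 12 for the edge; the 5 is two lookups and the 3 of
   the inner loop. The sum is at most [28 * (n * D)] as [n] and [D] are positive. *)
apply: (@leq_trans (3 + R s rn * (3 + (5 + R s rD * 17)) + pot s)); last by rewrite hn; nia.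
apply: (@for_cost w (5 + R s rD * 17) pot (fun _ _ => True)) => // i s' hi ei Fr _; split=> //.
have bs' := base_frame Fr isT bs.
set s2 := exec w (lk ra tsz ru rzero) (exec w (lk rg tdeg ru rzero) s').
have -> : cost w (lk rg tdeg ru rzero ;; lk ra tsz ru rzero ;; unite_row) s' =
  1 + (1 + cost w unite_row s2) by [].
rewrite -[pot (setr _ _ _)]/(pot (exec w unite_row s2)).
have bs2 : base s2 by [].
have u2 : R s2 ru < n by rewrite /s2 /= ei -hn.
have := unite_row_cost bs2 u2; have -> : R s2 rD = R s rD by rewrite /s2 /= Fr.1.
rewrite -[pot s2]/(pot s'); lia.
Qed.

Definition wcon := weight copy_lists + weight star + weight bfs + weight rows +
  weight spread + weight rebuild + weight finish + 28.

(** No partial cube is assumed here. Only [unite] writes [trep], so all other subroutines leave the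
    potential unchanged and cost a multiple of [n * D] by their loop structure. *)
Lemma contract_cost s : base s -> 0 < R s rD -> R s rD <= R s rrem -> R s rk + R s rrem = n ->
  let s' := exec w contract s in
  [/\ cost w contract s + pot s' <= wcon * (n * R s rD) + pot s,
      R s' rrem = R s rrem - R s rD & R s' rk + R s' rrem = n].
Proof.
move=> bs D0 hD hk; have [hn _ _ _] := bs; set D := R s rD in D0 hD *.
have nD : 0 < n * D by rewrite muln_gt0 n_gt0.
have part c s' : all (fun y => y \notin wr c) (bounds c) -> 
    all (fun y => y \in [:: rn; rD]) (bounds c) -> R s' rn = n -> R s' rD = D ->
    depth (predC1 rD) c <= 1 -> depth (pred1 rD) c <= 1 ->
    cost w c s' <= weight c * (n * D).
  move=> h1 /allP h2 hn' hD' d1 d2.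
  apply: leq_trans (@cost_le2 D c s' D0 h1 _) _.
    by move=> y /h2; rewrite !inE => /orP[]/eqP -> /=; rewrite ?hn' ?hD'.
  rewrite leq_mul2l; apply/orP; right; apply: leq_mul; rewrite -[X in _ <= X]expn1.
    by apply: leq_pexp2l.
  by apply: leq_pexp2l.
set s1 := exec w copy_lists s; set s2 := exec w star s1; set s3 := exec w bfs s2.
set s4 := exec w rows s3; set s5 := exec w spread s4; set s6 := exec w unite s5.
set s7 := exec w rebuild s6.
have -> : cost w contract s = cost w copy_lists s + (cost w star s1 + (cost w bfs s2 +
  (cost w rows s3 + (cost w spread s4 + (cost w unite s5 + (cost w rebuild s6 +
   cost w finish s7)))))) by [].
have -> : exec w contract s = exec w finish s7 by [].
have step c s' : all (fun z => z \notin wr c) [:: rn; rone; rzero; rmone; rD; rk; rrem] ->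
   base s' /\ [/\ R s' rD = D, R s' rk = R s rk & R s' rrem = R s rrem] ->
   base (exec w c s') /\ [/\ R (exec w c s') rD = D, R (exec w c s') rk = R s rk &
       R (exec w c s') rrem = R s rrem].
  move=> /= /and5P[h0 h1 h2 h3 /and4P[h4 h5 h6 _]] [bs' [e1 e2 e3]].
  by split; [apply: base_exec; rewrite //= h0 h1 h2 h3 | rewrite !exec_wr].
have i1 : base s1 /\ _ := @step copy_lists s isT (conj bs (And3 erefl erefl erefl)).
have i2 : base s2 /\ _ := @step star s1 isT i1.
have i3 : base s3 /\ _ := @step bfs s2 isT i2.
have i4 : base s4 /\ _ := @step rows s3 isT i3.
have i5 : base s5 /\ _ := @step spread s4 isT i4.
have i6 : base s6 /\ _ := @step unite s5 isT i5.
have i7 : base s7 /\ _ := @step rebuild s6 isT i6.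
have b' s' : base s' -> R s' rn = n by case.
have [bs7 [D7 k7 m7]] := i7.
have [||K1 K2] := finish_spec n_gt0 n_lt bs7; rewrite ?D7 ?k7 ?m7 //.
rewrite D7 k7 in K1; rewrite D7 m7 in K2.
split; last by rewrite K1 K2; lia.
  have c1 := part copy_lists s isT isT hn erefl isT isT.
  have c2 := part star s1 isT isT (b' _ i1.1) (let: And3 x _ _ := i1.2 in x) isT isT.
  have c3 := part bfs s2 isT isT (b' _ i2.1) (let: And3 x _ _ := i2.2 in x) isT isT.
  have c4 := part rows s3 isT isT (b' _ i3.1) (let: And3 x _ _ := i3.2 in x) isT isT.
  have c5 := part spread s4 isT isT (b' _ i4.1) (let: And3 x _ _ := i4.2 in x) isT isT.
  have c7 := part rebuild s6 isT isT (b' _ i6.1) (let: And3 x _ _ := i6.2 in x) isT isT.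
  have c8 := part finish s7 isT isT (b' _ i7.1) D7 isT isT.
  have D5 : R s5 rD = D by case: i5 => _ [].
  have := @unite_cost s5 i5.1; rewrite D5 -/s6 => /(_ D0) c6.
  have p8 : pot (exec w finish s7) = pot s6.
    by rewrite /pot classes_frame // /s7 classes_frame.
  have p5 : pot s5 = pot s by rewrite /pot /s5 /s4 /s3 /s2 /s1 !classes_frame.
  rewrite p8 /wcon; rewrite p5 in c6; move: c1 c2 c3 c4 c5 c6 c7 c8.
  move: (cost w copy_lists s) (cost w star s1) (cost w bfs s2) (cost w rows s3).
  move: (cost w spread s4) (cost w unite s5) (cost w rebuild s6) (cost w finish s7).
  move: (weight copy_lists) (weight star) (weight bfs) (weight rows) => w1 w2 w3 w4.
  move: (weight spread) (weight rebuild) (weight finish) (pot s6) (pot s) => w5 w7 w8 p p'.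
  by move: (n * D) => X; rewrite !mulnDl; lia.
by [].
Qed.

Definition wst := weight max_degree + 5.
(** A contraction lowers [rrem] by [D] and thereby releases [wcon * n * D], the cost of the stage
    apart from relabelling. *)
Definition tpot s := wcon * n * R s rrem + pot s.

Lemma stage_cost s : base s -> R s rk + R s rrem = n ->
  let s' := exec w stage s in
  R s' rk + R s' rrem = n /\ cost w stage s + tpot s' <= wst * n + tpot s.
Proof.
move=> bs hk /=; have [hn _ _ _] := bs.
set s1 := exec w (add rst1 rst rone) s; set s2 := exec w max_degree s1.
have -> : cost w stage s = 1 + (cost w max_degree s1 + (2 + (if test LT rzero rD s2
  then 2 + (if test LT rrem rD s2 then 0 else cost w contract s2) else 0))) by [].
have -> : exec w stage s = (if test LT rzero rD s2 then
  if test LT rrem rD s2 then s2 else exec w contract s2 else s2) by [].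
have bs1 : base s1 by [].
have bs2 : base s2 := base_exec (c := max_degree) isT bs1.
have k2 : R s2 rk = R s rk by rewrite /s2 exec_wr.
have m2 : R s2 rrem = R s rrem by rewrite /s2 exec_wr.
have p2 : pot s2 = pot s by rewrite /pot /s2 classes_frame.
have t2 : tpot s2 = tpot s by rewrite /tpot m2 p2.
have c2 : cost w max_degree s1 <= weight max_degree * n.
  have := @cost_le2 1 max_degree s1 isT isT; rewrite muln1 expn1; apply=> y.
  by rewrite inE => /eqP -> /=; rewrite hn.
have cn : weight max_degree * n + 5 <= wst * n.
  by rewrite /wst; move: (weight _) => W; rewrite mulnDl leq_add2l leq_pmulr.
have -> : test LT rzero rD s2 = (0 < R s2 rD) by case: bs2 => _ _ z2 _; rewrite /test z2.
case: (posnP (R s2 rD)) => D0; first by rewrite k2 m2 t2; split=> //; lia.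
case: ifP => h; first by rewrite k2 m2 t2; split=> //; lia.
have hD : R s2 rD <= R s2 rrem by rewrite leqNgt; apply/negP; rewrite -/(test LT rrem rD s2) h.
have [|C1 C2 C3] := contract_cost bs2 D0 hD; first by rewrite k2 m2.
split=> //; rewrite -t2 /tpot C2.
have : wcon * n * (R s2 rrem - R s2 rD) + wcon * (n * R s2 rD) = wcon * n * R s2 rrem.
  by rewrite mulnA -mulnDr subnK.
lia.
Qed.

(** The initial potential is at most [(wcon + wrel) * n ^ 2], and each of the [n] stages adds a
    multiple of [n] for finding the maximum degree. The invariant [k + rrem = n] gives [k <= n] for
    every input, as the checker requires. *)
Lemma stages_cost s : base s -> R s rk = 0 -> R s rrem = n ->
  let s' := exec w stages s in
  R s' rk <= n /\ cost w stages s <= (wst + wcon + wrel + 6) * n ^ 2.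
Proof.
move=> bs hk hr /=; have [hn _ _ _] := bs.
have I s' : frame stages s s' -> base s' by move=> Fr; apply: base_frame Fr isT bs.
split.
  suff : R (exec w stages s) rk + R (exec w stages s) rrem = n by lia.
  apply: (@for_base n w n (fun _ s1 => R s1 rk + R s1 rrem = n)) => //.
    by rewrite /= hk hr.
  by move=> i s' hi ei Fr bs' e; have [] := stage_cost bs' e.
have := @for_cost w (wst * n) tpot (fun _ s1 => R s1 rk + R s1 rrem = n) rst rn stage s.
rewrite -/stages hn => H.
have {}H : cost w stages s <= 3 + n * (3 + wst * n) + tpot s.
  apply: leq_trans (leq_addr _ _) (H _ _ _) => //=; first by rewrite hk hr.
  move=> i s' hi ei Fr e; have bs' := I s' Fr.
  by have [h1 h2] := stage_cost bs' e.
have := classes_le s; move: H; rewrite /tpot hr /pot.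
move: wst wcon wrel (classes s) (cost w stages s) => a b c d e; nia.
Qed.

Definition wtotal := weight init_lists + (wst + wcon + wrel + 6) + weight checker + 4.

Lemma main_cost s : R s rn = n -> R s rone = 1 -> R s rzero = 0 -> R s rk = 0 ->
  cost w main s <= wtotal * n ^ 2.
Proof.
move=> hn h1 hz hk.
set s1 := exec w init_const s; set s2 := exec w init_lists s1.
have -> : cost w main s = 2 + (cost w init_lists s1 + cost w stages s2) +
  (cost w checker (exec w stages s2) + 1) by [].
have bs1 : base s1.
  by rewrite /s1 /init_const !exec_seq exec_mov; split; rewrite /= ?hn ?h1 ?hz ?subn0.
have r1 : R s1 rrem = n by rewrite /s1 /init_const !exec_seq exec_mov /= hn.
have bs2 : base s2 := base_exec (c := init_lists) isT bs1.
have k2 : R s2 rk = 0 by rewrite /s2 exec_wr // /s1 exec_wr.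
have r2 : R s2 rrem = n by rewrite /s2 exec_wr.
have [k3 c3] := stages_cost bs2 k2 r2.
set s3 := exec w stages s2 in k3 *.
have bs3 : base s3 := base_exec (c := stages) isT bs2.
have c2 : cost w init_lists s1 <= weight init_lists * n ^ 2.
  have := @cost_le2 1 init_lists s1 isT isT; rewrite muln1; apply=> y.
  by case: bs1 => h _ _ _; rewrite !inE => /orP[]/eqP ->; apply: eq_leq; exact: h.
have c4 : cost w checker s3 <= weight checker * n ^ 2.
  have := @cost_le2 1 checker s3 isT isT; rewrite muln1; apply=> y hy.
  have : y \in [:: rn; rk] by apply: (allP (isT : all (mem [:: rn; rk]) (bounds checker))).
  by case: bs3 => h _ _ _; rewrite !inE => /orP[]/eqP ->; [apply: eq_leq; exact: h | exact: k3].
rewrite /wtotal; have n2 : 0 < n ^ 2 by rewrite expn_gt0 n_gt0.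
move: c2 c3 c4 n2; move: (weight init_lists) (weight checker) (wst + _ + _ + _) (n ^ 2).
move: (cost w init_lists s1) (cost w stages s2) (cost w checker s3) => a b c d e f X.
by rewrite !mulnDl; lia.
Qed.

End Time.

(** * The theorem *)

Section Hamming.

Variable k : nat.
Implicit Types a b c : k.-tuple bool.

Lemma hammingxx a : hamming a a = 0.
Proof. by apply: eq_card0 => i; rewrite !inE eqxx. Qed.

Lemma hamming_triangle a b c : hamming a c <= hamming a b + hamming b c.
Proof.
rewrite /hamming -cardsUI; apply: leq_trans (leq_addr _ _).
apply: subset_leq_card; apply/subsetP => i; rewrite !inE.
by case: (tnth a i) (tnth b i) (tnth c i) => [] [] [].
Qed.

Lemma hamming_sum a b : hamming a b = \sum_(i < k) (tnth a i != tnth b i).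
Proof. by rewrite /hamming -sum1dep_card big_mkcond /=; apply: eq_bigr => i _; case: ifP. Qed.

End Hamming.

Section Graph.

Variables (V : finType) (e : rel V) (k : nat) (lab : V -> k.-tuple bool).
Hypothesis e_irr : irreflexive e.

(** The second vertex of a shortest path from [u] to [v] is the closer neighbour; a single edge is a
    path of length 1, and length 0 is impossible between distinct vertices. *)
Lemma labeling_step : partial_cube_labeling e lab ->
  (forall u v, e u v -> hamming (lab u) (lab v) = 1) /\
  (forall u v, u <> v ->
     exists2 x, e u x & hamming (lab x) (lab v) < hamming (lab u) (lab v)).
Proof.
move=> P; split=> [u v uv|u v uv]; have [[p [pp pl pu] sp] m] := P u v.
  have ne : u <> v by move=> E; rewrite E e_irr in uv.
  have : hamming (lab u) (lab v) <= 1.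
    by apply: (m [:: v]); split=> //=; rewrite ?uv // inE andbT; apply/eqP.
  by case: p pl sp {pp pu} => [|x p] /= pl sp; [case: ne | rewrite -sp; case: p {pl sp}].
case: p pp pl pu sp => [|x p] /=; first by move=> _ E; case: uv.
move=> /andP[ux pp] pl /andP[_ pu] <-; exists x => //.
by have [_ m'] := P x v; rewrite ltnS; apply: m'.
Qed.

Lemma step_labeling :
  (forall u v, e u v -> hamming (lab u) (lab v) = 1) ->
  (forall u v, u <> v ->
     exists2 x, e u x & hamming (lab x) (lab v) < hamming (lab u) (lab v)) ->
  partial_cube_labeling e lab.
Proof.
move=> H1 H2.
have lower u p : path e u p -> hamming (lab u) (lab (last u p)) <= size p.
  elim: p u => [|x p IH] u /=; first by rewrite hammingxx.
  move=> /andP[/H1 ux /IH h]; apply: leq_trans (hamming_triangle _ (lab x) _) _.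
  by rewrite ux add1n ltnS.
have walk u v : exists p, [/\ path e u p, last u p = v & size p <= hamming (lab u) (lab v)].
  have [m] := ubnP (hamming (lab u) (lab v)); elim: m u => // m IH u hm.
  case: (u =P v) => [->|uv]; first by exists [::].
  have [x ux lx] := H2 u v uv; have [|p [pp pl sp]] := IH x; first exact: leq_trans lx _.
  by exists (x :: p); rewrite /= ux; split=> //; apply: leq_ltn_trans sp lx.
move=> u v; split; last by move=> p [pp <- _]; apply: lower.
(* Paths must not repeat vertices, so the walk is shortened; by the lower bound its length cannot
   drop below the Hamming distance. *)
have [p [pp pl sp]] := walk u v; case/shortenP: pp pl sp => p' pp' pu' sub pl sp.
have sp' : size p' <= size p by apply: uniq_leq_size => //; case/andP: pu'.
exists p'; first by split.
apply/eqP; rewrite eqn_leq (leq_trans sp' sp) /=.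
by rewrite -pl; apply: lower.
Qed.

End Graph.

(* The trivial graph is accepted at once: for [n = 0] the words may have no
   bits, and then the constant 1 does not fit. *)
Definition wrap (p : seq instr) : program :=
  JumpEq rn rzero (size p + 4) :: Const rone 1 :: p ++
  [:: JumpEq rok rone (size p + 4); Halt false; Halt true].

Lemma onth_wrap p i : i < 3 ->
  onth (wrap p) (i + (size p + 2)) =
  onth [:: JumpEq rok rone (size p + 4); Halt false; Halt true] i.
Proof.
move=> hi; have -> : i + (size p + 2) = (i + size p).+2 by lia.
rewrite /= onth_cat.
by rewrite ltnNge leq_addl /= addnK.
Qed.

Lemma code_at_wrap p : code_at (wrap p) 2 p.
Proof. by move=> i hi; rewrite /wrap add2n /= onth_cat hi. Qed.

Section Final.

Variables (n w : nat) (e : rel 'I_n).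
Hypotheses (n_lt : n < 2 ^ w) (e_sym : symmetric e) (e_irr : irreflexive e).

Definition adj u v :=
  match insub u, insub v with Some x, Some y => e x y | _, _ => false end.

Lemma adjE (x y : 'I_n) : adj x y = e x y.
Proof. by rewrite /adj !valK. Qed.

Definition st0 := State (reg (input e)) (tab (input e)).
Definition st1 := setr st0 rone (1 %% 2 ^ w).

Hypothesis n_gt0 : 0 < n.

Lemma st1_run p : run w (wrap p) 2 (input e) = cfg 2 st1.
Proof.
rewrite /run /= /step /=; have -> : (n == 0) = false by rewrite gtn_eqF.
by [].
Qed.

Lemma w_gt1 : 1 < 2 ^ w.
Proof. exact: leq_ltn_trans n_gt0 n_lt. Qed.

Lemma st1_range : in_range w st1.
Proof.
have w1 := w_gt1; split=> [x|t i j] /=.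
  case: ifP => _; first by rewrite ltn_mod ltnW.
  by case: ifP => _ //; apply: ltnW.
case: insubP => // [u _ _|_]; last exact: ltnW.
case: insubP => // [v _ _|_]; last exact: ltnW.
by case: (_ && _) => //; apply: ltnW.
Qed.

Lemma st1_base : [/\ R st1 rn = n, R st1 rone = 1, R st1 rzero = 0 & R st1 rk = 0].
Proof. by split=> //=; rewrite modn_small // w_gt1. Qed.

Lemma main_run p : p = compile main 2 -> exists2 t, t <= 2 + wtotal * n ^ 2 &
  run w (wrap p) t (input e) = cfg (size p + 2) (exec w main st1).
Proof.
move=> Ep; have [h0 h1 h2 h3] := st1_base.
have [] := @compile_correct w (wrap p) main 2 st1 main_wf isT.
- by rewrite -Ep; apply: code_at_wrap.
- exact: st1_range.
- exact: h1.
move=> t ht; rewrite -Ep => E.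
exists (2 + t); first by rewrite leq_add2l (leq_trans ht) // main_cost.
by rewrite runD st1_run E addnC.
Qed.

Lemma main_correct :
  let s := exec w main st1 in
  [/\ R s rone = 1,
      R s rok = 1 <-> partial_cube e &
      R s rok = 1 -> exists (k : nat) (lab : 'I_n -> k.-tuple bool),
        partial_cube_labeling e lab /\ forall pc, outputs (cfg pc s) lab].
Proof.
have [h0 h1 h2 h3] := st1_base.
set s1 := exec w init_const st1.
have -> : exec w main st1 =
  exec w (mov rn rk) (exec w checker (exec w (init_lists ;; stages) s1)) by [].
rewrite exec_mov.
have bs1 : base n w s1.
  by rewrite /s1 /init_const !exec_seq exec_mov; split; rewrite /= ?h0 ?h1 ?h2 ?subn0.
have r1 : R s1 rrem = n by rewrite /s1 /init_const !exec_seq exec_mov.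
have k1 : R s1 rk = 0 by rewrite /s1 exec_wr.
have T1 : T s1 = tab (input e) by [].
have A1 u v : u < n -> v < n -> T s1 tA u v = adj u v.
  by move=> hu hv; rewrite T1 /adj /= !insubT.
have fresh t i j : 0 < t -> T s1 t i j = 0.
  move=> ht; rewrite T1 /=; case: insubP => // u _ _; case: insubP => // v _ _.
  by rewrite gtn_eqF.
set s2 := exec w (init_lists ;; stages) s1.
have k2 : R s2 rk <= n.
  rewrite /s2 exec_seq; have bsl := base_exec (c := init_lists) isT bs1.
  by have [||//] := stages_cost n_gt0 n_lt bsl; rewrite exec_wr.
have F2 := exec_frame w (init_lists ;; stages) s1.
have cs2 : chk n w (R s2 rk) adj (T s2 tL) s2.
  split=> //; first exact: base_frame F2 isT bs1.
  by move=> u v hu hv; rewrite F2.2 ?A1.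
(* The tables of the checker are numbered after those of the labeller, which leaves them zero. *)
have fr2 t i j : tH <= t -> T s2 t i j = 0.
  move=> ht; rewrite F2.2 ?fresh //; first exact: leq_ltn_trans ht.
  have /allP H : all (fun x => x < tH) (wt (init_lists ;; stages)) by [].
  by apply/negP => /H; rewrite ltnNge ht.
have asym u v : adj u v -> adj v u.
  by rewrite /adj; case: insub => // x; case: insub => // y; rewrite e_sym.
have ok := checker_spec n_gt0 n_lt k2 asym cs2 fr2.
have F3 := exec_frame w checker s2.
have cs3 := chk_frame F3 isT isT cs2.
set k := R s2 rk in k2 cs2 ok cs3; set L := T s2 tL in cs2 ok cs3.
move: (exec w checker s2) ok cs3 {F3} => s3 ok [[c0 c1 c2 c3] ck cL _].
pose lab (u : 'I_n) := [tuple L u i != 0 | i < k].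
have hE : (forall u i, u < n -> i < k -> L u i <= 1) ->
    forall u v : 'I_n, hamming (lab u) (lab v) = hd k (L u) (L v).
  move=> bits u v; rewrite hamming_sum; apply: eq_bigr => i _; rewrite !tnth_mktuple.
  have := (bits u i (ltn_ord u) (ltn_ord i), bits v i (ltn_ord v) (ltn_ord i)).
  by case: (L u i) (L v i) => [|[|?]] [|[|?]] [].
have good : valid n k adj L -> partial_cube_labeling e lab.
  case=> bits v1 v2; apply: step_labeling => // u v.
    by move=> uv; rewrite hE // v1 // adjE.
  move=> uv; have [|x [hx ax lx]] := v2 u v (ltn_ord u) (ltn_ord v); first by move/val_inj.
  by exists (Ordinal hx); rewrite ?hE // -adjE.
split=> //=.
  rewrite ok; split=> [/good P|[K [lb P]]]; first by exists k, lab.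
  have [P1 P2] := labeling_step e_irr P.
  (* The hidden labeling is taken from the assumed one, of arbitrary length [K], and extended by
     [false] beyond the vertices. *)
  pose l v i := if insub v is Some u then tnth (lb u) i else false.
  have lE (u : 'I_n) i : l u i = tnth (lb u) i by rewrite /l valK.
  have dE (u v : 'I_n) : dq l [::] u v = hamming (lb u) (lb v).
    by apply: eq_card => i; rewrite !inE !lE.
  have ed u v : u < n -> v < n -> adj u v -> dq l [::] u v = 1.
    move=> hu hv; rewrite -[u]/(val (Ordinal hu)) -[v]/(val (Ordinal hv)) adjE dE.
    exact: P1.
  have geo u v : u < n -> v < n -> u <> v ->
     exists x, [/\ x < n, adj u x & dq l [::] x v < dq l [::] u v].
    move=> hu hv uv; have [|x ux lx] := P2 (Ordinal hu) (Ordinal hv); first by case.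
    by exists x; rewrite -[u]/(val (Ordinal hu)) -[v]/(val (Ordinal hv)) adjE !dE.
  have [k' [e1 [_ vk]]] := labeller_spec n_gt0 n_lt ed geo bs1 k1 r1 A1 fresh.
  by rewrite /k /s2 e1.
move=> /ok V; exists k, lab; split; first exact: good.
move=> pc; split=> //= u i; rewrite cL tnth_mktuple; case: V => bits _ _.
by have := bits u i (ltn_ord u) (ltn_ord i); case: (L u i) => [|[|?]].
Qed.

End Final.

Theorem theorem1 :
  exists (P : program) (T : nat -> nat),
    bigO T (fun n => n ^ 2) /\
    forall (n w : nat) (e : rel 'I_n),
      n < 2 ^ w -> symmetric e -> irreflexive e ->
      exists (t : nat) (b : bool),
        let c := run w P t (input e) in
        [/\ t <= T n,
            answer P c = Some b,
            b <-> partial_cube e &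
            b -> exists (k : nat) (lab : 'I_n -> k.-tuple bool),
                   partial_cube_labeling e lab /\ outputs c lab].
Proof.
have [p Ep] : exists p, p = compile main 2 by exists (compile main 2).
exists (wrap p), (fun n => 3 + wtotal * n ^ 2); split.
  (* Besides [main] there are two steps at the start and the final comparison; from [n = 1] on, the
     3 is absorbed by [3 * n ^ 2]. *)
  exists (3 + wtotal), 1 => n n1.
  by rewrite mulnDl leq_add2r leq_pmulr // expn_gt0 n1.
move=> n w e n_lt e_sym e_irr; case: (posnP n) => [n0|n_gt0].
  subst n; have lab0 k (lab : 'I_0 -> k.-tuple bool) : partial_cube_labeling e lab.
    by case.
  (* One jump leads to [Halt true]; the empty graph is labelled by words of length 0, and register 0
     already holds 0. *)
  exists 1, true; rewrite /run /= /step /= /jump_if /=; split=> //.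
  - by rewrite /answer [pc _]/= -[4]/(2 + 2) addnCA (@onth_wrap p 2).
  - by split=> // _; exists 0, (fun=> [tuple]).
  by move=> _; exists 0, (fun=> [tuple]); split=> //; split=> // u [].
have [t ht E] := main_run e n_lt n_gt0 Ep.
have := main_correct n_lt e_sym e_irr n_gt0.
move: (exec w main _) E => s E /= [s1 sok sout].
exists t.+1, (R s rok == 1); rewrite /run iterS -/(run w (wrap p) t _) E.
set pc' := (if R s rok == 1 then size p + 4 else (size p + 2).+1).
have -> : step w (wrap p) (cfg (size p + 2) s) = cfg pc' s.
  by rewrite /step [pc _]/= (@onth_wrap p 0) //= /jump_if /= s1.
split=> //.
- rewrite /answer [pc _]/= /pc'; case: ifP => _; last by rewrite (@onth_wrap p 1).
  by rewrite -[4]/(2 + 2) addnCA (@onth_wrap p 2).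
- by split=> [/eqP/sok|/sok/eqP].
by move=> /eqP/sout[k [lab [P out]]]; exists k, lab.
Qed.
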